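(* Let $n\ge2$, let $\mathbf T=D^n\times S^1$, and let $\mathcal F=\{C_r\times S^1\mid r\in[0,1]\}$ be the partition of $\mathbf T$ where $C_r\subset\mathbb R^n$ is the $(n-1)$-sphere of radius $r$ centered at the origin ($C_0=\{0\}$). Then the map $$\eta\colon\Omega^\infty(\mathrm{SO}(n))\times\mathrm O(n)\times\mathrm O(2)\to\mathcal D(\mathcal F),\qquad \eta(\Phi,A,B)(v,y)=(\Phi(y)Av,\ By),$$ is a homotopy equivalence.
   Context: $D^n\subset\mathbb R^n$ is the closed unit disk centered at the origin and $S^1$ is the unit circle in $\mathbb C=\mathbb R^2$, on which $\mathrm O(2)$ acts. $\mathcal D(\mathcal F)$ is the group of $C^\infty$ diffeomorphisms $h$ of $\mathbf T$ with $h(\omega)=\omega$ for each element (leaf) $\omega$ of $\mathcal F$, endowed with the $C^\infty$ Whitney topology. $\Omega^\infty(\mathrm{SO}(n))=C^\infty((S^1,1),(\mathrm{SO}(n),I))$ is the space of smooth loops in the special orthogonal group $\mathrm{SO}(n)$ at the unit matrix $I$, with the $C^\infty$ topology. *)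

(* Defs.v *)
From HB Require Import structures.
From mathcomp Require Export all_boot all_order all_algebra.
From mathcomp Require Export all_classical all_reals all_analysis.
Export numFieldNormedType.Exports.

Set Implicit Arguments.
Unset Strict Implicit.
Unset Printing Implicit Defensive.

Import Order.TTheory GRing.Theory Num.Theory.

Local Open Scope classical_set_scope.
Local Open Scope ring_scope.

Section Homotopy.
Variable R : realType.

Definition homotopic (X Y : topologicalType) (f g : X -> Y) : Prop :=
  exists H : X * R -> Y,
    [/\ {within [set: X] `*` `[0, 1], continuous H},
        forall x, H (x, 0) = f x
      & forall x, H (x, 1) = g x].

Definition homotopy_equivalence (X Y : topologicalType) (f : X -> Y) : Prop :=
  continuous f /\
  exists g : Y -> X,
    [/\ continuous g, homotopic (g \o f) idfun & homotopic (f \o g) idfun].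

End Homotopy.

Section Smooth.
Variable R : realType.

Definition iter_derive (V W : normedModType R) (s : seq V) (f : V -> W) :
  V -> W := foldr (fun v g => 'D_v g) f s.

(* On a finite-dimensional [V], this is the usual C^oo condition on an open
   [U]: all iterated directional derivatives exist and are continuous. *)
Definition smooth_on (V W : normedModType R) (U : set V) (f : V -> W) : Prop :=
  forall (s : seq V) (x : V), U x ->
    {for x, continuous (iter_derive s f)} /\
    forall v, derivable (iter_derive s f) x v.

(* A map on a subset of a vector space is smooth if near each point of the
   subset it extends to a smooth map on an open set.  On an embedded submanifold
   with boundary, this is smoothness in charts. *)
Definition smooth (V W : normedModType R) (A : set V) (f : A -> W) : Prop :=
  forall x : A, exists (U : set V) (F : V -> W),
    [/\ open U, U (set_val x), smooth_on U F
      & forall y : A, U (set_val y) -> F (set_val y) = f y].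

(* All the iterated derivatives of [f] read through a parametrization [p] that
   sends the open set [U] into [A]; the codomain carries the topology of uniform
   convergence on [U] of each of them.  (Outside [A], [f] is extended by 0,
   which does not affect the derivatives at points of [U].) *)
Definition jets (E V W : normedModType R) (U : set E) (p : E -> V) (A : set V)
    (f : A -> W) : {ptws seq E -> {uniform` U -> W}} :=
  fun s => iter_derive s ('valL_ 0 f \o p).

End Smooth.

Unset Implicit Arguments.

Section SolidTorus.
Variable R : realType.

(* The norm of the library on matrices is the sup norm. *)
Definition enorm {n} (v : 'cV[R]_n) : R := Num.sqrt (\sum_i v i 0 ^+ 2).

Definition sphere {n} (r : R) : set 'cV[R]_n := [set v | enorm v = r].

Definition disk n : set 'cV[R]_n := [set v | enorm v <= 1].

Definition circle : set 'cV[R]_2 := sphere 1.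

Definition torus n : set ('cV[R]_n * 'cV[R]_2) := disk n `*` circle.

Definition leaf {n} (r : R) : set (torus n) :=
  set_val @^-1` (sphere r `*` circle).

Definition foliation n : set (set (torus n)) := [set leaf r | r in `[0, 1]].

Definition orthogonal_group n : set 'M[R]_n := [set A | A^T *m A = 1%:M].

Definition special_orthogonal_group n : set 'M[R]_n :=
  [set A | orthogonal_group n A /\ \det A = 1].

Definition angle_pt (t : R) : 'cV[R]_2 :=
  \col_i (if i == 0 then cos t else sin t).

Lemma circle_angle_pt t : circle (angle_pt t).
Proof.
rewrite /circle /sphere /enorm /= big_ord_recl big_ord1 !mxE /=.
by rewrite cos2Dsin2 sqrtr1.
Qed.

Definition angle (t : R) : circle := SigSub (mem_set (circle_angle_pt t)).

(* [angle 0] is the complex number 1. *)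
Record smooth_loop n := SmoothLoop {
  loop_fun :> circle -> special_orthogonal_group n;
  loop_smooth : smooth (set_val \o loop_fun);
  loop_base : set_val (loop_fun (angle 0)) = 1%:M }.

HB.instance Definition _ n := gen_eqMixin (smooth_loop n).
HB.instance Definition _ n := gen_choiceMixin (smooth_loop n).

Definition loop_jets {n} (Phi : smooth_loop n) :=
  jets [set: R] angle_pt (set_val \o Phi).

HB.instance Definition _ n :=
  Topological.copy (smooth_loop n) (initial_topology (@loop_jets n)).

Record leaf_diffeo n := LeafDiffeo {
  diffeo_fun :> torus n -> torus n;
  diffeo_smooth : smooth (set_val \o diffeo_fun);
  diffeo_inv : exists g : torus n -> torus n,
    [/\ cancel diffeo_fun g, cancel g diffeo_fun & smooth (set_val \o g)];
  diffeo_leaf : forall L, foliation n L -> diffeo_fun @` L = L }.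

HB.instance Definition _ n := gen_eqMixin (leaf_diffeo n).
HB.instance Definition _ n := gen_choiceMixin (leaf_diffeo n).

Definition torus_pt {n} (x : 'cV[R]_n * R) : 'cV[R]_n * 'cV[R]_2 :=
  (x.1, angle_pt x.2).

(* For a smooth map, uniform convergence of a derivative on the interior of the
   disk is the same as on the closed disk, and the interior avoids choosing
   derivatives at boundary points.  As the solid torus is compact, this is the
   Whitney topology. *)
Definition diffeo_jets {n} (h : leaf_diffeo n) :=
  jets [set x : 'cV[R]_n * R | enorm x.1 < 1] (@torus_pt n) (set_val \o h).

HB.instance Definition _ n :=
  Topological.copy (leaf_diffeo n) (initial_topology (@diffeo_jets n)).

End SolidTorus.

(* Main.v *)
(* Write a leaf-preserving diffeomorphism in angle coordinates as h(v, t) =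
   (alpha(v, t), beta(v, t)).  Since |alpha(v, t)| = |v|, alpha vanishes on the
   core v = 0, and h is joined to the map (v, t) -> (A(t) v, beta(0, t)), with
   A(t) the derivative of alpha in the disk direction at the core (orthogonal,
   since h preserves norms), by
     (v, t) -> (alpha(a v, t) / a, beta(a v, t)),   0 < a <= 1.
   Then a lift L of beta(0, .) has the form L(t) = L(0) + e t + p(t) with e = 1
   or -1 and p periodic, and L(0) + e t + s p(t), 0 <= s <= 1, straightens it.
   The result is eta(g(h)), where g(h) consists of the loop A(t) A(0)^-1, of A(0)
   and of the isometry of angle L(0) + e t; and g o eta is the identity.

   The homotopy is continuous in the C^oo topology because the derivative of the
   quotient alpha(a v, t) / a in a direction (w, c) is the derivative of alpha
   in the direction (w, 0) at (a v, t) plus c times the same kind of quotient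
   for the angular derivative of alpha, which also vanishes on the core. *)

From HB Require Import structures.
Require Import Defs.
From mathcomp Require Import all_boot all_order all_algebra.
From mathcomp Require Import all_classical all_reals all_analysis.
From mathcomp Require Import ring lra.

Set Implicit Arguments.
Unset Strict Implicit.
Unset Printing Implicit Defensive.

Import Order.TTheory GRing.Theory Num.Theory.
Import numFieldNormedType.Exports.

Local Open Scope classical_set_scope.
Local Open Scope ring_scope.

(** * Scalar calculus *)

Section Calculus.
Variable R : realType.

(** The loop and diffeomorphism spaces are topologized by uniform convergence of iterated
    derivatives, so each continuity claim is proved for families along an arbitrary filter: if [h t]
    tends to [h0], the constructed objects converge. [jconv] records this for scalar functions. The
    solid torus is seen through the open disk times the line of angles, which is not compact; bounds
    and equicontinuity come from the compactness of one period of the closed torus and are then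
    carried along as hypotheses.

    A second obstacle: the lift L is determined only modulo 2 pi and is chosen with no continuity in
    h. Hence only quantities free of the choice are made to converge: cos L(0), sin L(0), e and p.
    The angular speed x y' - y x' of the core map gives the last two: its sign is e, which is thus
    locally constant in h, and p is the primitive of the speed minus e.

    The intermediate maps stay invertible because shrinking the inverse inverts the shrinking, and
    because along the straightening e times the derivative of the angle is a convex combination of 1
    and a positive function. *)

Definition coordinates (V : normedModType R) (I : finType) (e : I -> V)
    (c : I -> {linear V -> R}) : Prop :=
  (forall i, continuous (c i)) /\ forall x, x = \sum_i c i x *: e i.

Definition findim (V : normedModType R) : Prop :=
  exists (I : finType) (e : I -> V) (c : I -> {linear V -> R}), coordinates e c.

Lemma coordinates_ord (V : normedModType R) (I : finType) (e : I -> V)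
    (c : I -> {linear V -> R}) : coordinates e c ->
  coordinates (e \o @enum_val I I) (c \o @enum_val I I).
Proof.
move=> [cc E]; split=> [i|x]; first exact: cc.
rewrite [LHS]E (reindex (@enum_val I I)) //=.
by apply: onW_bij; exact: enum_val_bij.
Qed.

Lemma cvg_bigsum (W : normedModType R) (T I : Type) (F : set_system T) {FF : Filter F}
    (r : seq I) (f : I -> T -> W) (l : I -> W) : (forall i, f i @ F --> l i) ->
  (fun t => \sum_(i <- r) f i t) @ F --> \sum_(i <- r) l i.
Proof.
move=> fl; elim: r => [|i r IH].
  rewrite big_nil (_ : (fun t => _) = fun=> 0); first exact: cvg_cst.
  by apply/funext => t; rewrite big_nil.
rewrite big_cons (_ : (fun t => _) = f i + (fun t => \sum_(i <- r) f i t)).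
  exact: cvgD.
by apply/funext => t; rewrite big_cons.
Qed.

Lemma continuous_bigsum (V : topologicalType) (W : normedModType R) (I : Type)
    (r : seq I) (F : I -> V -> W) x :
  (forall i, {for x, continuous (F i)}) ->
  {for x, continuous (fun y => \sum_(i <- r) F i y)}.
Proof. by move=> Fc; exact: cvg_bigsum. Qed.

Lemma differentiable_bigsum (V W : normedModType R) (I : Type) (r : seq I)
    (F : I -> V -> W) x : (forall i, differentiable (F i) x) ->
  differentiable (fun y => \sum_(i <- r) F i y) x.
Proof.
move=> dF; elim: r => [|i r IH].
  rewrite (_ : (fun y => _) = cst 0); last by apply/funext => y; rewrite big_nil.
  exact: differentiable_cst.
rewrite (_ : (fun y => _) = F i + (fun y => \sum_(i <- r) F i y)).
  exact: differentiableD.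
by apply/funext => y; rewrite big_cons.
Qed.

Lemma is_derive_bigsum (V W : normedModType R) (I : Type) (r : seq I)
    (F : I -> V -> W) (dF : I -> W) x v : (forall i, is_derive x v (F i) (dF i)) ->
  is_derive x v (fun y => \sum_(i <- r) F i y) (\sum_(i <- r) dF i).
Proof.
move=> dFi; elim: r => [|i r IH].
  rewrite (_ : (fun y => _) = cst 0); last by apply/funext => y; rewrite big_nil.
  by rewrite big_nil; exact: is_derive_cst.
rewrite (_ : (fun y => _) = F i + (fun y => \sum_(i <- r) F i y)).
  by rewrite big_cons; exact: is_deriveD.
by apply/funext => y; rewrite big_cons.
Qed.

Lemma near_open (V : normedModType R) (U : set V) (P : V -> Prop) x :
  open U -> U x -> (forall y, U y -> P y) -> \forall y \near x, P y.
Proof. by move=> oU Ux UP; apply: filterS (open_nbhs_nbhs (conj oU Ux)). Qed.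

(** The one-variable mean value theorem is applied to t -> f(y + t a e) on [0, 1], so that one
    statement covers [a] of either sign and [a] = 0. *)
Lemma line_mvt (V : normedModType R) (f : V -> R) (y e : V) (a : R) :
  (forall t : R, 0 <= t <= 1 -> derivable f (y + (t * a) *: e) e) ->
  exists2 t : R, 0 <= t <= 1 & f (y + a *: e) - f y = a * 'D_e f (y + (t * a) *: e).
Proof.
move=> df; pose g (t : R) := f (y + (t * a) *: e).
have dg (t : R) : 0 <= t <= 1 -> is_derive t 1 g (a * 'D_e f (y + (t * a) *: e)).
  move=> /df dft.
  have dk : is_derive (t * a) 1 (fun s : R => f (y + s *: e))
      ('D_e f (y + (t * a) *: e)).
    have E : (fun h : R => h^-1 *: (((fun s : R => f (y + s *: e)) \o shift (t * a))
          (h *: 1) - f (y + (t * a) *: e))) =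
        (fun h : R => h^-1 *: ((f \o shift (y + (t * a) *: e)) (h *: e) -
          f (y + (t * a) *: e))).
      apply/funext => h /=; congr (_ *: (f _ - _)).
      by rewrite [h *: 1]mulr1 scalerDl addrCA addrA.
    by split; [rewrite /derivable E | rewrite /derive E].
  have dm : is_derive t 1 (fun s : R => s * a) a.
    by apply: is_derive_eq; rewrite scaler0 add0r [a *: 1]mulr1.
  have := @is_derive1_comp R (fun s : R => f (y + s *: e)) (fun s => s * a) t _ _ dk dm.
  by rewrite mulrC.
have [|||t t01] := @MVT_segment R g (fun t : R => a * 'D_e f (y + (t * a) *: e)) 0 1.
- exact: ler01.
- by move=> x /[!in_itv]/= /andP[x0 x1]; apply: dg; rewrite !ltW.
- apply: derivable_within_continuous => x /[!in_itv]/= x01.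
  by have [] := dg x x01.
rewrite subr0 mulr1 /g mul1r mul0r scale0r addr0 => E.
by exists t => //; move: t01; rewrite in_itv.
Qed.

(** * Continuous directional derivatives imply differentiability *)

Section findim_domain.
Variables (V : normedModType R) (m : nat) (e : 'I_m -> V).
Variable c : 'I_m -> {linear V -> R}.
Hypothesis ec : coordinates e c.

(** In the estimate below, the first bound controls the increment along each coordinate vector and
    the second the length of the step itself; one constant serves both. *)
Lemma coord_bound : exists2 K, 0 < K &
  forall i h, `|c i h| <= K * `|h| /\ `|c i h| * `|e i| <= K * `|h|.
Proof.
have [/= k kP] : {k : 'I_m -> R | forall i, 0 < k i /\
    forall x, `|c i x| <= k i * `|x|}.
  have /choice[k kP] : forall i, exists k, 0 < k /\ forall x, `|c i x| <= k * `|x|.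
    by move=> i; have [k k0 kP] := linear_lipschitz (ec.1 i); exists k.
  by exists k.
exists (1 + \sum_i (k i + k i * `|e i|)).
  rewrite ltr_pwDl// sumr_ge0// => i _.
  by rewrite addr_ge0// ?mulr_ge0// ltW//; have [] := kP i.
move=> i h.
have kS : k i + k i * `|e i| <= 1 + \sum_i (k i + k i * `|e i|).
  rewrite (bigD1 i)//= addrCA lerDl addr_ge0// sumr_ge0// => j _.
  by rewrite addr_ge0// ?mulr_ge0// ltW//; have [] := kP j.
have [k0 kh] := kP i.
split; first apply: (le_trans (kh h)).
  apply: ler_wpM2r => //; apply: le_trans kS.
  by rewrite lerDl mulr_ge0// ltW.
apply: (@le_trans _ _ (k i * `|h| * `|e i|)); first exact: ler_wpM2r.
rewrite mulrAC; apply: ler_wpM2r => //; apply: le_trans kS.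
by rewrite lerDr ltW.
Qed.

(** The path from [x] to [x + h] moves in one coordinate at a time. The mean value theorem on each
    leg replaces the increment of [f] by a partial derivative at a nearby point, and continuity of
    the partial derivatives makes the total error o(h). *)
Lemma C1_differentiable (U : set V) (f : V -> R) x : open U -> U x ->
  (forall y v, U y -> derivable f y v /\ {for y, continuous ('D_v f)}) ->
  differentiable f x.
Proof.
move=> oU Ux dfU.
pose L (h : V) : R := \sum_i c i h * 'D_(e i) f x.
have Llin : linear L.
  move=> a u v; rewrite /L scaler_sumr -big_split /=; apply: eq_bigr => i _.
  by rewrite linearP mulrDl /GRing.scale /= mulrA.
pose LL : {linear V -> R} := HB.pack L (GRing.isLinear.Build _ _ _ _ L Llin).
have [K K0 KP] := coord_bound.
have Lc : continuous LL.
  rewrite (_ : LL = (fun h => \sum_i c i h * 'D_(e i) f x) :> (V -> R))//.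
  move=> y; apply: continuous_bigsum => i; apply: cvgM; first exact: ec.1.
  exact: cvg_cst.
have Ex (eps : R) : 0 < eps -> \forall h \near 0,
    `|f (x + h) - f x - L h| <= eps * `|h|.
  move=> eps0.
  (* There are m legs, each with increment at most K |h|, so a tolerance eps / (K (m + 1)) per leg
     is enough; m + 1 also keeps the divisor nonzero when m = 0. *)
  have [d /= d0 dP] : exists2 d, 0 < d & forall z, `|x - z| < d ->
      U z /\ forall i, `|'D_(e i) f x - 'D_(e i) f z| < eps / (K * m.+1%:R).
    have : \forall z \near x, U z /\
        forall i, `|'D_(e i) f x - 'D_(e i) f z| < eps / (K * m.+1%:R).
      apply/near_andP; split; first by apply: (near_open oU).
      apply: filter_forall => i.
      have /cvgrPdist_lt := (dfU x (e i) Ux).2; apply.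
      by rewrite divr_gt0// mulr_gt0.
    by move=> /nbhs_normP[d d0 dP]; exists d.
  have d'0 : 0 < d / (K * m.+1%:R) by rewrite divr_gt0// mulr_gt0.
  apply/nbhs_norm0P; exists (d / (K * m.+1%:R)) => //= h hd.
  (* [P j] is the sum of the first j coordinate steps. A point on a leg is within (m + 1) K |h| of
     [x], hence the requirement |h| < d / (K (m + 1)). *)
  pose P (j : nat) : V := \sum_(i < m | (i < j)%N) c i h *: e i.
  have PS (j : 'I_m) : P j.+1 = P j + c j h *: e j.
    rewrite /P (bigD1 j)//= addrC; congr (_ + _); apply: eq_bigl => i.
    by rewrite ltnS ltn_neqAle andbC.
  have Pn (j : 'I_m) (t : R) : 0 <= t <= 1 -> `|P j + (t * c j h) *: e j| < d.
    move=> /andP[t0 t1].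
    suff: `|P j + (t * c j h) *: e j| <= K * m.+1%:R * `|h|.
      move=> /le_lt_trans; apply; rewrite mulrC -ltr_pdivlMr// mulr_gt0//.
    rewrite (le_trans (ler_normD _ _))//.
    have a1 : `|P j| <= \sum_(i < m) K * `|h|.
      rewrite (le_trans (ler_norm_sum _ _ _))//.
      rewrite big_mkcond /= ler_sum// => i _; case: ifP => _.
        by rewrite normrZ; have [] := KP i h.
      by rewrite mulr_ge0// ltW.
    rewrite sumr_const card_ord -mulr_natr in a1.
    have a2 : `|(t * c j h) *: e j| <= K * `|h|.
      rewrite normrZ normrM (ger0_norm t0) -mulrA.
      have [_ q] := KP j h; apply: le_trans q.
      by rewrite ler_piMl// mulr_ge0.
    apply: (le_trans (lerD a1 a2)).
    by rewrite -natr1 le_eqVlt; apply/orP; left; apply/eqP; ring.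
  have tele : f (x + h) - f x = \sum_(j < m) (f (x + P j.+1) - f (x + P j)).
    rewrite -(big_mkord xpredT (fun j => f (x + P j.+1) - f (x + P j))).
    rewrite telescope_sumr// /P; congr (f (x + _) - f _).
      by rewrite [LHS](ec.2 h); apply: eq_bigl => i; rewrite ltn_ord.
    by rewrite big_pred0 ?addr0.
  rewrite tele /L -sumrB.
  apply: (@le_trans _ _ (\sum_(i < m) eps / m.+1%:R * `|h|)); last first.
    rewrite sumr_const card_ord -[_ *+ m]mulr_natr.
    rewrite [leLHS](_ : _ = eps * `|h| * (m%:R / m.+1%:R)); last by ring.
    rewrite ler_piMr ?mulr_ge0 ?(ltW eps0)//.
    by rewrite ler_pdivrMr// mul1r ler_nat.
  rewrite (le_trans (ler_norm_sum _ _ _))// ler_sum// => j _.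
  have [|t t01] := @line_mvt V f (x + P j) (e j) (c j h).
    move=> t t01; apply: (dfU _ _ _).1.
    by have [] := dP (x + P j + (t * c j h) *: e j) => //; rewrite -addrA opprD addNKr normrN; apply: Pn.
  rewrite PS addrA => ->; rewrite -mulrBr normrM.
  have Pd : `|x - (x + P j + (t * c j h) *: e j)| < d.
    by rewrite -addrA opprD addNKr normrN; apply: Pn.
  have [_ /(_ j) lt1] := dP _ Pd; rewrite distrC in lt1.
  apply: (@le_trans _ _ (K * `|h| * (eps / (K * m.+1%:R)))).
    by apply: ler_pM => //; [have [] := KP j h|exact: ltW].
  rewrite le_eqVlt; apply/orP; left; apply/eqP.
  have : m.+1%:R != 0 :> R by rewrite pnatr_eq0.
  by move: (m.+1%:R : R) => M M0; field; rewrite M0 gt_eqF.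
have LE : f \o shift x = cst (f x) + LL +o_ 0 id.
  apply/eqaddoP => eps eps0; near=> h.
  rewrite /= opprD -![(_ + _ : _ -> _) _]/(_ + _) -![(- _ : _ -> _) _]/(- _).
  rewrite /cst/= addrA [h + x]addrC; near: h; exact: Ex.
by apply/diff_locallyP; rewrite (diff_unique Lc LE); split.
Unshelve. all: by end_near. Qed.

End findim_domain.

Lemma derive_near_eq (V W : normedModType R) (U : set V) (f g : V -> W) v x :
  open U -> U x -> (forall y, U y -> f y = g y) -> 'D_v f x = 'D_v g x.
Proof. by move=> oU Ux fg; apply: near_eq_derive; apply: (near_open oU). Qed.

Lemma derivable_near_eq (V W : normedModType R) (U : set V) (f g : V -> W) v x :
  open U -> U x -> (forall y, U y -> f y = g y) -> derivable f x v -> derivable g x v.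
Proof. by move=> oU Ux fg; apply: near_eq_derivable; apply: (near_open oU). Qed.

Lemma iter_derive_rcons (V W : normedModType R) (f : V -> W) s v :
  iter_derive (rcons s v) f = iter_derive s ('D_v f).
Proof. by rewrite /iter_derive foldr_rcons. Qed.

Lemma continuous_near_eq (V : normedModType R) (W : topologicalType) (U : set V)
  (f g : V -> W) x :
  open U -> U x -> (forall y, U y -> f y = g y) ->
  {for x, continuous f} -> {for x, continuous g}.
Proof.
move=> oU Ux fg; rewrite /prop_for /continuous_at -(fg x Ux) => fc.
by apply: cvg_trans fc; apply: near_eq_cvg; apply: (near_open oU) => // y /fg ->.
Qed.

Lemma differentiable_near_eq (V : normedModType R) (U : set V) (f g : V -> R) x :
  open U -> U x -> (forall y, U y -> f y = g y) ->
  differentiable f x -> differentiable g x.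
Proof.
move=> oU Ux fg df.
have E : g \o shift x = cst (g x) + 'd f x +o_ 0 id.
  apply/eqaddoP => eps eps0.
  have /eqaddoP /(_ eps eps0) := ((diff_locallyP _ _).1 df).2.
  apply: filter_app; rewrite near_simpl /=.
  have : \forall h \near 0, U (h + x).
    have : (fun h => h + x) @ 0 --> x.
      by rewrite -[X in _ --> X]add0r; apply: cvgD; [exact: cvg_id|exact: cvg_cst].
    by apply; apply: (near_open oU).
  apply: filterS => h Uh.
  rewrite -![(_ + _ : _ -> _) _]/(_ + _) -![(- _ : _ -> _) _]/(- _) /cst/=.
  by rewrite !fg.
apply/diff_locallyP; rewrite (diff_unique (diff_continuous df) E); split=> //.
exact: diff_continuous.
Qed.

(* Smoothness is developed for scalar functions only; a map into a
   finite-dimensional space is handled through its coordinates. *)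
Fixpoint Ck (k : nat) (V : normedModType R) (U : set V) (f : V -> R) : Prop :=
  if k is k'.+1 then
    (forall x, U x -> differentiable f x) /\ (forall v, Ck k' U ('D_v f))
  else forall x, U x -> {for x, continuous f}.

Lemma Ck_eq k (V : normedModType R) (U : set V) (f g : V -> R) :
  open U -> (forall x, U x -> f x = g x) -> Ck k U f -> Ck k U g.
Proof.
move=> oU; elim: k f g => [|k IH] f g fg /=.
  by move=> fc x Ux; apply: (continuous_near_eq oU Ux fg); exact: fc.
move=> [df Df]; split=> [x Ux|v].
  by apply: (differentiable_near_eq oU Ux fg); exact: df.
by apply: IH (Df v) => x Ux; apply: (derive_near_eq _ oU).
Qed.

Lemma Ck_sub k (V : normedModType R) (U U' : set V) (f : V -> R) :
  U' `<=` U -> Ck k U f -> Ck k U' f.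
Proof.
move=> UU; elim: k f => [|k IH] f /=; first by move=> fc x /UU; exact: fc.
by move=> [df Df]; split=> [x /UU|v]; [exact: df|exact: IH].
Qed.

Lemma CkS k (V : normedModType R) (U : set V) (f : V -> R) :
  Ck k.+1 U f -> Ck k U f.
Proof.
elim: k f => [|k IH] f /= [df Df]; first by move=> x /df /differentiable_continuous.
by split => // v; exact: IH.
Qed.

Lemma Ck_cst k (V : normedModType R) (U : set V) (a : R) : Ck k U (fun=> a).
Proof.
elim: k a => [|k IH] a /=; first by move=> x _; exact: cst_continuous.
split=> [x _|v]; first exact: differentiable_cst.
by rewrite (_ : 'D_v _ = fun=> 0)//; apply/funext => x; rewrite derive_cst.
Qed.

Lemma CkD k (V : normedModType R) (U : set V) (f g : V -> R) : open U ->
  Ck k U f -> Ck k U g -> Ck k U (fun x => f x + g x).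
Proof.
move=> oU; elim: k f g => [|k IH] f g /=.
  by move=> fc gc x Ux; apply: continuousD; [exact: fc|exact: gc].
move=> [df Df] [dg Dg]; split=> [x Ux|v].
  by apply: differentiableD; [exact: df|exact: dg].
apply: (@Ck_eq _ _ _ (fun x => 'D_v f x + 'D_v g x)) => //; last exact: IH.
move=> x Ux; rewrite -(@deriveD _ _ _ f g)//; apply: diff_derivable;
  [exact: df|exact: dg].
Qed.

Lemma CkM k (V : normedModType R) (U : set V) (f g : V -> R) : open U ->
  Ck k U f -> Ck k U g -> Ck k U (fun x => f x * g x).
Proof.
move=> oU; elim: k f g => [|k IH] f g.
  by move=> /= fc gc x Ux; apply: continuousM; [exact: fc|exact: gc].
move=> fS gS; have fk := CkS fS; have gk := CkS gS.
move: fS gS => /= [df Df] [dg Dg]; split=> [x Ux|v].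
  by apply: differentiableM; [exact: df|exact: dg].
apply: (@Ck_eq _ _ _ (fun x => f x * 'D_v g x + g x * 'D_v f x)) => //.
  move=> x Ux; rewrite -(@deriveM _ _ f g)//; apply: diff_derivable;
    [exact: df|exact: dg].
by apply: CkD => //; apply: IH.
Qed.

Lemma Ck_sum k (V : normedModType R) (U : set V) I (r : seq I) (F : I -> V -> R) :
  open U -> (forall i, Ck k U (F i)) -> Ck k U (fun x => \sum_(i <- r) F i x).
Proof.
move=> oU FC; elim: r => [|i r IH].
  rewrite (_ : (fun x => _) = fun=> 0); first exact: Ck_cst.
  by apply/funext => x; rewrite big_nil.
rewrite (_ : (fun x => _) = fun x => F i x + \sum_(i <- r) F i x); first exact: CkD.
by apply/funext => x; rewrite big_cons.
Qed.

Lemma Ck_linear k (V : normedModType R) (U : set V) (L : {linear V -> R}) :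
  continuous L -> Ck k U L.
Proof.
move=> Lc; case: k => [|k] /=; first by move=> x _; exact: Lc.
split=> [x _|v]; first exact: linear_differentiable.
rewrite (_ : 'D_v _ = fun=> L v); first exact: Ck_cst.
apply/funext => x; rewrite deriveE; last exact: linear_differentiable.
by rewrite diff_lin.
Qed.

(** The chain rule writes D_v (f o g) as the sum over i of D_v (c_i o g) times (D_(e_i) f) o g. The
    second factors are composites whose outer function has one class less, so the induction on [k]
    runs over all [f]. *)
Lemma Ck_comp k (V V' : normedModType R) (U : set V) (U' : set V')
    (I : finType) (e : I -> V') (c : I -> {linear V' -> R}) (f : V' -> R) (g : V -> V') :
  coordinates e c -> open U -> open U' -> (forall x, U x -> U' (g x)) ->
  (forall x, U x -> {for x, continuous g}) ->
  Ck k U' f -> (forall i, Ck k U (fun x => c i (g x))) -> Ck k U (f \o g).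
Proof.
move=> ec oU oU' Ug gc; elim: k f => [|k IH] f.
  by move=> /= fc cg x Ux; apply: continuous_comp; [exact: gc|apply/fc/Ug].
move=> fS cgS; have cgk i := CkS (cgS i); move: fS cgS => /= [df Df] cg.
have dg x : U x -> differentiable g x.
  move=> Ux; rewrite (_ : g = fun y => \sum_i c i (g y) *: e i); last first.
    by apply/funext => y; rewrite -ec.2.
  apply: differentiable_bigsum => i; apply: differentiableZl.
  by apply: (cg i).1.
split=> [x Ux|v].
  by apply: differentiable_comp; [exact: dg|apply/df/Ug].
apply: (@Ck_eq _ _ _ (fun x =>
    \sum_i 'D_v (fun x => c i (g x)) x * 'D_(e i) f (g x))) => //.
  move=> x Ux; have dgx := dg _ Ux; have dfx := df _ (Ug _ Ux).
  rewrite [RHS]deriveE; last exact: differentiable_comp.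
  rewrite diff_comp//= [in RHS](ec.2 ('d g x v)) linear_sum.
  apply: eq_bigr => i _; rewrite linearZ /= -deriveE//; congr (_ * _).
  rewrite deriveE; last exact: (cg i).1.
  rewrite (_ : (fun x => c i (g x)) = c i \o g)// diff_comp//=.
    by rewrite deriveE// diff_lin//; exact: ec.1.
    by apply: linear_differentiable; exact: ec.1.
  by rewrite deriveE.
apply: Ck_sum => // i; apply: CkM => //; first exact: (cg i).2.
exact: (IH _ (Df _) cgk).
Qed.

Definition Csmooth (V : normedModType R) (U : set V) (f : V -> R) :=
  forall k, Ck k U f.

Lemma CsmoothD (V : normedModType R) (U : set V) (f : V -> R) v :
  Csmooth U f -> Csmooth U ('D_v f).
Proof. by move=> fC k; have [_ Df] := fC k.+1; exact: Df. Qed.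

Lemma Csmooth_derivable (V : normedModType R) (U : set V) (f : V -> R) x :
  Csmooth U f -> U x -> differentiable f x.
Proof. by move=> fC; have [+ _] := fC 1%N; exact. Qed.

Lemma Csmooth_continuous (V : normedModType R) (U : set V) (f : V -> R) x :
  Csmooth U f -> U x -> {for x, continuous f}.
Proof. by move=> fC; have := fC 0%N; exact. Qed.

Lemma Csmooth_iter (V : normedModType R) (U : set V) (f : V -> R) s :
  Csmooth U f -> Csmooth U (iter_derive s f).
Proof. by move=> fC; elim: s => //= v s; exact: CsmoothD. Qed.

Lemma Csmooth_smooth_on (V : normedModType R) (U : set V) (f : V -> R) :
  Csmooth U f -> smooth_on U f.
Proof.
move=> /Csmooth_iter fC s x Ux; have fs := fC s; split.
  exact: (Csmooth_continuous fs).
by move=> v; apply: diff_derivable; exact: (Csmooth_derivable fs).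
Qed.

(** The step from directional derivatives to differentiability is [C1_differentiable], hence the
    finite-dimensional domain. Passing from [f] to its derivative along [v] appends [v] at the inner
    end of the list of directions. *)
Lemma smooth_on_Csmooth (V : normedModType R) (U : set V) (f : V -> R) :
  findim V -> open U -> smooth_on U f -> Csmooth U f.
Proof.
move=> [I [e [c /coordinates_ord ec]]] oU fS k; elim: k f fS => [|k IH] f fS /=.
  by move=> x Ux; have [] := fS [::] x Ux.
split=> [x Ux|v].
  apply: (C1_differentiable ec oU Ux) => y v Uy.
  by split; [have [_] := fS [::] y Uy; exact|have [] := fS [:: v] y Uy].
by apply: IH => s x Ux; have := fS (rcons s v) x Ux; rewrite !iter_derive_rcons.
Qed.


(** * Vector-valued maps through their coordinates *)

Lemma derive_linear (V W W' : normedModType R) (L : {linear W -> W'}) (f : V -> W) x v :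
  continuous L -> derivable f x v ->
  derivable (L \o f) x v /\ 'D_v (L \o f) x = L ('D_v f x).
Proof.
move=> Lc df.
have : h^-1 *: (((L \o f) \o shift x) (h *: v) - (L \o f) x) @[h --> 0^'] -->
    L ('D_v f x).
  under eq_fun do rewrite /= -linearB -linearZ /=.
  by apply: (cvg_comp (fun h => h^-1 *: ((f \o shift x) (h *: v) - f x)) L);
    [exact: df|exact: Lc].
by move=> Q; split; [apply/cvg_ex; eexists; exact: Q|apply: cvg_lim => //].
Qed.

Lemma iter_derive_linear (V W W' : normedModType R) (L : {linear W -> W'}) (U : set V)
    (f : V -> W) s x : continuous L -> open U -> smooth_on U f -> U x ->
  iter_derive s (L \o f) x = L (iter_derive s f x).
Proof.
move=> Lc oU fS; elim: s x => [//|v s IH] x Ux /=.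
rewrite (derive_near_eq _ oU Ux IH).
by have [] := derive_linear Lc ((fS s x Ux).2 v).
Qed.

Lemma smooth_on_linear (V W W' : normedModType R) (L : {linear W -> W'}) (U : set V)
    (f : V -> W) : continuous L -> open U -> smooth_on U f -> smooth_on U (L \o f).
Proof.
move=> Lc oU fS s x Ux; have [fc df] := fS s x Ux.
have E y : U y -> L (iter_derive s f y) = iter_derive s (L \o f) y.
  by move=> Uy; rewrite (iter_derive_linear _ Lc oU fS).
split=> [|v].
  by apply: (continuous_near_eq oU Ux E); apply: continuous_comp; [exact: fc|exact: Lc].
by apply: (derivable_near_eq oU Ux E); exact: (derive_linear Lc (df v)).1.
Qed.

(** Each iterated derivative of [f] is the combination of the iterated derivatives of its
    coordinates with the fixed vectors [e i]. *)
Lemma smooth_on_coords (V W : normedModType R) (I : finType) (e : I -> W)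
    (c : I -> {linear W -> R}) (U : set V) (f : V -> W) : coordinates e c ->
  open U -> (forall i, smooth_on U (c i \o f)) -> smooth_on U f.
Proof.
move=> ec oU cf.
have D i s x v : U x -> is_derive x v (fun y => iter_derive s (c i \o f) y *: e i)
    (iter_derive (v :: s) (c i \o f) x *: e i).
  move=> Ux; have [_ /(_ v) df] := cf i s x Ux.
  have lin : linear (fun r : R => r *: e i).
    by move=> a b d; rewrite scalerDl scalerA.
  pose L : {linear R -> W} := HB.pack (fun r : R => r *: e i)
    (GRing.isLinear.Build _ _ _ _ _ lin).
  have Lc : continuous L by exact: scalel_continuous.
  have [d1 d2] := derive_linear Lc df.
  by split => //; rewrite -d2.
have E s x : U x -> \sum_i iter_derive s (c i \o f) x *: e i = iter_derive s f x.
  elim: s x => [|v s IH] x Ux /=; first by rewrite [RHS](ec.2 (f x)).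
  rewrite -(derive_near_eq v oU Ux IH).
  by have [_ ->] := is_derive_bigsum (index_enum I) (fun i => D i s x v Ux).
move=> s x Ux; split=> [|v].
  apply: (continuous_near_eq oU Ux (E s)); apply: continuous_bigsum => i.
  by apply: continuousZl; have [] := cf i s x Ux.
apply: (derivable_near_eq oU Ux (E s)).
by have [] := is_derive_bigsum (index_enum I) (fun i => D i s x v Ux).
Qed.

Lemma coordinates_R : coordinates (fun _ : unit => 1 : R) (fun _ => idfun : {linear R -> R}).
Proof.
split=> [_ x|x]; first exact: cvg_id.
by rewrite (big_pred1 tt) => [|[]//]; rewrite [RHS]mulr1.
Qed.

Lemma mx_coord_linear m n i j : linear (fun A : 'M[R]_(m, n) => A i j).
Proof. by move=> a A B; rewrite !mxE. Qed.

Definition mx_coord m n (ij : 'I_m * 'I_n) : {linear 'M[R]_(m, n) -> R} :=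
  HB.pack (fun A : 'M[R]_(m, n) => A ij.1 ij.2)
    (GRing.isLinear.Build _ _ _ _ _ (@mx_coord_linear m n ij.1 ij.2)).

Lemma coordinates_mx m n :
  coordinates (fun ij : 'I_m * 'I_n => delta_mx ij.1 ij.2) (@mx_coord m n).
Proof.
split=> [[i j]|A]; first exact: coord_continuous.
by rewrite [LHS]matrix_sum_delta pair_big.
Qed.

Definition prod_coord (V W : normedModType R) (I J : finType)
    (c : I -> {linear V -> R}) (d : J -> {linear W -> R}) (k : I + J) :
  {linear (V * W)%type -> R} :=
  match k with
  | inl i => c i \o fst
  | inr j => d j \o snd
  end.

Lemma coordinates_prod (V W : normedModType R) (I J : finType)
    (e : I -> V) (e' : J -> W) (c : I -> {linear V -> R}) (d : J -> {linear W -> R}) :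
  coordinates e c -> coordinates e' d ->
  coordinates (fun k : I + J => match k with inl i => (e i, 0) | inr j => (0, e' j) end)
    (prod_coord c d).
Proof.
move=> [cc E] [dc E']; split=> [[i|j] x /=|[v w]].
- by apply: continuous_comp; [exact: cvg_fst|exact: cc].
- by apply: continuous_comp; [exact: cvg_snd|exact: dc].
have P1 (z : V) : (z, 0 : W) = (\sum_i c i z *: (e i, 0)).
  have lin : linear (fun z : V => (z, 0 : W)).
    by move=> a b d'; apply/pair_equal_spec; split=> /=; rewrite ?scaler0 ?addr0.
  pose L : {linear V -> (V * W)%type} := HB.pack (fun z : V => (z, 0 : W))
    (GRing.isLinear.Build _ _ _ _ _ lin).
  by rewrite -[LHS]/(L z) {1}(E z) linear_sum; apply: eq_bigr => i _; rewrite linearZ.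
have P2 (z : W) : (0 : V, z) = (\sum_j d j z *: (0, e' j)).
  have lin : linear (fun z : W => (0 : V, z)).
    by move=> a b d'; apply/pair_equal_spec; split=> /=; rewrite ?scaler0 ?addr0.
  pose L : {linear W -> (V * W)%type} := HB.pack (fun z : W => (0 : V, z))
    (GRing.isLinear.Build _ _ _ _ _ lin).
  by rewrite -[LHS]/(L z) {1}(E' z) linear_sum; apply: eq_bigr => i _; rewrite linearZ.
rewrite big_sumType /= -P1 -P2.
by congr (_, _); rewrite ?addr0 ?add0r.
Qed.

(** * Smoothness of the elementary functions *)

Lemma derive_1d (f : R -> R) (x v : R) : derivable f x 1 ->
  derivable f x v /\ 'D_v f x = v * 'D_1 f x.
Proof.
move=> /derivable1_diffP df; split; first exact: diff_derivable.
by rewrite (deriveE _ df) (diff1E df) derive1E.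
Qed.

(** In one variable D_v is v times D_1, so a formula for the ordinary derivative suffices to gain
    one class. Functions whose derivative is expressed through themselves become smooth by
    bootstrapping. *)
Lemma Ck_1d k (U : set R) (f df : R -> R) : open U ->
  (forall x, U x -> is_derive x 1 f (df x)) -> Ck k U df -> Ck k.+1 U f.
Proof.
move=> oU fd dfC; split=> [x Ux|v].
  by apply/derivable1_diffP; have [] := fd x Ux.
apply: (@Ck_eq _ _ _ (fun x => v * df x)) => //.
  by move=> x Ux; have [d1 <-] := fd x Ux; have [_ ->] := derive_1d v d1.
by apply: CkM => //; exact: Ck_cst.
Qed.

(** Both functions go through one induction, as each is the derivative of the other up to sign. *)
Lemma Csmooth_cos_sin U : open U -> Csmooth U (@cos R) /\ Csmooth U (@sin R).
Proof.
move=> oU; suff H k : Ck k U (@cos R) /\ Ck k U (@sin R) by split=> k; have [] := H k.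
elim: k => [|k [Hc Hs]].
  by split=> x _; [exact: continuous_cos|exact: continuous_sin].
split; last by apply: (Ck_1d oU (fun x _ => is_derive_sin x)).
apply: (Ck_1d oU (fun x _ => is_derive_cos x)).
apply: (@Ck_eq _ _ _ (fun x => -1 * sin x)) => //.
  by move=> x _; rewrite mulN1r.
by apply: CkM => //; exact: Ck_cst.
Qed.

Lemma open_neq0 : open [set x : R | x != 0].
Proof. exact: open_neq. Qed.

Lemma Csmooth_inv : Csmooth [set x : R | x != 0] (fun x => x^-1).
Proof.
have oU := open_neq0.
elim=> [|k IH]; first by move=> x x0; exact: inv_continuous.
apply: (@Ck_1d _ _ _ (fun x => -1 * (x^-1 * x^-1))) => //.
  move=> x x0; apply: is_derive_eq; first by apply: is_deriveV.
  by rewrite [_ *: _]mulr1 -expr2 exprVn mulN1r.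
by apply: CkM => //; [exact: Ck_cst|exact: CkM].
Qed.

Lemma Ck_comp_1d k (V : normedModType R) (U : set V) (U' : set R) f g :
  open U -> open U' -> (forall x, U x -> U' (g x)) ->
  (forall x, U x -> {for x, continuous g}) ->
  Ck k U' f -> Ck k U g -> Ck k U (fun x => f (g x)).
Proof.
by move=> oU oU' Ug gc fC gC; apply: (@Ck_comp k _ _ U U' _ _ _ f g coordinates_R).
Qed.

Lemma Csmooth_comp_1d (V : normedModType R) (U : set V) (U' : set R) f g :
  open U -> open U' -> (forall x, U x -> U' (g x)) ->
  Csmooth U' f -> Csmooth U g -> Csmooth U (fun x => f (g x)).
Proof.
move=> oU oU' Ug fC gC k; apply: (Ck_comp_1d oU oU') => //.
by move=> x Ux; exact: (Csmooth_continuous gC).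
Qed.

Lemma Csmooth_atan : Csmooth [set: R] (@atan R).
Proof.
have H : Csmooth [set: R] (fun x : R => (1 + x ^+ 2)^-1).
  apply: (Csmooth_comp_1d _ _ _ Csmooth_inv) => //.
  - exact: openT.
  - by move=> x _; rewrite /= gt_eqF// ltr_pwDl// sqr_ge0.
  have idC k : Ck k [set: R] (fun x : R => x).
    exact: (@Ck_linear k R setT idfun (fun x => cvg_id)).
  by move=> k; apply: CkD; [exact: openT|exact: Ck_cst|apply: CkM => //; exact: openT].
case=> [|k]; first by move=> x _; exact: continuous_atan.
by apply: (Ck_1d openT (fun x _ => is_derive1_atan x)).
Qed.

(** The mean value theorem is used twice: along [v] for z -> f(z + h w) - f(z), then along [w] for
    D_v f. *)
Lemma second_difference (V : normedModType R) (U : set V) (f : V -> R) x v w (h : R) :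
  Csmooth U f ->
  (forall a b : R, 0 <= a <= 1 -> 0 <= b <= 1 -> U (x + (a * h) *: v + (b * h) *: w)) ->
  exists a b : R, [/\ 0 <= a <= 1, 0 <= b <= 1 &
    f (x + h *: v + h *: w) - f (x + h *: v) - (f (x + h *: w) - f x) =
    h * h * 'D_w ('D_v f) (x + (a * h) *: v + (b * h) *: w)].
Proof.
move=> fC UP; have e01 (t : R) : t = 0 \/ t = 1 -> 0 <= t <= 1.
  by case=> ->; rewrite ?lexx ?ler01.
have z01 := e01 0 (or_introl erefl); have o01 := e01 1 (or_intror erefl).
pose phi z := f (z + h *: w) - f z.
have dphi (t : R) : 0 <= t <= 1 -> is_derive (x + (t * h) *: v) v phi
   ('D_v f (x + (t * h) *: v + h *: w) - 'D_v f (x + (t * h) *: v)).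
  move=> t01; apply: is_deriveB; last first.
    apply/derivableP/diff_derivable/(Csmooth_derivable fC).
    by have := UP t 0 t01 z01; rewrite mul0r scale0r addr0.
  have dd : derivable f (x + (t * h) *: v + h *: w) v.
    apply/diff_derivable/(Csmooth_derivable fC).
    by have := UP t 1 t01 o01; rewrite mul1r.
  have E : (fun k : R => k^-1 *: (((fun z => f (z + h *: w)) \o shift (x + (t * h) *: v))
      (k *: v) - f (x + (t * h) *: v + h *: w))) =
    (fun k : R => k^-1 *: ((f \o shift (x + (t * h) *: v + h *: w)) (k *: v) -
      f (x + (t * h) *: v + h *: w))).
    by apply/funext => k /=; rewrite !addrA.
  by split; [rewrite /derivable E|rewrite /derive E].
have [|a a01] := @line_mvt V phi x v h.
  by move=> t /dphi[].
have [_ ->] := dphi a a01; rewrite /phi => Ea.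
have [|b b01 Eb] := @line_mvt V ('D_v f) (x + (a * h) *: v) w h.
  move=> t t01; apply/diff_derivable/(Csmooth_derivable (CsmoothD _ fC)).
  exact: UP.
by exists a, b; split=> //; rewrite Ea Eb mulrA.
Qed.

(** The second difference over a small parallelogram is symmetric in [v] and [w], and by
    [second_difference] it equals h^2 times either mixed derivative at some point of the
    parallelogram. Since both mixed derivatives are continuous, they cannot differ at [x]. *)
Lemma schwarz (V : normedModType R) (U : set V) (f : V -> R) x v w :
  open U -> U x -> Csmooth U f -> 'D_w ('D_v f) x = 'D_v ('D_w f) x.
Proof.
move=> oU Ux fC; apply/eqP; rewrite -subr_eq0 -normr_le0 leNgt; apply/negP => d0.
set d := `|_| in d0.
have c1 := Csmooth_continuous (CsmoothD w (CsmoothD v fC)) Ux.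
have c2 := Csmooth_continuous (CsmoothD v (CsmoothD w fC)) Ux.
have d20 : 0 < d / 2 by rewrite divr_gt0.
have nz : \forall z \near x, [/\ U z, `|'D_w ('D_v f) x - 'D_w ('D_v f) z| < d / 2
    & `|'D_v ('D_w f) x - 'D_v ('D_w f) z| < d / 2].
  have n1 : \forall z \near x, U z by exact: (near_open oU).
  have n2 : \forall z \near x, `|'D_w ('D_v f) x - 'D_w ('D_v f) z| < d / 2.
    by have /cvgrPdist_lt := c1; apply.
  have n3 : \forall z \near x, `|'D_v ('D_w f) x - 'D_v ('D_w f) z| < d / 2.
    by have /cvgrPdist_lt := c2; apply.
  by move: n1 n2 n3; apply: filterS3 => z ? ? ?; split.
have /nbhs_normP[r /= r0 rP] := nz.
(* The points x + a h v + b h w with a, b in [0, 1] lie within h (|v| + |w|) of [x], so h K < r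
   keeps the parallelogram in the ball; the summand 1 makes K positive. *)
pose K := 1 + `|v| + `|w|; have K0 : 0 < K by rewrite /K -addrA ltr_pwDl.
have [h h0 hr] : exists2 h : R, 0 < h & h * K < r.
  exists (r / (2 * K)); first by rewrite divr_gt0// mulr_gt0.
  by rewrite invfM mulrA divfK ?gt_eqF// ltr_pdivrMr// ltr_pMr// ltr1n.
have near_x (v' w' : V) (a b : R) : `|v'| + `|w'| <= K -> 0 <= a <= 1 -> 0 <= b <= 1 ->
    `|x - (x + (a * h) *: v' + (b * h) *: w')| < r.
  move=> vwK /andP[a0 a1] /andP[b0 b1].
  rewrite -addrA opprD addNKr normrN (le_lt_trans (ler_normD _ _))//.
  rewrite (normrZ _ v') (normrZ _ w') !normrM (ger0_norm a0) (ger0_norm b0) (gtr0_norm h0).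
  apply: le_lt_trans hr.
  apply: (@le_trans _ _ (h * (`|v'| + `|w'|))); last by rewrite ler_wpM2l// ltW.
  by rewrite mulrDr lerD// -mulrA ler_piMl// mulr_ge0// ltW.
have K1 : `|v| + `|w| <= K by rewrite /K -addrA lerDr.
have K2 : `|w| + `|v| <= K by rewrite addrC.
have [a [b [a01 b01 E1]]] := @second_difference V U f x v w h fC
  (fun a b a01 b01 => let: And3 Uz _ _ := rP _ (near_x v w a b K1 a01 b01) in Uz).
have [a' [b' [a01' b01' E2]]] := @second_difference V U f x w v h fC
  (fun a b a01 b01 => let: And3 Uz _ _ := rP _ (near_x w v a b K2 a01 b01) in Uz).
have [_ q1 _] := rP _ (near_x v w a b K1 a01 b01).
have [_ _ q2] := rP _ (near_x w v a' b' K2 a01' b01').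
have E : 'D_w ('D_v f) (x + (a * h) *: v + (b * h) *: w) =
    'D_v ('D_w f) (x + (a' * h) *: w + (b' * h) *: v).
  have hh : h * h != 0 by rewrite mulf_neq0 ?gt_eqF.
  have swap (A B C D : R) : A - B - (C - D) = A - C - (B - D) by ring.
  have cancel (k p q l m : R) : k != 0 -> l = k * p -> m = k * q -> l = m -> p = q.
    by move=> k0 -> -> /(mulfI k0).
  by apply: (cancel _ _ _ _ _ hh E1 E2); rewrite [x + h *: w + h *: v]addrAC; exact: swap.
have : d < d / 2 + d / 2.
  apply: le_lt_trans (ltrD q1 q2).
  rewrite E [X in _ <= _ + X]distrC.
  exact: ler_distD.
by rewrite -splitr ltxx.
Qed.

End Calculus.

(** * Uniform convergence of all derivatives *)

Section JetConvergence.
Variables (R : realType) (T : Type) (F : set_system T).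
Context {FF : Filter F}.

Definition ucvg (E : Type) (U : set E) (f : T -> E -> R) (f0 : E -> R) : Prop :=
  forall eps : R, 0 < eps -> \forall t \near F, forall x, U x -> `|f t x - f0 x| <= eps.

Definition ubnd (E : Type) (U : set E) (f0 : E -> R) : Prop :=
  exists M : R, forall x, U x -> `|f0 x| <= M.

Lemma ubnd_pos (E : Type) (U : set E) (f0 : E -> R) : ubnd U f0 ->
  exists2 M : R, 0 < M & forall x, U x -> `|f0 x| <= M.
Proof.
move=> [M MP]; exists (`|M| + 1); first by rewrite ltr_wpDl.
move=> x Ux; rewrite (le_trans (MP x Ux))// (le_trans (ler_norm M))//.
by rewrite lerDl.
Qed.

(** Absorbs a constant factor. As [C] may have any sign, the tolerance is divided by |C| + 1. *)
Lemma ucvg_le (E : Type) (U : set E) (f : T -> E -> R) f0 (C : R) :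
  (forall eps : R, 0 < eps -> \forall t \near F, forall x, U x -> `|f t x - f0 x| <= C * eps) ->
  ucvg U f f0.
Proof.
move=> H eps eps0; have C0 : 0 < `|C| + 1 by rewrite ltr_wpDl.
have := H (eps / (`|C| + 1)); rewrite divr_gt0// => /(_ isT).
apply: filterS => t ft x Ux; rewrite (le_trans (ft x Ux))//.
rewrite mulrA ler_pdivrMr// mulrC ler_wpM2l ?(ltW eps0)//.
by rewrite (le_trans (ler_norm C))// lerDl.
Qed.

Lemma ucvgD (E : Type) (U : set E) f g (f0 g0 : E -> R) :
  ucvg U f f0 -> ucvg U g g0 -> ucvg U (fun t x => f t x + g t x) (fun x => f0 x + g0 x).
Proof.
move=> fc gc eps eps0; have e2 : 0 < eps / 2 by rewrite divr_gt0.
move: (fc _ e2) (gc _ e2); apply: filterS2 => t ft gt x Ux.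
by rewrite opprD addrACA (le_trans (ler_normD _ _))// (splitr eps) lerD ?ft ?gt.
Qed.

Lemma ucvgM (E : Type) (U : set E) f g (f0 g0 : E -> R) : ubnd U f0 -> ubnd U g0 ->
  ucvg U f f0 -> ucvg U g g0 -> ucvg U (fun t x => f t x * g t x) (fun x => f0 x * g0 x).
Proof.
move=> /ubnd_pos[A A0 fA] /ubnd_pos[B B0 gB] fc gc.
apply: (@ucvg_le _ _ _ _ (A + B + 1)) => eps eps0.
(* The error on the first factor is also kept below 1, so that the product of the two errors is at
   most eps; this is the summand 1 in the constant A + B + 1. *)
have m0 : 0 < Num.min eps 1 by rewrite lt_min eps0 ltr01.
move: (fc _ m0) (gc _ eps0); apply: filterS2 => t ft gt x Ux.
rewrite (_ : _ - _ = (f t x - f0 x) * (g t x - g0 x) + (f t x - f0 x) * g0 x +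
  f0 x * (g t x - g0 x)); last by ring.
have := ft x Ux; rewrite le_min => /andP[f1 f2].
rewrite (_ : _ * eps = 1 * eps + eps * B + A * eps); last by ring.
rewrite (le_trans (ler_normD _ _))// lerD//; last first.
  by rewrite normrM ler_pM// ?fA ?gt.
rewrite (le_trans (ler_normD _ _))// lerD// normrM ler_pM// ?gt//.
exact: gB.
Qed.

Lemma ubndD (E : Type) (U : set E) (f0 g0 : E -> R) :
  ubnd U f0 -> ubnd U g0 -> ubnd U (fun x => f0 x + g0 x).
Proof.
move=> [A fA] [B gB]; exists (A + B) => x Ux.
by rewrite (le_trans (ler_normD _ _))// lerD ?fA ?gB.
Qed.

Lemma ubndM (E : Type) (U : set E) (f0 g0 : E -> R) :
  ubnd U f0 -> ubnd U g0 -> ubnd U (fun x => f0 x * g0 x).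
Proof.
move=> [A fA] [B gB]; exists (A * B) => x Ux.
by rewrite normrM ler_pM ?fA ?gB.
Qed.

Section fixed_domain.
Variables (E : normedModType R) (U : set E).
Hypothesis oU : open U.

(* Boundedness of the limit is included so that the class is stable under
   products, although [U] need not be compact. *)
Fixpoint jc (k : nat) f f0 : Prop :=
  [/\ Csmooth U f0, \forall t \near F, Csmooth U (f t), ucvg U f f0, ubnd U f0 &
  if k is k'.+1 then forall v, jc k' (fun t => 'D_v (f t)) ('D_v f0) else True].

Lemma jc0W k f f0 : jc k f f0 ->
  [/\ Csmooth U f0, \forall t \near F, Csmooth U (f t), ucvg U f f0 & ubnd U f0].
Proof. by case: k => [|k] []. Qed.

Lemma jcW k f f0 : jc k.+1 f f0 -> jc k f f0.
Proof.
elim: k f f0 => [|k IH] f f0 [s1 s2 c b D]; split => //.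
by move=> v; apply: IH; exact: D.
Qed.

Lemma Csmooth_eq f0 g0 : (forall x, U x -> f0 x = g0 x) -> Csmooth U f0 -> Csmooth U g0.
Proof. by move=> fg fC k; exact: (Ck_eq oU fg). Qed.

Lemma jc_eq k f g f0 g0 : (\forall t \near F, forall x, U x -> f t x = g t x) ->
  (forall x, U x -> f0 x = g0 x) -> jc k f f0 -> jc k g g0.
Proof.
elim: k f g f0 g0 => [|k IH] f g f0 g0 fg fg0 [s1 s2 c b D]; split => //.
- exact: (Csmooth_eq fg0).
- by move: fg s2; apply: filterS2 => t ft; exact: Csmooth_eq.
- move=> eps e0; move: (c eps e0) fg; apply: filterS2 => t ct ft x Ux.
  by rewrite -ft// -fg0// ct.
- by move: b => [M MP]; exists M => x Ux; rewrite -fg0// MP.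
- exact: (Csmooth_eq fg0).
- by move: fg s2; apply: filterS2 => t ft; exact: Csmooth_eq.
- move=> eps e0; move: (c eps e0) fg; apply: filterS2 => t ct ft x Ux.
  by rewrite -ft// -fg0// ct.
- by move: b => [M MP]; exists M => x Ux; rewrite -fg0// MP.
- move=> v; apply: IH (D v); last by move=> x Ux; exact: (derive_near_eq _ oU).
  by move: fg; apply: filterS => t ft x Ux; exact: (derive_near_eq _ oU).
Qed.

Lemma jcD k f g f0 g0 : jc k f f0 -> jc k g g0 ->
  jc k (fun t x => f t x + g t x) (fun x => f0 x + g0 x).
Proof.
elim: k f g f0 g0 => [|k IH] f g f0 g0 [s1 s2 c b D] [s1' s2' c' b' D']; split => //.
- by move=> k; exact: CkD.
- by move: s2 s2'; apply: filterS2 => t ft gt k; exact: CkD.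
- exact: ucvgD.
- exact: ubndD.
- by move=> j; exact: CkD.
- by move: s2 s2'; apply: filterS2 => t ft gt j; exact: CkD.
- exact: ucvgD.
- exact: ubndD.
- move=> v; apply: jc_eq (IH _ _ _ _ (D v) (D' v)).
    move: s2 s2'; apply: filterS2 => t ft gt x Ux.
    by rewrite -deriveD//; apply: diff_derivable;
      [exact: (Csmooth_derivable ft)|exact: (Csmooth_derivable gt)].
  move=> x Ux; rewrite -deriveD//; apply: diff_derivable;
      [exact: (Csmooth_derivable s1)|exact: (Csmooth_derivable s1')].
Qed.

Lemma jcM k f g f0 g0 : jc k f f0 -> jc k g g0 ->
  jc k (fun t x => f t x * g t x) (fun x => f0 x * g0 x).
Proof.
elim: k f g f0 g0 => [|k IH] f g f0 g0.
  move=> [s1 s2 c b D] [s1' s2' c' b' D']; split => //.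
  - by move=> k; exact: CkM.
  - by move: s2 s2'; apply: filterS2 => t ft gt k; exact: CkM.
  - exact: ucvgM.
  - exact: ubndM.
move=> jf jg; have jfk := jcW jf; have jgk := jcW jg.
move: jf jg => [s1 s2 c b D] [s1' s2' c' b' D']; split => //.
- by move=> j; exact: CkM.
- by move: s2 s2'; apply: filterS2 => t ft gt j; exact: CkM.
- exact: ucvgM.
- exact: ubndM.
- move=> v; apply: jc_eq (jcD (IH _ _ _ _ jfk (D' v)) (IH _ _ _ _ jgk (D v))).
    move: s2 s2'; apply: filterS2 => t ft gt x Ux.
    by rewrite -(@deriveM _ _ (f t) (g t))//; apply: diff_derivable;
      [exact: (Csmooth_derivable ft)|exact: (Csmooth_derivable gt)].
  by move=> x Ux; rewrite -(@deriveM _ _ f0 g0)//; apply: diff_derivable;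
      [exact: (Csmooth_derivable s1)|exact: (Csmooth_derivable s1')].
Qed.

Lemma Csmooth_cst (V : normedModType R) (W : set V) (a : R) : Csmooth W (fun=> a).
Proof. by move=> k; exact: Ck_cst. Qed.

Lemma jc_num k (c : T -> R) (c0 : R) : c @ F --> c0 -> jc k (fun t _ => c t) (fun=> c0).
Proof.
have D0 v a : 'D_v (fun=> a : R) = (fun=> 0) :> (E -> R).
  by apply/funext => x; rewrite derive_cst.
elim: k c c0 => [|k IH] c c0 cc; split => //.
- exact: Csmooth_cst.
- by apply: nearW => t; exact: Csmooth_cst.
- move=> eps e0; move/cvgrPdist_le : cc => /(_ eps e0); apply: filterS => t ct x _.
  by rewrite distrC.
- by exists `|c0|.
- exact: Csmooth_cst.
- by apply: nearW => t; exact: Csmooth_cst.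
- move=> eps e0; move/cvgrPdist_le : cc => /(_ eps e0); apply: filterS => t ct x _.
  by rewrite distrC.
- by exists `|c0|.
- move=> v; rewrite D0 (_ : (fun t => _) = fun t _ => 0); last first.
    by apply/funext => t; rewrite D0.
  by apply: IH; exact: cvg_cst.
Qed.

Lemma jc_sum k I (r : seq I) (f : I -> T -> E -> R) (f0 : I -> E -> R) :
  (forall i, jc k (f i) (f0 i)) ->
  jc k (fun t x => \sum_(i <- r) f i t x) (fun x => \sum_(i <- r) f0 i x).
Proof.
move=> fj; elim: r => [|i r IH].
  apply: jc_eq (jc_num k (cvg_cst 0)); first apply: nearW => t.
    by move=> x _; rewrite big_nil.
  by move=> x _; rewrite big_nil.
apply: jc_eq (jcD (fj i) IH); first apply: nearW => t.
  by move=> x _; rewrite big_cons.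
by move=> x _; rewrite big_cons.
Qed.

Definition jconv f f0 : Prop := forall k, jc k f f0.

Lemma jconv_derive f f0 v : jconv f f0 -> jconv (fun t => 'D_v (f t)) ('D_v f0).
Proof. by move=> fj k; have [_ _ _ _ D] := fj k.+1; exact: D. Qed.

Lemma jconv_iter f f0 s : jconv f f0 ->
  jconv (fun t => iter_derive s (f t)) (iter_derive s f0).
Proof. by move=> fj; elim: s => //= v s; exact: jconv_derive. Qed.

Lemma jconv_ucvg f f0 s : jconv f f0 ->
  ucvg U (fun t => iter_derive s (f t)) (iter_derive s f0).
Proof. by move=> /(jconv_iter s)/(_ 0%N) []. Qed.

(** [jc] differentiates the family before it recurses, so a new direction [v] enters at the inner
    end: the derivatives of D_v f along [s] are those of [f] along [rcons s v]. *)
Lemma jconvP f f0 : Csmooth U f0 -> (\forall t \near F, Csmooth U (f t)) ->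
  (forall s, ucvg U (fun t => iter_derive s (f t)) (iter_derive s f0)) ->
  (forall s, ubnd U (iter_derive s f0)) -> jconv f f0.
Proof.
move=> s1 s2 c b k; elim: k f f0 s1 s2 c b => [|k IH] f f0 s1 s2 c b; split => //.
- exact: (c [::]).
- exact: (b [::]).
- exact: (c [::]).
- exact: (b [::]).
- move=> v; apply: IH.
  + exact: CsmoothD.
  + by move: s2; apply: filterS => t; exact: CsmoothD.
  + move=> s; have := c (rcons s v); rewrite iter_derive_rcons.
    by under [X in ucvg _ X _]eq_fun do rewrite iter_derive_rcons.
  + by move=> s; have := b (rcons s v); rewrite iter_derive_rcons.
Qed.

(* A class of families that is stable under differentiation up to linear
   combinations with coefficients that converge together with all derivatives. *)
Lemma jconv_class (K : (T -> E -> R) -> (E -> R) -> Prop) :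
  (forall f f0, K f f0 ->
    [/\ Csmooth U f0, \forall t \near F, Csmooth U (f t), ucvg U f f0 & ubnd U f0]) ->
  (forall f f0 v, K f f0 -> exists r : seq ((T -> E -> R) * (E -> R) * ((T -> E -> R) * (E -> R))),
    [/\ forall p, p \in r -> jconv p.1.1 p.1.2 /\ K p.2.1 p.2.2,
     \forall t \near F, forall x, U x ->
       \sum_(p <- r) p.1.1 t x * p.2.1 t x = 'D_v (f t) x &
     forall x, U x -> \sum_(p <- r) p.1.2 x * p.2.2 x = 'D_v f0 x]) ->
  forall f f0, K f f0 -> jconv f f0.
Proof.
move=> K0 KD f f0 + k; elim: k f f0 => [|k IH] f f0 Kf.
  by have [] := K0 _ _ Kf.
have [s1 s2 c b] := K0 _ _ Kf; split=> // v.
have [r [rP rE rE0]] := KD f f0 v Kf.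
apply: jc_eq rE rE0 _.
elim: r rP => [|p r IHr] rP.
  apply: jc_eq (jc_num k (cvg_cst 0)); first apply: nearW => t.
    by move=> x _; rewrite big_nil.
  by move=> x _; rewrite big_nil.
have [j1 j2] := rP p (mem_head _ _).
have jr := IHr (fun q qr => rP q (mem_behead (s := p :: r) qr)).
apply: jc_eq (jcD (jcM (j1 k) (IH _ _ j2)) jr); first apply: nearW => t.
  by move=> x _; rewrite big_cons.
by move=> x _; rewrite big_cons.
Qed.

(** [jconv_class] is applied to the two-element class made of cos p and sin p: differentiating one
    gives the other times a derivative of p, up to sign. *)
Lemma jconv_cos_sin p p0 : jconv p p0 ->
  jconv (fun t x => cos (p t x)) (fun x => cos (p0 x)) /\
  jconv (fun t x => sin (p t x)) (fun x => sin (p0 x)).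
Proof.
move=> pj; have [ps0 ps pc pb] := jc0W (pj 0%N).
(* A derivative bounded by 1 makes cos and sin 1-Lipschitz, which turns the uniform convergence of
   [p] into that of cos p and sin p. *)
have lip (f g : R -> R) : (forall x : R, is_derive x 1 f (g x)) -> (forall x : R, `|g x| <= 1) ->
    forall x y : R, `|f x - f y| <= `|x - y|.
  move=> fd g1 x y.
  have [|t _] := @line_mvt R R f y 1 (x - y).
    by move=> t _; have [] := fd (y + (t * (x - y)) *: 1).
  have -> : y + (x - y) *: (1 : R) = x by rewrite [_ *: _]mulr1 addrC subrK.
  move=> ->; rewrite normrM ler_piMr//.
  by have [_ ->] := fd (y + (t * (x - y)) *: 1).
have cl := lip _ _ (fun x => is_derive_cos x)
  (fun x => (ltac:(by rewrite normrN; exact: sin_max) : `|- sin x| <= 1)).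
have sl := lip _ _ (fun x => is_derive_sin x) (@cos_max R).
have [Cc Cs] := @Csmooth_cos_sin R setT openT.
have sm f q : Csmooth setT f -> Csmooth U q -> Csmooth U (fun x => f (q x)).
  by move=> fC qC; apply: (Csmooth_comp_1d oU openT _ fC qC).
have uc (f : R -> R) : (forall x y : R, `|f x - f y| <= `|x - y|) ->
    ucvg U (fun t x => f (p t x)) (fun x => f (p0 x)).
  move=> fl eps e0; apply: filterS (pc eps e0) => t pt x Ux.
  by rewrite (le_trans (fl _ _))// pt.
have Dc (f g : R -> R) q v x : (forall x : R, is_derive x 1 f (g x)) -> Csmooth U q -> U x ->
    'D_v (fun x => f (q x)) x = 'D_v q x * g (q x).
  move=> fd qC Ux; have dq := Csmooth_derivable qC Ux.
  have df : differentiable f (q x) by apply/derivable1_diffP; have [] := fd (q x).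
  rewrite (_ : (fun x => f (q x)) = f \o q)//.
  rewrite (deriveE v (differentiable_comp dq df)) (diff_comp dq df) /=.
  by rewrite (diff1E df) derive1E (deriveE v dq); have [_ ->] := fd (q x).
pose K f f0 := (f = (fun t x => cos (p t x)) /\ f0 = (fun x => cos (p0 x))) \/
  (f = (fun t x => sin (p t x)) /\ f0 = (fun x => sin (p0 x))).
suff KK f f0 : K f f0 -> jconv f f0 by split; apply: KK; [left|right].
apply: jconv_class.
  move=> _ _ [] [-> ->]; split.
  - exact: sm.
  - by apply: filterS ps => t; exact: sm.
  - exact: uc.
  - by exists 1 => x _; exact: cos_max.
  - exact: sm.
  - by apply: filterS ps => t; exact: sm.
  - exact: uc.
  - by exists 1 => x _; exact: sin_max.
have jD v := jconv_derive v pj.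
move=> _ _ v [] [-> ->].
  exists [:: ((fun t x => -1 * 'D_v (p t) x, fun x => -1 * 'D_v p0 x),
    (fun t x => sin (p t x), fun x => sin (p0 x)))]; split.
  - move=> q; rewrite inE => /eqP -> /=; split; last by right.
    by move=> k; apply: jcM; [apply: jc_num; exact: cvg_cst|exact: jD].
  - apply: filterS ps => t pt x Ux; rewrite big_seq1 /=.
    rewrite (Dc _ _ _ _ _ (fun x => is_derive_cos x) pt Ux); ring.
  - move=> x Ux; rewrite big_seq1 /=.
    rewrite (Dc _ _ _ _ _ (fun x => is_derive_cos x) ps0 Ux); ring.
exists [:: ((fun t x => 'D_v (p t) x, fun x => 'D_v p0 x),
    (fun t x => cos (p t x), fun x => cos (p0 x)))]; split.
- move=> q; rewrite inE => /eqP -> /=; split; last by left.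
  exact: jD.
- apply: filterS ps => t pt x Ux; rewrite big_seq1 /=.
  by rewrite (Dc _ _ _ _ _ (fun x => is_derive_sin x) pt Ux).
- move=> x Ux; rewrite big_seq1 /=.
  by rewrite (Dc _ _ _ _ _ (fun x => is_derive_sin x) ps0 Ux).
Qed.

(** The class used here consists of [L] and the constants, because the derivative of [L] along [v]
    is the constant [L v]. *)
Lemma jconv_linear (L : {linear E -> R}) : continuous L -> ubnd U L ->
  jconv (fun _ => L) L.
Proof.
move=> Lc Lb; apply: (@jconv_class (fun f f0 => (exists a : R, f = (fun _ _ => a) /\ f0 = (fun _ => a))
   \/ (f = (fun _ => L) /\ f0 = L))); last by right.
  have u g0 : ucvg U (fun _ => g0) g0.
    by move=> eps e0; apply: nearW => t x _; rewrite subrr normr0 ltW.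
  move=> f f0 [[a]|] [-> ->]; split => //.
  - exact: Csmooth_cst.
  - by apply: nearW => t; exact: Csmooth_cst.
  - by exists `|a|.
  - by move=> k; exact: Ck_linear.
  - by apply: nearW => t k; exact: Ck_linear.
move=> f f0 v [[a]|] [-> ->].
  by exists [::]; split => //; [apply: nearW => t|]; move=> x _; rewrite big_nil derive_cst.
have DL x : 'D_v L x = L v.
  rewrite deriveE; last exact: linear_differentiable.
  by rewrite diff_lin.
exists [:: ((fun _ _ => 1, fun=> 1), (fun _ _ => L v, fun=> L v))]; split.
- move=> q; rewrite inE => /eqP -> /=; split; last by left; exists (L v).
  by move=> k; apply: jc_num; exact: cvg_cst.
- by apply: nearW => t x Ux; rewrite big_seq1/= mul1r DL.
- by move=> x Ux; rewrite big_seq1/= mul1r DL.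
Qed.

End fixed_domain.

(** * Composition with linear maps *)

Lemma derive_comp_linear (E E' : normedModType R) (A : {linear E' -> E}) (f : E -> R) x v :
  'D_v (f \o A) x = 'D_(A v) f (A x).
Proof.
have E1 : (fun h : R => h^-1 *: (((f \o A) \o shift x) (h *: v) - (f \o A) x)) =
  (fun h : R => h^-1 *: ((f \o shift (A x)) (h *: A v) - f (A x))).
  by apply/funext => h /=; rewrite linearP.
by rewrite /derive E1.
Qed.

Lemma Csmooth_comp_linear (E E' : normedModType R) (U : set E) (U' : set E')
    (A : {linear E' -> E}) (f : E -> R) :
  continuous A -> (forall x, U' x -> U (A x)) -> Csmooth U f -> Csmooth U' (f \o A).
Proof.
move=> Ac UA fC k; elim: k f fC => [|k IH] f fC /=.
  by move=> x /UA Ux; apply: continuous_comp; [exact: Ac|exact: (Csmooth_continuous fC)].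
split=> [x /UA Ux|v].
  by apply: differentiable_comp; [exact: linear_differentiable|exact: (Csmooth_derivable fC)].
rewrite (_ : 'D_v _ = 'D_(A v) f \o A); first by apply: IH; exact: CsmoothD.
by apply/funext => x; exact: derive_comp_linear.
Qed.

(** D_v (f o A) is (D_(A v) f) o A, so convergence is inherited direction by direction. It serves to
    restrict to the core and to regard functions of the angle as functions on the solid torus. *)
Lemma jconv_comp_linear (E E' : normedModType R) (U : set E) (U' : set E')
    (A : {linear E' -> E}) f f0 :
  continuous A -> (forall x, U' x -> U (A x)) ->
  jconv U f f0 -> jconv U' (fun t => f t \o A) (f0 \o A).
Proof.
move=> Ac UA fj k; have {fj} := fj k; elim: k f f0 => [|k IH] f f0 [s1 s2 c b D].
  split => //.
  - exact: (Csmooth_comp_linear Ac UA).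
  - by apply: filterS s2 => t; exact: (Csmooth_comp_linear Ac UA).
  - by move=> eps e0; apply: filterS (c eps e0) => t ct x /UA; exact: ct.
  - by move: b => [M MP]; exists M => x /UA; exact: MP.
split => //.
- exact: (Csmooth_comp_linear Ac UA).
- by apply: filterS s2 => t; exact: (Csmooth_comp_linear Ac UA).
- by move=> eps e0; apply: filterS (c eps e0) => t ct x /UA; exact: ct.
- by move: b => [M MP]; exists M => x /UA; exact: MP.
- move=> v; rewrite (_ : 'D_v _ = 'D_(A v) f0 \o A); last first.
    by apply/funext => x; exact: derive_comp_linear.
  have -> : (fun t : T => 'D_v (f t \o A)) = (fun t => 'D_(A v) (f t) \o A).
    by apply/funext => t; apply/funext => x; exact: derive_comp_linear.
  exact: (IH _ _ (D (A v))).
Qed.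

End JetConvergence.

(** * Dilations and quotients along the core *)

Section Dilation.
Variables (R : realType) (V : normedModType R).
Variables (I : finType) (e : I -> V) (c : I -> {linear V -> R}).
Hypothesis ec : coordinates e c.

Lemma dilate_linear (a : R) : linear (fun x : V * R => (a *: x.1, x.2)).
Proof.
move=> b x y; apply/pair_equal_spec; split=> //=.
by rewrite scalerDr !scalerA mulrC.
Qed.

Definition dilate (a : R) : {linear (V * R)%type -> (V * R)%type} :=
  HB.pack (fun x : V * R => (a *: x.1, x.2))
    (GRing.isLinear.Build _ _ _ _ _ (dilate_linear a)).

Lemma dilate_continuous a : continuous (dilate a).
Proof.
move=> x; have H1 : (fun x : V * R => a *: x.1) @ x --> a *: x.1.
  by apply: (@continuous_comp _ _ _ fst ( *:%R a)); [exact: cvg_fst|exact: scaler_continuous].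
have H2 : (fun x : V * R => x.2) @ x --> x.2 by exact: cvg_snd.
exact: (cvg_pair H1 H2).
Qed.

Lemma axis_linear : linear (fun y : R => (0 : V, y)).
Proof. by move=> b x y; apply/pair_equal_spec; split=> //=; rewrite scaler0 addr0. Qed.

Definition axis : {linear R -> (V * R)%type} :=
  HB.pack (fun y : R => (0 : V, y)) (GRing.isLinear.Build _ _ _ _ _ axis_linear).

Lemma axis_continuous : continuous axis.
Proof. move=> x; have H1 : (fun y : R => 0 : V) @ x --> (0 : V) by exact: cvg_cst.
have H2 : (fun y : R => y) @ x --> x by exact: cvg_id.
exact: (cvg_pair H1 H2). Qed.

Variable U : set (V * R).
Hypothesis oU : open U.
Hypothesis starU : forall x a, 0 <= a <= 1 -> U x -> U (dilate a x).
Hypothesis cU : forall i, ubnd U (fun x => c i x.1).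

(* Equicontinuity in the dilation factor, uniformly on [U]; on the open solid
   torus it replaces uniform continuity up to the boundary. *)
Definition ueq (f : V * R -> R) : Prop :=
  forall (a0 eps : R), 0 <= a0 <= 1 -> 0 < eps -> \forall a \near a0, 0 <= a <= 1 ->
    forall x, U x -> `|f (dilate a x) - f (dilate a0 x)| <= eps.

Definition jets_ueq (f : V * R -> R) : Prop := forall s, ueq (iter_derive s f).

Lemma jets_ueq_derive f v : jets_ueq f -> jets_ueq ('D_v f).
Proof. by move=> fu s; have := fu (rcons s v); rewrite iter_derive_rcons. Qed.

Lemma derive_split (f : V * R -> R) (a : R) (x v : V * R) : Csmooth U f -> U x ->
  'D_(dilate a v) f x = a * 'D_(v.1, 0) f x + 'D_(0, v.2) f x.
Proof.
move=> fC Ux; have df := Csmooth_derivable fC Ux.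
rewrite !deriveE// (_ : dilate a v = a *: (v.1, 0) + (0, v.2)); last first.
  by apply/pair_equal_spec; split=> /=; rewrite ?scaler0 ?addr0 ?add0r.
by rewrite linearP.
Qed.

Lemma derive_dilate (f : V * R -> R) (a : R) (x v : V * R) : Csmooth U f ->
  U (dilate a x) ->
  'D_v (f \o dilate a) x = a * 'D_(v.1, 0) f (dilate a x) + 'D_(0, v.2) f (dilate a x).
Proof. by move=> fC Ux; rewrite derive_comp_linear derive_split. Qed.

Section family.
Variables (T : Type) (F : set_system T).
Context {FF : Filter F}.
Variables (r : T -> R) (r0 : R).
Hypothesis rr0 : r @ F --> r0.
Hypothesis r01 : \forall t \near F, 0 <= r t <= 1.
Hypothesis r001 : 0 <= r0 <= 1.

Lemma ueq_near f (eps : R) : ueq f -> 0 < eps ->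
  \forall t \near F, forall x, U x -> `|f (dilate (r t) x) - f (dilate r0 x)| <= eps.
Proof.
move=> fu e0; have := rr0 (fu _ _ r001 e0).
by move: r01; apply: filterS2 => t t01 /(_ t01).
Qed.

(** Differentiating [f o dilate a] gives a times one composite plus another, both of the same form,
    so these composites are a class for [jconv_class]. Since the factor [r t] varies too, [f t] is
    first compared with [f0] at the same dilated point, then [f0] at two dilations by
    equicontinuity. *)
Lemma jconv_dilate f f0 : jconv F U f f0 -> jets_ueq f0 ->
  jconv F U (fun t => f t \o dilate (r t)) (f0 \o dilate r0).
Proof.
move=> fj fu; apply: (@jconv_class _ _ _ _ _ _ oU (fun f' f0' => exists f f0,
  [/\ jconv F U f f0, jets_ueq f0, f' = (fun t => f t \o dilate (r t)) &
    f0' = f0 \o dilate r0])); last by exists f, f0.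
  move=> {fj fu f f0} _ _ [f [f0 [fj fu -> ->]]].
  have [s1 s2 fc [M MP]] := jc0W (fj 0%N).
  have Ux0 x : U x -> U (dilate r0 x) by exact: starU.
  split.
  - exact: (Csmooth_comp_linear (@dilate_continuous r0) Ux0).
  - move: s2 r01; apply: filterS2 => t ft t01.
    by apply: (Csmooth_comp_linear (@dilate_continuous (r t)) _ ft) => x; exact: starU.
  - move=> eps e0; have e2 : 0 < eps / 2 by rewrite divr_gt0.
    move: (fc _ e2) (ueq_near (fu [::]) e2) r01; apply: filterS3 => t c1 c2 t01 x Ux /=.
    rewrite (le_trans (ler_distD (f0 (dilate (r t) x)) _ _))// (splitr eps) lerD//.
      by apply: c1; exact: starU.
    exact: c2.
  - by exists M => x /Ux0; exact: MP.
move=> {fj fu f f0} _ _ v [f [f0 [fj fu -> ->]]].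
have [s1 s2 fc [M MP]] := jc0W (fj 0%N).
exists [:: ((fun t _ => r t, fun=> r0),
    (fun t => 'D_(v.1, 0) (f t) \o dilate (r t), 'D_(v.1, 0) f0 \o dilate r0));
  ((fun _ _ => 1, fun=> 1),
    (fun t => 'D_(0, v.2) (f t) \o dilate (r t), 'D_(0, v.2) f0 \o dilate r0))]; split.
- have K1 w : exists f' f0', [/\ jconv F U f' f0', jets_ueq f0',
     (fun t => 'D_w (f t) \o dilate (r t)) = (fun t => f' t \o dilate (r t)) &
     'D_w f0 \o dilate r0 = f0' \o dilate r0].
    exists (fun t => 'D_w (f t)), ('D_w f0); split => //; first exact: jconv_derive.
    exact: jets_ueq_derive.
  move=> q; rewrite !inE => /orP[] /eqP -> /=; split; try exact: K1.
    by move=> k; exact: jc_num.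
  by move=> k; apply: jc_num; exact: cvg_cst.
- move: s2 r01; apply: filterS2 => t ft t01 x Ux.
  rewrite big_cons big_seq1 /= mul1r derive_dilate//; exact: starU.
- by move=> x Ux; rewrite big_cons big_seq1 /= mul1r derive_dilate//; exact: starU.
Qed.

End family.

(* The quotient [f (a v, y) / a], continued by its limit at [a = 0]. *)
Definition dquot (a : R) (f : V * R -> R) (x : V * R) : R :=
  if a == 0 then 'D_(x.1, 0) f (dilate 0 x) else a^-1 * f (dilate a x).

Definition axis_zero (f : V * R -> R) : Prop := forall y, U (0, y) -> f (0, y) = 0.

Lemma derive_coords (f : V * R -> R) v x : Csmooth U f -> U x ->
  'D_(v, 0) f x = \sum_i c i v * 'D_(e i, 0) f x.
Proof.
move=> fC Ux; have df := Csmooth_derivable fC Ux.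
rewrite deriveE// (_ : (v, 0) = \sum_i c i v *: (e i, 0 : R)); last first.
  have lin : linear (fun z : V => (z, 0 : R)).
    by move=> a b d'; apply/pair_equal_spec; split=> /=; rewrite ?scaler0 ?addr0.
  pose L : {linear V -> (V * R)%type} := HB.pack (fun z : V => (z, 0 : R))
    (GRing.isLinear.Build _ _ _ _ _ lin).
  rewrite -[LHS]/(L v) {1}(ec.2 v) linear_sum; apply: eq_bigr => i _.
  by rewrite linearZ.
rewrite linear_sum; apply: eq_bigr => i _.
by rewrite linearZ deriveE.
Qed.

Lemma unit0 : (0 : R) <= (0 : R) <= (1 : R).
Proof. by rewrite lexx ler01. Qed.

(** [f] is constant along the core, so its angular derivative vanishes there. This lets the quotient
    construction be repeated on that derivative. *)
Lemma axis_zero_derive f (w : R) : Csmooth U f -> axis_zero f -> axis_zero ('D_(0, w) f).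
Proof.
move=> fC f0 y Uy; rewrite -[(0, w)]/(axis w) -[(0, y)]/(axis y).
rewrite -derive_comp_linear.
rewrite (@derive_near_eq R _ _ (axis @^-1` U) _ (cst 0)) ?derive_cst//.
by apply: open_comp => // z _; exact: axis_continuous.
Qed.

(** The mean value theorem runs from the core point (0, x.2), where [f] vanishes, to [dilate a x].
    The result, a form of Hadamard's lemma, has no denominator and is the source of the estimates on
    quotients that are uniform down to a = 0. *)
Lemma dquot_mvt (a : R) f x : Csmooth U f -> axis_zero f -> 0 <= a <= 1 -> U x ->
  exists2 b : R, 0 <= b <= a &
    dquot a f x = \sum_i c i x.1 * 'D_(e i, 0) f (dilate b x).
Proof.
move=> fC f0 /andP[a0 a1] Ux; rewrite /dquot; case: ifPn => [/eqP a00|an0].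
  exists 0; first by rewrite lexx a0.
  by rewrite derive_coords//; apply: starU => //; exact: unit0.
have E b : (0, x.2) + b *: (x.1, 0) = dilate b x.
  by apply/pair_equal_spec; split=> /=; rewrite ?add0r ?scaler0 ?addr0.
have Ub b : 0 <= b <= a -> U (dilate b x).
  by move=> /andP[b0 ba]; apply: starU => //; rewrite b0 (le_trans ba).
have ta (t : R) : 0 <= t <= 1 -> 0 <= t * a <= a.
  by move=> /andP[t0 t1]; rewrite mulr_ge0// ler_piMl.
have [|t t01] := @line_mvt R _ f (0, x.2) (x.1, 0) a.
  by move=> t /ta /Ub Ut; rewrite E; apply/diff_derivable/(Csmooth_derivable fC).
rewrite !E f0 ?subr0; last first.
  by have := Ub 0; rewrite lexx a0 => /(_ isT); rewrite -E scale0r addr0.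
move=> ->; exists (t * a); first exact: ta.
by rewrite mulrA mulVf// mul1r derive_coords//; apply/Ub/ta.
Qed.

Lemma Csmooth_dquot (a : R) f : 0 <= a <= 1 -> Csmooth U f -> Csmooth U (dquot a f).
Proof.
move=> a01 fC; case: (eqVneq a 0) => a0; last first.
  have -> : dquot a f = (fun x => a^-1 * (f \o dilate a) x).
    by apply/funext => z; rewrite /dquot (negPf a0).
  move=> k; apply: CkM => //; first exact: Ck_cst.
  have := Csmooth_comp_linear (@dilate_continuous a) _ fC; apply.
  by move=> x; apply: starU.
  apply: (@Csmooth_eq R _ U oU (fun x => \sum_i c i x.1 * ('D_(e i, 0) f \o dilate 0) x)).
    move=> x Ux; rewrite /dquot a0 eqxx derive_coords//; apply: starU => //; exact: unit0.
  move=> k; apply: Ck_sum => // i; apply: CkM => //.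
    apply: (@Ck_linear _ k _ U (c i \o fst)).
    by move=> x; apply: continuous_comp; [exact: cvg_fst|exact: ec.1].
  have := Csmooth_comp_linear (@dilate_continuous 0) _ (CsmoothD (e i, 0) fC); apply.
  by move=> x; apply: starU; exact: unit0.
Qed.

(** For nonzero [a] the factor a produced by [derive_dilate] cancels a^-1 in the first term. For [a]
    = 0 the second term arises as D_(0, v.2) of D_(e_i, 0) f, and [schwarz] exchanges the two
    derivatives. *)
Lemma derive_dquot (a : R) f x v : 0 <= a <= 1 -> Csmooth U f -> U x ->
  'D_v (dquot a f) x = 'D_(v.1, 0) f (dilate a x) + dquot a ('D_(0, v.2) f) x.
Proof.
move=> a01 fC Ux; have U0 y : U y -> U (dilate 0 y) by apply: starU; exact: unit0.
case: (eqVneq a 0) => [->|a0]; last first.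
  have Ua : U (dilate a x) by exact: starU.
  have -> : dquot a f = (fun x => a^-1 * (f \o dilate a) x).
    by apply/funext => z; rewrite /dquot (negPf a0).
  have dd : derivable (f \o dilate a) x v.
    apply/diff_derivable/differentiable_comp.
      by apply: linear_differentiable; exact: dilate_continuous.
    exact: (Csmooth_derivable fC).
  rewrite (@deriveMl _ _ (f \o dilate a))// derive_dilate//.
  by rewrite mulrDr mulrA mulVf// mul1r /dquot (negPf a0).
have Di i z w : U z -> is_derive z w (fun x => c i x.1 * ('D_(e i, 0) f \o dilate 0) x)
    (c i z.1 * 'D_(0, w.2) ('D_(e i, 0) f) (dilate 0 z) +
     'D_(e i, 0) f (dilate 0 z) * c i w.1).
  move=> Uz.
  have cl : continuous (c i \o fst : {linear (V * R)%type -> R}).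
    by move=> y; apply: continuous_comp; [exact: cvg_fst|exact: ec.1].
  have d1 : differentiable (c i \o fst : {linear (V * R)%type -> R}) z.
    exact: linear_differentiable.
  have d2 : differentiable ('D_(e i, 0) f \o dilate 0) z.
    apply: differentiable_comp.
      by apply: linear_differentiable; exact: dilate_continuous.
    by apply: (Csmooth_derivable (CsmoothD _ fC)); exact: U0.
  have i1 : is_derive z w (c i \o fst : {linear (V * R)%type -> R}) (c i w.1).
    by split; [exact: diff_derivable|rewrite deriveE// diff_lin].
  have i2 : is_derive z w ('D_(e i, 0) f \o dilate 0)
     ('D_(0, w.2) ('D_(e i, 0) f) (dilate 0 z)).
    split; first exact: diff_derivable.
    rewrite derive_dilate ?mul0r ?add0r//; last exact: U0.
    exact: CsmoothD.
  exact: (is_deriveM i1 i2).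
rewrite (@derive_near_eq R _ _ U _
    (fun x => \sum_i c i x.1 * ('D_(e i, 0) f \o dilate 0) x)) //; last first.
  by move=> z Uz; rewrite /dquot eqxx derive_coords//; exact: U0.
have [_ ->] := is_derive_bigsum (index_enum I) (fun i => Di i x v Ux).
rewrite big_split /= addrC /dquot eqxx; congr (_ + _).
  rewrite (derive_coords v.1 fC (U0 _ Ux)).
  by apply: eq_bigr => i _; rewrite mulrC.
rewrite (derive_coords x.1 (CsmoothD (0, v.2) fC) (U0 _ Ux)).
by apply: eq_bigr => i _; rewrite (schwarz _ _ oU (U0 _ Ux)).
Qed.

Lemma cU_bound : exists2 C : R, 0 < C & forall i x, U x -> `|c i x.1| <= C.
Proof.
have /choice[M MP] : forall i, exists M : R, 0 < M /\ forall x, U x -> `|c i x.1| <= M.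
  by move=> i; have [M M0 MP] := ubnd_pos (cU i); exists M.
exists (1 + \sum_i M i).
  by rewrite ltr_pwDl// sumr_ge0// => i _; have [/ltW] := MP i.
move=> i x Ux; have [_ /(_ x Ux) h] := MP i; rewrite (le_trans h)//.
rewrite (bigD1 i)//= addrCA lerDl addr_ge0// sumr_ge0// => j _.
by have [/ltW] := MP j.
Qed.

Lemma coords_sum_le (x : V * R) (C eps : R) (g : I -> R) : U x ->
  (forall i, `|c i x.1| <= C) -> (forall i, `|g i| <= eps) ->
  `|\sum_i c i x.1 * g i| <= #|I|%:R * C * eps.
Proof.
move=> Ux cC ge; rewrite (le_trans (ler_norm_sum _ _ _))//.
rewrite (_ : _ * _ = \sum_(i : I) C * eps); last first.
  by rewrite sumr_const -[RHS]mulr_natl mulrA.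
by apply: ler_sum => i _; rewrite normrM ler_pM.
Qed.

(** Near a0 = 0 the quotient is compared with its limit through [dquot_mvt], which reduces the claim
    to equicontinuity of the first derivatives. Near any other a0 it is the product of a^-1 and f o
    dilate a. *)
Lemma dquot_ueq (f : V * R -> R) (a0 : R) : Csmooth U f -> axis_zero f ->
  ubnd U f -> jets_ueq f -> 0 <= a0 <= 1 ->
  ucvg (within [set a : R | 0 <= a <= 1] (nbhs a0)) U (fun a => dquot a f) (dquot a0 f).
Proof.
move=> fC f0 fb fu a01; have [C C0 CP] := cU_bound.
case: (eqVneq a0 0) => [a00|an0].
  subst a0; apply: (@ucvg_le _ _ _ _ _ _ _ _ (#|I|%:R * C)) => eps e0.
  have := filter_forall (nbhs_filter (0 : R)) (fun i => fu [:: (e i, 0)] 0 eps a01 e0).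
  move=> /nbhs_normP[d /= d0 dP]; apply/nbhs_normP; exists d => //= a ad a01' x Ux.
  have [b /andP[b0 ba] ->] := dquot_mvt fC f0 a01' Ux.
  rewrite /dquot eqxx derive_coords//; last by apply: starU.
  rewrite -sumrB (eq_bigr (fun i => c i x.1 *
     ('D_(e i, 0) f (dilate b x) - 'D_(e i, 0) f (dilate 0 x)))); last first.
    by move=> i _; rewrite mulrBr.
  apply: (coords_sum_le Ux) => i; first exact: CP.
  apply: dP => //; last by case/andP: a01' => _ a1; rewrite b0 (le_trans ba).
  by rewrite /ball_/= sub0r normrN ger0_norm// (le_lt_trans ba)//;
    move: ad; rewrite /ball_/= sub0r normrN; apply: le_lt_trans; exact: ler_norm.
have fd : ubnd U (fun x => f (dilate a0 x)).
  by move: fb => [M MP]; exists M => x Ux; apply: MP; exact: starU.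
have := @ucvgM _ _ (within [set a : R | 0 <= a <= 1] (nbhs a0)) _ _ U
  (fun a _ => a^-1) (fun a x => f (dilate a x)) (fun=> a0^-1) (fun x => f (dilate a0 x)).
move=> H eps e0.
have {H} : ucvg (within [set a : R | 0 <= a <= 1] (nbhs a0)) U
    (fun a x => a^-1 * f (dilate a x)) (fun x => a0^-1 * f (dilate a0 x)).
  apply: H => //; first by exists `|a0^-1|.
    move=> d d0; apply: cvg_within.
    have /cvgrPdist_le/(_ d d0) : (fun a : R => a^-1) @ a0 --> a0^-1.
      exact: inv_continuous.
    by apply: filterS => a ha x _; rewrite distrC.
  move=> d d0; have := fu [::] _ _ a01 d0; rewrite /within /=.
  by apply: filterS => a ha a01' x Ux; exact: ha.
move=> /(_ _ e0); rewrite /within /=.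
have : \forall a \near a0, a != 0.
  exact: (near_open (@open_neq0 R)).
apply: filterS2 => a anz ha a01' x Ux.
by rewrite /dquot (negPf an0) (negPf anz); exact: ha.
Qed.

Section quotient_family.
Variables (T : Type) (F : set_system T).
Context {FF : Filter F}.
Variables (r : T -> R) (r0 : R).
Hypothesis rr0 : r @ F --> r0.
Hypothesis r01 : \forall t \near F, 0 <= r t <= 1.
Hypothesis r001 : 0 <= r0 <= 1.

Lemma jconv_dquot f f0 : jconv F U f f0 -> jets_ueq f0 ->
  (\forall t \near F, axis_zero (f t)) -> axis_zero f0 ->
  jconv F U (fun t => dquot (r t) (f t)) (dquot r0 f0).
Proof.
move=> fj fu fz f0z.
(* The class contains all convergent families besides the quotients, because the derivative of a
   quotient has a term (D_(v.1, 0) f) o dilate a that is not a quotient. *)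
pose K f' f0' := jconv F U f' f0' \/ exists f f0,
  [/\ jconv F U f f0 /\ jets_ueq f0, \forall t \near F, axis_zero (f t), axis_zero f0,
   f' = (fun t => dquot (r t) (f t)) & f0' = dquot r0 f0].
apply: (@jconv_class _ _ _ _ _ _ oU K); last by right; exists f, f0.
  move=> {fj fu fz f0z f f0} f' f0' [/(_ 0%N)/jc0W//|[f [f0 [[fj fu] fz f0z -> ->]]]].
  have [s1 s2 fc fb] := jc0W (fj 0%N).
  have [C C0 CP] := cU_bound.
  split.
  - exact: Csmooth_dquot.
  - by move: s2 r01; apply: filterS2 => t ft t01; exact: Csmooth_dquot.
  - apply: (@ucvg_le _ _ _ _ _ _ _ _ (#|I|%:R * C + 1)) => eps e0.
    have n1 : \forall t \near F, forall i x, U x ->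
        `|'D_(e i, 0) (f t) x - 'D_(e i, 0) f0 x| <= eps.
      by apply: filter_forall => i; exact: (jconv_ucvg [:: (e i, 0)] fj).
    have n2 : \forall t \near F, forall x, U x -> `|dquot (r t) f0 x - dquot r0 f0 x| <= eps.
      have := dquot_ueq s1 f0z fb fu r001 e0; rewrite /within /= => /rr0.
      by move: r01; apply: filterS2 => t t01 /(_ t01).
    near=> t => x Ux.
    rewrite (le_trans (ler_distD (dquot (r t) f0 x) _ _))// mulrDl mul1r lerD//; last first.
      by move: x Ux; near: t.
    have t01 : 0 <= r t <= 1 by near: t.
    have ft : Csmooth U (f t) by near: t.
    have ftz : axis_zero (f t) by near: t.
    have gC : Csmooth U (fun x => f t x + -1 * f0 x).
      by move=> k; apply: CkD => //; apply: CkM => //; exact: Ck_cst.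
    have DB w z : U z -> 'D_w (fun x => f t x + -1 * f0 x) z = 'D_w (f t) z - 'D_w f0 z.
      move=> Uz; have d1 := Csmooth_derivable ft Uz; have d2 := Csmooth_derivable s1 Uz.
      rewrite (_ : (fun x => _) = f t - f0).
        by rewrite deriveB//; exact: diff_derivable.
      by apply/funext => y; rewrite mulN1r.
    (* [dquot] is linear in the function, so the difference is the quotient of f t - f0; [dquot_mvt]
       bounds it by the first derivatives of f t - f0, uniformly in [r t]. *)
    have -> : dquot (r t) (f t) x - dquot (r t) f0 x =
        dquot (r t) (fun x => f t x + -1 * f0 x) x.
      rewrite /dquot; case: ifP => _; last by rewrite mulN1r mulrBr.
      by rewrite DB//; apply: starU => //; exact: unit0.
    have gz : axis_zero (fun x => f t x + -1 * f0 x).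
      by move=> y Uy; rewrite ftz// f0z// mulr0 addr0.
    have [b /andP[b0 ba] ->] := dquot_mvt gC gz t01 Ux.
    apply: (coords_sum_le Ux) => i; first exact: CP.
    have Ub : U (dilate b x).
      by apply: starU => //; case/andP: t01 => _; rewrite b0; exact: le_trans.
    rewrite DB//; move: i (dilate b x) Ub; near: t; exact: n1.
  - have [M MP] : exists M : R, forall i x, U x -> `|'D_(e i, 0) f0 x| <= M.
      have /choice[M MP] : forall i, exists M : R, 0 < M /\
           forall x, U x -> `|'D_(e i, 0) f0 x| <= M.
        move=> i; have [_ _ _ /ubnd_pos[M M0 MP]] := jc0W (jconv_derive (e i, 0) fj 0%N).
        by exists M.
      exists (\sum_i M i) => i x Ux; have [_ /(_ x Ux) h] := MP i; rewrite (le_trans h)//.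
      rewrite (bigD1 i)//= lerDl sumr_ge0// => j _.
      by have [/ltW] := MP j.
    exists (#|I|%:R * C * M) => x Ux.
    have [b /andP[b0 ba] ->] := dquot_mvt s1 f0z r001 Ux.
    apply: (coords_sum_le Ux) => i; first exact: CP.
    apply: MP; apply: starU => //.
    by case/andP: r001 => _; rewrite b0; exact: le_trans.
have j1 : jconv F U (fun _ _ => 1) (fun=> 1).
  by move=> k; apply: jc_num; exact: cvg_cst.
move=> {fj fu fz f0z f f0} f' f0' v [fj|[f [f0 [[fj fu] fz f0z -> ->]]]].
  exists [:: ((fun _ _ => 1, fun=> 1), (fun t => 'D_v (f' t), 'D_v f0'))]; split.
  - by move=> q; rewrite inE => /eqP -> /=; split => //; left; exact: jconv_derive.
  - by apply: nearW => t x Ux; rewrite big_seq1/= mul1r.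
  - by move=> x Ux; rewrite big_seq1/= mul1r.
have [s1 s2 fc fb] := jc0W (fj 0%N).
exists [:: ((fun _ _ => 1, fun=> 1),
    (fun t => 'D_(v.1, 0) (f t) \o dilate (r t), 'D_(v.1, 0) f0 \o dilate r0));
  ((fun _ _ => 1, fun=> 1),
    (fun t => dquot (r t) ('D_(0, v.2) (f t)), dquot r0 ('D_(0, v.2) f0)))]; split.
- move=> q; rewrite !inE => /orP[] /eqP -> /=; split=> //.
    left; apply: (jconv_dilate rr0 r01 r001); first exact: jconv_derive.
    exact: jets_ueq_derive.
  right; exists (fun t => 'D_(0, v.2) (f t)), ('D_(0, v.2) f0); split => //.
  + by split; [exact: jconv_derive|exact: jets_ueq_derive].
  + by move: s2 fz; apply: filterS2 => t ft; exact: axis_zero_derive.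
  + exact: axis_zero_derive.
- move: s2 r01; apply: filterS2 => t ft t01 x Ux.
  by rewrite big_cons big_seq1 /= !mul1r derive_dquot.
- by move=> x Ux; rewrite big_cons big_seq1 /= !mul1r derive_dquot.
Unshelve. all: by end_near. Qed.

End quotient_family.
End Dilation.

(** * The topology of jets *)

Section JetTopology.
Variable R : realType.

Lemma cvg_to_initial (T : Type) (S : choiceType) (X : topologicalType) (f : S -> X) (F : set_system T)
  {FF : Filter F} (h : T -> S) (x : S) :
  (f \o h) @ F --> f x -> h @ F --> (x : initial_topology f).
Proof.
move=> H A; rewrite nbhsE => -[B [[C oC <-] Cx] BA].
by apply: (filterS BA); apply: H; exact: open_nbhs_nbhs.
Qed.

Section uniform.
Variables (E : choiceType) (W : normedModType R) (U : set E).
Variables (T : Type) (F : set_system T).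
Context {FF : Filter F}.

Lemma cvg_uniformP (g : T -> {uniform` U -> W}) (g0 : {uniform` U -> W}) :
  g @ F --> g0 <-> forall eps : R, 0 < eps -> \forall t \near F,
    forall x, U x -> `|g t x - g0 x| <= eps.
Proof.
split=> [gc eps e0|H A].
  have : nbhs g0 [set k : {uniform` U -> W} | forall x, U x -> `|k x - g0 x| <= eps].
    apply/uniform_nbhs; exists [set xy : W * W | ball xy.1 eps xy.2]; split.
      exact: (entourage_ball W (PosNum e0)).
    move=> k /= kP x Ux; have := kP x Ux; rewrite -ball_normE /= distrC; exact: ltW.
  by move=> /gc.
move=> /uniform_nbhs[B [eB BA]].
move: eB; rewrite -entourage_from_ballE => -[eps /= e0 eB].
have e20 : 0 < eps / 2 by rewrite divr_gt0.
have := H _ e20; apply: filterS => t gt; apply: BA => x Ux; apply: eB.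
rewrite /= -ball_normE /= distrC (le_lt_trans (gt x Ux))//.
by rewrite ltr_pdivrMr// ltr_pMr// ltr1n.
Qed.

Lemma cvg_jetsP (D : Type) (g : T -> {ptws D -> {uniform` U -> W}})
    (g0 : {ptws D -> {uniform` U -> W}}) :
  g @ F --> g0 <-> forall s, (fun t => g t s) @ F --> g0 s.
Proof.
split=> [gc s|H].
  have /cvg_sup/(_ s) gs := gc.
  exact: (cvg_comp _ _ gs (@initial_continuous _ _ (proj s) g0)).
apply/cvg_sup => s; apply: cvg_to_initial; exact: H.
Qed.

End uniform.

Section coords.
Variables (V W : normedModType R) (I : finType) (e : I -> W) (c : I -> {linear W -> R}).
Hypothesis ec : coordinates e c.
Variables (T : Type) (F : set_system T).
Context {FF : Filter F}.
Variable U : set V.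
Hypothesis oU : open U.

(** Coordinates are linear and commute with iterated derivatives. One direction uses their Lipschitz
    constants, the other the sum of the norms of the [e i], increased by 1 to be a positive
    divisor. *)
Lemma ucvg_coords (f : T -> V -> W) (f0 : V -> W) :
  (forall t, smooth_on U (f t)) -> smooth_on U f0 ->
  (forall s (eps : R), 0 < eps -> \forall t \near F, forall x, U x ->
    `|iter_derive s (f t) x - iter_derive s f0 x| <= eps) <->
  (forall i s, ucvg F U (fun t => iter_derive s (c i \o f t)) (iter_derive s (c i \o f0))).
Proof.
move=> fS f0S; have E s t i x : U x -> iter_derive s (c i \o f t) x - iter_derive s (c i \o f0) x =
    c i (iter_derive s (f t) x - iter_derive s f0 x).
  move=> Ux; rewrite linearB /=.
  by rewrite !(iter_derive_linear _ (ec.1 i) oU _ Ux).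
split=> [H i s|H s].
  have [K K0 KP] := linear_lipschitz (ec.1 i).
  apply: (@ucvg_le _ _ _ _ _ _ _ _ K) => eps e0.
  have := H s eps e0; apply: filterS => t ft x Ux.
  by rewrite E// (le_trans (KP _))// ler_wpM2l ?(ltW K0)// ft.
move=> eps e0.
pose K := 1 + \sum_i `|e i|; have K0 : 0 < K by rewrite ltr_pwDl// sumr_ge0.
have eK : 0 < eps / K by rewrite divr_gt0.
have := filter_forall FF (fun i => H i s _ eK); apply: filterS => t ft x Ux.
rewrite [X in `|X|](ec.2 (iter_derive s (f t) x - iter_derive s f0 x)).
rewrite (le_trans (ler_norm_sum _ _ _))//.
apply: (@le_trans _ _ (\sum_i eps / K * `|e i|)).
  apply: ler_sum => i _; rewrite normrZ ler_wpM2r//.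
  by rewrite -E//; exact: ft.
rewrite -mulr_sumr mulrAC ler_pdivrMr// ler_wpM2l ?(ltW e0)//.
by rewrite /K lerDr.
Qed.

End coords.

Lemma smooth_coords (V W : normedModType R) (J : finType) (e' : J -> W)
    (d : J -> {linear W -> R}) (A : set V) (f : A -> W) : coordinates e' d ->
  (forall x : A, exists (U : set V) (G : V -> W), [/\ open U, U (set_val x),
     forall j, Csmooth U (fun x => d j (G x)) &
     forall y : A, U (set_val y) -> G (set_val y) = f y]) -> smooth f.
Proof.
move=> ed H x; have [U [G [oU Ux GS Gf]]] := H x; exists U, G; split=> //.
by apply: (smooth_on_coords ed oU) => j; apply: Csmooth_smooth_on; exact: GS.
Qed.

Lemma smooth_coordsP (V W : normedModType R) (J : finType) (e' : J -> W)
    (d : J -> {linear W -> R}) (A : set V) (f : A -> W) : findim V -> coordinates e' d ->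
  smooth f -> forall x : A, exists (U : set V) (G : V -> W), [/\ open U, U (set_val x),
     forall j, Csmooth U (fun x => d j (G x)) &
     forall y : A, U (set_val y) -> G (set_val y) = f y].
Proof.
move=> fV ed fS x; have [U [G [oU Ux GS Gf]]] := fS x; exists U, G; split=> // j.
by apply: (smooth_on_Csmooth fV oU); apply: smooth_on_linear => //; exact: ed.1.
Qed.

End JetTopology.

(** * The solid torus in angle coordinates *)

Section PeriodicFunctions.
Variable R : realType.

Lemma periodic_int (X : Type) (f : R -> X) (p : R) :
  (forall t, f (t + p) = f t) -> forall (k : int) t, f (t + p *~ k) = f t.
Proof.
move=> fp; have N (k : nat) t : f (t + p *+ k) = f t.
  by elim: k t => [|k IH] t; rewrite ?mulr0n ?addr0// mulrSr addrA fp.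
case=> k t; first exact: N.
by rewrite NegzE mulrNz -[in RHS](subrK (p *+ k.+1) t) N.
Qed.

Lemma period_reduce (t : R) : exists t' (k : int),
  0 <= t' < pi *+ 2 /\ t = t' + (pi *+ 2) *~ k.
Proof.
pose p : R := pi *+ 2; have p0 : 0 < p by rewrite mulrn_wgt0// pi_gt0.
exists (t - p *~ Num.floor (t / p)), (Num.floor (t / p)); split; last by rewrite subrK.
have /andP[h1 h2] := floor_itv (t / p).
rewrite -/p -mulrzr subr_ge0 ltrBlDr; apply/andP; split.
  by rewrite mulrC -ler_pdivlMr.
by rewrite -[X in X + _]mulr1 -mulrDr mulrC addrC -ltr_pdivrMr// -intrD1.
Qed.

Lemma linear_findim_continuous (V W : normedModType R) (I : finType) (e : I -> V)
    (c : I -> {linear V -> R}) (L : {linear V -> W}) : coordinates e c -> continuous L.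
Proof.
move=> ec x; rewrite (_ : L = (fun x => \sum_i c i x *: L (e i)) :> (V -> W)); last first.
  apply/funext => y; rewrite {1}(ec.2 y) linear_sum.
  by apply: eq_bigr => i _; rewrite linearZ.
by apply: continuous_bigsum => i; apply: continuousZl; exact: ec.1.
Qed.

Lemma valL_val (U V : Type) (A : set U) (v : V) (f : A -> V) (x : A) :
  valL_ v f (set_val x) = f x.
Proof. by have := congr1 (@^~ x) (valLK v f). Qed.

Lemma Ck_local k (V : normedModType R) (U : set V) (f : V -> R) : open U ->
  (forall x, U x -> exists (N : set V) (g : V -> R),
    [/\ open N, N x, Ck k N g & forall y, N y -> U y -> f y = g y]) -> Ck k U f.
Proof.
move=> oU; elim: k f => [|k IH] f H.
  move=> x Ux; have [N [g [oN Nx gC fg]]] := H x Ux.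
  apply: (@continuous_near_eq _ _ _ (N `&` U) g) => //; first exact: openI.
    by move=> y [Ny Uy]; rewrite fg.
  exact: gC.
split=> [x Ux|v].
  have [N [g [oN Nx [dg _] fg]]] := H x Ux.
  apply: (@differentiable_near_eq _ _ (N `&` U) g) => //; first exact: openI.
    by move=> y [Ny Uy]; rewrite fg.
  exact: dg.
apply: IH => x Ux; have [N [g [oN Nx [_ Dg] fg]]] := H x Ux.
exists N, ('D_v g); split => //; first exact: Dg.
move=> y Ny Uy.
apply: (@derive_near_eq _ _ _ (N `&` U)) => //; first exact: openI.
by move=> z [Nz Uz]; rewrite fg.
Qed.

Lemma Csmooth_local (V : normedModType R) (U : set V) (f : V -> R) : open U ->
  (forall x, U x -> exists (N : set V) (g : V -> R),
    [/\ open N, N x, Csmooth N g & forall y, N y -> U y -> f y = g y]) -> Csmooth U f.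
Proof.
move=> oU H k; apply: Ck_local => // x /H[N [g [oN Nx gC fg]]].
by exists N, g; split => //; exact: gC.
Qed.

(** Smoothness of [f] on the set [A] supplies an extension near a point, and composing it with [p]
    gives a smooth function on an open set of parameters. Agreement with [f] holds only at
    parameters that [p] sends into [A]. *)
Lemma pullback_local (E V W : normedModType R) (I J : finType)
    (e : I -> V) (c : I -> {linear V -> R}) (e' : J -> W) (d : J -> {linear W -> R})
    (A : set V) (f : A -> W) (p : E -> V) (x0 : E) :
  coordinates e c -> coordinates e' d -> smooth f ->
  (forall i, Csmooth [set: E] (fun x => c i (p x))) -> A (p x0) ->
  exists (N : set E) (G : E -> W), [/\ open N, N x0, forall j, Csmooth N (fun x => d j (G x))
   & forall x, N x -> A (p x) -> valL_ 0 f (p x) = G x].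
Proof.
move=> ec ed fS pS Ax0.
have fV : findim V by exists I, e, c.
have pc : continuous p.
  move=> x; rewrite (_ : p = fun y => \sum_i c i (p y) *: e i); last first.
    by apply/funext => y; rewrite -ec.2.
  apply: continuous_bigsum => i; apply: continuousZl.
  by apply: (Csmooth_continuous (pS i)).
have [U [G [oU Ux GS Gf]]] := smooth_coordsP fV ed fS (SigSub (mem_set Ax0)).
have oN : open (p @^-1` U) by apply: open_comp => // x _; exact: pc.
exists (p @^-1` U), (G \o p); split => //.
  move=> j k; apply: (@Ck_comp _ _ _ _ _ U _ _ _ (fun y => d j (G y)) p ec oN oU) => //.
  - by move=> x _; exact: pc.
  - exact: GS.
  - by move=> i; apply: (Ck_sub _ (pS i k)).
move=> x Ux' Apx; rewrite -[p x]/(set_val (SigSub (mem_set Apx))) valL_val.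
by rewrite -Gf.
Qed.

End PeriodicFunctions.

(** * Uniform bounds from compactness of the closed solid torus *)

Section TorusGeometry.
Variables (R : realType) (n : nat).
Local Notation E := ('cV[R]_n * R)%type.
Local Notation enorm := (@enorm R _).

Lemma enorm_ge0 m (v : 'cV[R]_m) : 0 <= enorm v.
Proof. exact: sqrtr_ge0. Qed.

Lemma enorm_sqr m (v : 'cV[R]_m) : enorm v ^+ 2 = \sum_i v i 0 ^+ 2.
Proof. by rewrite sqr_sqrtr// sumr_ge0// => i _; rewrite sqr_ge0. Qed.

Lemma enormZ m (a : R) (v : 'cV[R]_m) : enorm (a *: v) = `|a| * enorm v.
Proof.
rewrite /enorm -sqrtr_sqr -sqrtrM ?sqr_ge0//; congr Num.sqrt.
by rewrite mulr_sumr; apply: eq_bigr => i _; rewrite mxE exprMn.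
Qed.

Lemma coord_le_enorm m (v : 'cV[R]_m) i : `|v i 0| <= enorm v.
Proof.
rewrite -sqrtr_sqr; apply: ler_wsqrtr; rewrite (bigD1 i)//= lerDl sumr_ge0// => j _.
exact: sqr_ge0.
Qed.

Lemma continuous_enorm m : continuous (@Defs.enorm R m).
Proof.
move=> v; apply: (@continuous_comp _ _ _ (fun v : 'cV[R]_m => \sum_i v i 0 ^+ 2) Num.sqrt).
  apply: continuous_bigsum => i.
  rewrite (_ : (fun v : 'cV[R]_m => _) = (fun v => v i 0 * v i 0)).
    by apply: continuousM; exact: coord_continuous.
  by apply/funext => w; rewrite expr2.
exact: sqrt_continuous.
Qed.

Definition odisk : set E := [set x | enorm x.1 < 1].

Lemma enorm_fst_continuous : continuous (fun x : E => enorm x.1).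
Proof. by move=> x; apply: continuous_comp; [exact: cvg_fst|exact: continuous_enorm]. Qed.

Lemma open_odisk : open odisk.
Proof.
apply: (@open_comp _ _ (fun x : E => enorm x.1) [set r : R | r < 1]); last exact: open_lt.
by move=> x _; exact: enorm_fst_continuous.
Qed.

Lemma odisk_dilate (x : E) (a : R) : 0 <= a <= 1 -> odisk x -> odisk (dilate 'cV[R]_n a x).
Proof.
move=> /andP[a0 a1]; rewrite /odisk /= enormZ ger0_norm//; apply: le_lt_trans.
by rewrite ler_piMl// enorm_ge0.
Qed.

Lemma odisk_bounded ij : ubnd odisk (fun x : E => @mx_coord R n 1 ij x.1).
Proof.
case: ij => i j; exists 1 => x /ltW; apply: le_trans.
by rewrite [j]ord1; exact: coord_le_enorm.
Qed.

(** The box is the image under transposition of a product of segments of row vectors, and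
    transposition is continuous as a linear map in finite dimension. *)
Lemma cV_box_compact (M : R) : compact [set v : 'cV[R]_n | forall i, `|v i 0| <= M].
Proof.
pose A : set 'rV[R]_n := [set v | forall i, `[- M, M]%classic (v 0 i)].
have cA : compact A.
  by apply: (@rV_compact _ n (fun=> `[- M, M]%classic)) => i; exact: segment_compact.
have tl : linear (fun v : 'rV[R]_n => v^T).
  by move=> a u v; apply/matrixP => i j; rewrite !mxE.
pose L : {linear 'rV[R]_n -> 'cV[R]_n} := HB.pack (fun v : 'rV[R]_n => v^T)
  (GRing.isLinear.Build _ _ _ _ _ tl).
have Lc : continuous L := linear_findim_continuous (@coordinates_mx R 1 n).
have := continuous_compact (continuous_subspaceT Lc) cA.
congr compact; apply/seteqP; split=> [_ [v Av <-] i|v Av].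
  by rewrite mxE; have := Av i; rewrite /= in_itv /= ler_norml.
exists v^T; last by rewrite /L /= trmxK.
by move=> i; rewrite /= in_itv /= -ler_norml mxE.
Qed.

(** One period of angles over the closed disk: it is compact, and periodic functions take all their
    values over the disk on it. *)
Definition ctorus : set E := [set x | enorm x.1 <= 1 /\ `[0, pi *+ 2]%classic x.2].

Lemma compact_ctorus : compact ctorus.
Proof.
have K : compact [set v : 'cV[R]_n | enorm v <= 1].
  have cl : closed [set v : 'cV[R]_n | enorm v <= 1].
    apply: (@closed_comp _ _ (@Defs.enorm R n) [set r : R | r <= 1]); last exact: closed_le.
    by move=> x _; exact: continuous_enorm.
  apply: (subclosed_compact cl (@cV_box_compact 1)).
  by move=> v v1 i; apply: le_trans v1; exact: coord_le_enorm.
have -> : ctorus = [set v | enorm v <= 1] `*` `[0, pi *+ 2]%classic.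
  by apply/seteqP; split=> x [].
by apply: compact_setX => //; exact: segment_compact.
Qed.

(** An extension is required near boundary points too, but it has to agree with [f] only inside the
    open disk. In this form the property passes to derivatives, whereas values on the closed disk do
    not determine the derivatives of [f] at its boundary. *)
Definition locally_smooth (f : E -> R) : Prop := forall x0, enorm x0.1 <= 1 ->
  exists (N : set E) (G : E -> R), [/\ open N, N x0, Csmooth N G &
    forall x, N x -> odisk x -> f x = G x].

Definition angle_periodic (X : Type) (f : E -> X) : Prop :=
  forall v t, f (v, t + pi *+ 2) = f (v, t).

Lemma locally_smooth_derive f v : locally_smooth f -> locally_smooth ('D_v f).
Proof.
move=> H x0 /H[N [G [oN Nx GC fG]]]; exists N, ('D_v G); split => //.
  exact: CsmoothD.
move=> x Nx' dx; apply: (@derive_near_eq _ _ _ (N `&` odisk)) => //.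
  by apply: openI => //; exact: open_odisk.
by move=> y [Ny dy]; exact: fG.
Qed.

Lemma angle_periodic_derive (f : E -> R) v : angle_periodic f -> angle_periodic ('D_v f).
Proof.
move=> fp w t; rewrite /derive; set g1 := (fun h : R => _); set g2 := (fun h : R => _).
suff -> : g1 = g2 by [].
apply/funext => h; rewrite /g1 /g2 /=; congr (_ *: (_ - _)); last exact: fp.
have -> : h *: v + (w, t + pi *+ 2) = ((h *: v).1 + w, (h *: v).2 + t + pi *+ 2).
  by apply/pair_equal_spec; split=> //=; rewrite addrA.
exact: fp.
Qed.

Lemma locally_smooth_iter f s : locally_smooth f -> locally_smooth (iter_derive s f).
Proof. by move=> H; elim: s => //= v s; exact: locally_smooth_derive. Qed.

Lemma angle_periodic_iter (f : E -> R) s : angle_periodic f ->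
  angle_periodic (iter_derive s f).
Proof. by move=> H; elim: s => //= v s; exact: angle_periodic_derive. Qed.

Lemma locally_smooth_Csmooth f : locally_smooth f -> Csmooth odisk f.
Proof.
move=> H; apply: Csmooth_local; first exact: open_odisk.
by move=> x /ltW/H[N [G [oN Nx GC fG]]]; exists N, G; split.
Qed.

Lemma angle_reduce (t : R) : exists t' : R, `[0, pi *+ 2]%classic t' /\
  forall (X : Type) (f : E -> X) v, angle_periodic f -> f (v, t) = f (v, t').
Proof.
have [t' [k [/andP[t0 t1] ->]]] := period_reduce t.
exists t'; split; first by rewrite /= in_itv /= t0 ltW.
by move=> X f v fp; rewrite (@periodic_int R X (fun t => f (v, t)))//.
Qed.

(** Near each point of [ctorus] the local extension is bounded; compactness gives one bound for all
    points, and periodicity brings every angle into [ctorus]. *)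
Lemma locally_smooth_ubnd f : locally_smooth f -> angle_periodic f -> ubnd odisk f.
Proof.
move=> fS fp.
have : \forall M \near +oo%R, ctorus `<=` [set x | odisk x -> `|f x| <= M].
  apply: (iffLR (compact_near_coveringP _) compact_ctorus) => x0 [x01 _].
  have [N [G [oN Nx GC fG]]] := fS x0 x01.
  have Gc := Csmooth_continuous GC Nx.
  exists ((N `&` [set x | `|G x0 - G x| <= 1]), [set M : R | `|G x0| + 1 <= M]).
    split; last exact: nbhs_pinfty_ge.
    apply: filterI; first exact: open_nbhs_nbhs.
    by have /cvgrPdist_le/(_ 1 ltr01) := Gc.
  move=> [x M] /= [[Nx' G1] M1] dx; rewrite fG//; apply: le_trans M1.
  rewrite -[X in `|X|](subrK (G x0)) addrC (le_trans (ler_normD _ _))// lerD//.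
  by rewrite distrC.
move=> /filter_ex[M MP]; exists M => -[v t] dx.
have [t' [t01 E']] := angle_reduce t.
by rewrite E'//; apply: MP => //; split => //; exact: ltW.
Qed.

(** For x near x0 and a near a0, both values of [f] are within eps / 2 of the value of a local
    extension at [dilate a0 x0], a point that may lie on the boundary. Compactness makes the
    neighbourhood of a0 independent of x0. *)
Lemma locally_smooth_ueq f : locally_smooth f -> angle_periodic f -> ueq odisk f.
Proof.
move=> fS fp a0 eps a01 e0.
have : \forall a \near a0, ctorus `<=` [set x | 0 <= a <= 1 -> odisk x ->
    `|f (dilate _ a x) - f (dilate _ a0 x)| <= eps].
  apply: (iffLR (compact_near_coveringP _) compact_ctorus R (nbhs a0)
    (fun a x => 0 <= a <= 1 -> odisk x ->
      `|f (dilate _ a x) - f (dilate _ a0 x)| <= eps)) => x0 [x01 _].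
  have y01 : enorm (dilate _ a0 x0).1 <= 1.
    rewrite /= enormZ mulr_ile1 ?enorm_ge0//; case/andP: a01 => ? ?; by rewrite ger0_norm.
  have [N [G [oN Nx GC fG]]] := fS _ y01.
  have Gc := Csmooth_continuous GC Nx.
  have e20 : 0 < eps / 2 by rewrite divr_gt0.
  have nG : nbhs (dilate _ a0 x0) (N `&` [set y | `|G (dilate _ a0 x0) - G y| <= eps / 2]).
    apply: filterI; first exact: open_nbhs_nbhs.
    by have /cvgrPdist_le/(_ _ e20) := Gc.
  have c1 : (fun xa : E * R => dilate _ xa.2 xa.1) @ (x0, a0) --> dilate _ a0 x0.
    have H1 : (fun xa : E * R => xa.2 *: xa.1.1) @ (x0, a0) --> a0 *: x0.1.
      apply: cvgZ; first exact: cvg_snd.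
      by apply: cvg_comp; [exact: cvg_fst|exact: cvg_fst].
    have H2 : (fun xa : E * R => xa.1.2) @ (x0, a0) --> x0.2.
      by apply: cvg_comp; [exact: cvg_fst|exact: cvg_snd].
    exact: (cvg_pair H1 H2).
  have c2 : (fun xa : E * R => dilate _ a0 xa.1) @ (x0, a0) --> dilate _ a0 x0.
    apply: (cvg_comp fst (dilate _ a0)); first exact: cvg_fst.
    exact: dilate_continuous.
  have n1 : \forall xa \near (x0, a0), (N `&` [set y | `|G (dilate _ a0 x0) - G y| <= eps / 2])
     (dilate _ xa.2 xa.1) := c1 _ nG.
  have n2 : \forall xa \near (x0, a0), (N `&` [set y | `|G (dilate _ a0 x0) - G y| <= eps / 2])
     (dilate _ a0 xa.1) := c2 _ nG.
  move: n1 n2; apply: filterS2 => -[x a] /= [N1 G1] [N2 G2] a01' dx.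
  rewrite !fG//; try exact: odisk_dilate.
  rewrite (le_trans (ler_distD (G (dilate _ a0 x0)) _ _))// (splitr eps) lerD//.
  by rewrite distrC.
apply: filterS => a aP a01' [v t] dx.
have [t' [t01 E']] := angle_reduce t.
have := aP (v, t') (conj (ltW dx) t01) a01' dx.
by rewrite /= (E' _ f (a *: v))// (E' _ f (a0 *: v)).
Qed.

End TorusGeometry.

Lemma ord2_cases (i : 'I_2) : i = 0 \/ i = 1.
Proof. by case: i => [[|[|//]] ?]; [left|right]; apply/val_inj. Qed.

(** * The angle as a local coordinate on the circle *)

Section Angles.
Variable R : realType.

Lemma angle_ptE (t : R) i j : angle_pt R t i j = if i == 0 then cos t else sin t.
Proof. by rewrite mxE. Qed.

Lemma angle_pt_inj (t u : R) : angle_pt R t = angle_pt R u <-> cos t = cos u /\ sin t = sin u.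
Proof.
split=> [/matrixP H|[c s]]; first by have := H 0 0; have := H 1 0; rewrite !mxE.
by apply/matrixP => i j; rewrite !mxE c s.
Qed.

Lemma angle_pt_periodic (k : int) (t : R) : angle_pt R (t + (pi *+ 2) *~ k) = angle_pt R t.
Proof.
apply: periodic_int => u; apply/angle_pt_inj.
by split; [exact: cosD2pi|exact: sinD2pi].
Qed.

(** Halving the angle, cos x = 1 forces sin (x / 2) = 0, while sin is positive strictly between 0
    and pi. *)
Lemma cos_eq1 (x : R) : 0 <= x < pi *+ 2 -> cos x = 1 -> x = 0.
Proof.
move=> /andP[x0 x2] c1.
have h : x = x / 2 + x / 2 by rewrite -splitr.
have s0 : sin (x / 2) ^+ 2 = 0.
  move: c1; rewrite {1}h cosD -!expr2; have := cos2Dsin2 (x / 2); lra.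
apply/eqP; rewrite eq_le x0 andbT leNgt; apply/negP => xp.
have : 0 < sin (x / 2).
  by apply: sin_gt0_pi; rewrite divr_gt0//= ltr_pdivrMr// mulr_natr.
by move/eqP: s0; rewrite sqrf_eq0 => /eqP ->; rewrite ltxx.
Qed.

Lemma angle_pt_eq (t u : R) : angle_pt R t = angle_pt R u ->
  exists k : int, t = u + (pi *+ 2) *~ k.
Proof.
move=> /angle_pt_inj[c s].
have [d [k [d01 E]]] := period_reduce (t - u).
exists k; suff d0 : d = 0 by rewrite d0 add0r in E; rewrite -E addrC subrK.
apply: cos_eq1 => //.
rewrite (_ : d = t - u + (pi *+ 2) *~ (- k)); last by rewrite E mulrNz addrK.
have := angle_pt_periodic (- k) (t - u) => /angle_pt_inj[-> _].
by rewrite cosB c s -!expr2 cos2Dsin2.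
Qed.

Lemma circleE (y : 'cV[R]_2) : circle R y <-> y 0 0 ^+ 2 + y 1 0 ^+ 2 = 1.
Proof.
have e2 : enorm R y ^+ 2 = y 0 0 ^+ 2 + y 1 0 ^+ 2.
  rewrite enorm_sqr big_ord_recl big_ord1.
  by congr (_ + y _ _ ^+ 2); apply/val_inj.
rewrite -e2; split=> [->|/eqP]; first by rewrite expr1n.
by rewrite sqrp_eq1 ?enorm_ge0// => /eqP.
Qed.

Lemma circle_angle_pt_ex (y : 'cV[R]_2) : circle R y -> exists t, y = angle_pt R t.
Proof.
move=> /circleE y1.
have B : -1 <= y 0 0 <= 1.
  rewrite -ler_norml -(@ler_pXn2r _ 2)// ?nnegrE// real_normK ?num_real//.
  by rewrite expr1n -y1 lerDl sqr_ge0.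
have c := @acosK R (y 0 0); rewrite in_itv /= in c.
have s : sin (acos (y 0 0)) = `|y 1 0|.
  by rewrite sin_acos// -sqrtr_sqr -y1 addrAC subrr add0r.
case: (leP 0 (y 1 0)) => y10.
  exists (acos (y 0 0)); apply/matrixP => i j; rewrite [j]ord1 mxE.
  by case: (ord2_cases i) => -> /=; rewrite ?c// s ger0_norm.
exists (- acos (y 0 0)); apply/matrixP => i j; rewrite [j]ord1 mxE.
by case: (ord2_cases i) => -> /=; rewrite ?cosN ?c// sinN s ltr0_norm ?opprK.
Qed.

Lemma atan_div (c s : R) : 0 < c -> c ^+ 2 + s ^+ 2 = 1 ->
  cos (atan (s / c)) = c /\ sin (atan (s / c)) = s.
Proof.
move=> c0 cs; have cn0 : c != 0 by rewrite gt_eqF.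
have C : cos (atan (s / c)) = c.
  rewrite cos_atan (_ : 1 + (s / c) ^+ 2 = (c^-1) ^+ 2).
    by rewrite sqrtr_sqr gtr0_norm ?invr_gt0// invrK.
  by rewrite exprMn -{1}(@mulfV _ (c ^+ 2)) ?expf_neq0// exprVn -mulrDl cs mul1r.
split=> //; have := atanK (s / c); rewrite /tan C => H.
by rewrite -[LHS](@mulfVK _ c) // H mulfVK.
Qed.

(** A smooth branch of the angle near t0: [X] and [Y] are the coordinates in the frame rotated by
    t0, and t0 + atan (Y / X) works on the half-plane X > 0. *)
Lemma angle_local (t0 : R) : exists (N : set 'cV[R]_2) (psi : 'cV[R]_2 -> R),
  [/\ open N, N (angle_pt R t0), Csmooth N psi, psi (angle_pt R t0) = t0 &
   forall y, N y -> circle R y -> angle_pt R (psi y) = y].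
Proof.
pose X (y : 'cV[R]_2) : R := cos t0 * y 0 0 + sin t0 * y 1 0.
pose Y (y : 'cV[R]_2) : R := cos t0 * y 1 0 - sin t0 * y 0 0.
pose N : set 'cV[R]_2 := [set y | 0 < X y].
have mxS k U i : Ck k U (fun y : 'cV[R]_2 => y i 0).
  apply: (@Ck_linear _ k _ U (@mx_coord R 2 1 (i, 0))); exact: coord_continuous.
have XS U : open U -> Csmooth U X.
  by move=> oU k; apply: CkD => //; apply: CkM => //; exact: Ck_cst.
have YS U : open U -> Csmooth U Y.
  move=> oU; apply: (Csmooth_eq oU (f0 := fun y : 'cV[R]_2 => cos t0 * y 1 0 + (- sin t0) * y 0 0)).
    by move=> y _; rewrite /Y mulNr.
  by move=> k; apply: CkD => //; apply: CkM => //; exact: Ck_cst.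
have oN : open N.
  apply: (@open_comp _ _ X [set r : R | 0 < r]); last exact: open_gt.
  by move=> y _; apply: (Csmooth_continuous (XS _ openT)).
have tr : cos t0 * cos t0 + sin t0 * sin t0 = 1 by rewrite -!expr2 cos2Dsin2.
exists N, (fun y => t0 + atan (Y y / X y)); split => //.
- by rewrite /N /= /X !angle_ptE /= tr.
- move=> k; apply: CkD => //; first exact: Ck_cst.
  apply: (Csmooth_comp_1d oN openT _ (@Csmooth_atan R)) => // j.
  apply: CkM => //; first exact: YS.
  apply: (Csmooth_comp_1d oN (@open_neq0 R) _ (@Csmooth_inv R)); last exact: XS.
  by move=> y; rewrite /N /= => Xy; rewrite gt_eqF.
- by rewrite /Y !angle_ptE /= [sin t0 * _]mulrC subrr mul0r atan0 addr0.
move=> y Ny yc; have [t yt] := circle_angle_pt_ex yc; subst y.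
have XE : X (angle_pt R t) = cos (t - t0) by rewrite /X !angle_ptE /= cosB; ring.
have YE : Y (angle_pt R t) = sin (t - t0) by rewrite /Y !angle_ptE /= sinB; ring.
have [|c s] := @atan_div (cos (t - t0)) (sin (t - t0)) _ (cos2Dsin2 _).
  by rewrite -XE.
rewrite XE YE; apply/angle_pt_inj.
by split; [rewrite [LHS]cosD c s -cosD|rewrite [LHS]sinD c s -sinD]; rewrite addrC subrK.
Qed.

Lemma open_preimage_in (S T : topologicalType) (f : S -> T) (N : set S) (M : set T) :
  open N -> open M -> (forall x, N x -> {for x, continuous f}) -> open (N `&` f @^-1` M).
Proof.
move=> oN oM fc; rewrite openE => x [Nx Mx]; apply: filterI.
  exact: open_nbhs_nbhs.
by apply: (fc x Nx); exact: open_nbhs_nbhs.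
Qed.

(** The neighbourhood of the extension may depend on the coordinate; the finitely many
    neighbourhoods are intersected. *)
Lemma smooth_percoord (V W : normedModType R) (J : finType) (e : J -> W)
    (d : J -> {linear W -> R}) (A : set V) (f : A -> W) : coordinates e d ->
  (forall j (x : A), exists (U : set V) (G : V -> R), [/\ open U, U (set_val x),
     Csmooth U G & forall y : A, U (set_val y) -> G (set_val y) = d j (f y)]) -> smooth f.
Proof.
move=> ed H; apply: (smooth_coords ed) => x.
have /choice[NG NGP] : forall j, exists NG : set V * (V -> R),
    [/\ open NG.1, NG.1 (set_val x), Csmooth NG.1 NG.2 &
     forall y : A, NG.1 (set_val y) -> NG.2 (set_val y) = d j (f y)].
  by move=> j; have [N [G NGj]] := H j x; exists (N, G).
pose U : set V := \bigcap_(j in [set: J]) (NG j).1.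
have oU : open U.
  rewrite openE => y Uy.
  have Nj j : nbhs y (NG j).1.
    by apply: open_nbhs_nbhs; split; [have [] := NGP j|exact: Uy].
  by have := filter_forall (nbhs_filter y) Nj; apply: filterS => z h j _; exact: h.
exists U, (fun y => \sum_j (NG j).2 y *: e j); split => //.
- by move=> j _; have [] := NGP j.
- move=> j; apply: (Csmooth_eq oU (f0 := fun y => \sum_i (NG i).2 y * d j (e i))).
    move=> y _; rewrite linear_sum; apply: eq_bigr => i _.
    by rewrite linearZ.
  move=> k; apply: Ck_sum => // i; apply: CkM => //; last exact: Ck_cst.
  by have [_ _ GS _] := NGP i; apply: (Ck_sub _ (GS k)) => y Uy; exact: Uy.
- move=> y Uy; rewrite [RHS](ed.2 (f y)); apply: eq_bigr => j _.
  by have [_ _ _ ->] := NGP j => //; exact: Uy.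
Qed.

Lemma circle_smooth (W : normedModType R) (J : finType) (e : J -> W) (d : J -> {linear W -> R})
    (f : circle R -> W) (phi : R -> W) : coordinates e d ->
  (forall t, f (angle R t) = phi t) -> (forall j, Csmooth [set: R] (fun t => d j (phi t))) ->
  smooth f.
Proof.
move=> ed fphi phiS; apply: (smooth_coords ed) => y.
have [t yt] := circle_angle_pt_ex (set_valP y).
have [N [psi [oN Nt psiS _ psiK]]] := angle_local t.
exists N, (phi \o psi); split => //.
- by move: yt Nt => /= <-.
- by move=> j; apply: (Csmooth_comp_1d oN openT _ (phiS j) psiS).
- move=> z Nz /=; rewrite -fphi; congr f; apply: val_inj => /=.
  exact: (psiK _ Nz (set_valP z)).
Qed.

End Angles.

(** * Self-maps of the solid torus in angle coordinates *)

Section TorusMaps.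
Variables (R : realType) (n : nat).
Local Notation E := ('cV[R]_n * R)%type.
Local Notation W := ('cV[R]_n * 'cV[R]_2)%type.
Local Notation enorm := (@Defs.enorm R _).
Local Notation odisk := (@odisk R n).

Definition torus_coord := prod_coord (@mx_coord R n 1) (@mx_coord R 2 1).
Definition angle_coord :=
  prod_coord (@mx_coord R n 1) (fun _ : unit => idfun : {linear R -> R}).

Definition torus_basis (k : ('I_n * 'I_1) + ('I_2 * 'I_1)) : W :=
  match k with
  | inl ij => (delta_mx ij.1 ij.2, 0)
  | inr ij => (0, delta_mx ij.1 ij.2)
  end.

Definition angle_basis (k : ('I_n * 'I_1) + unit) : E :=
  match k with
  | inl ij => (delta_mx ij.1 ij.2, 0)
  | inr _ => (0, 1)
  end.

Lemma coordinates_torus : coordinates torus_basis torus_coord.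
Proof. exact: coordinates_prod (@coordinates_mx R n 1) (@coordinates_mx R 2 1). Qed.

Lemma coordinates_angle : coordinates angle_basis angle_coord.
Proof. exact: coordinates_prod (@coordinates_mx R n 1) (@coordinates_R R). Qed.

Lemma torus_torus_pt (x : E) : enorm x.1 <= 1 -> torus R n (torus_pt R x).
Proof. by move=> x1; split => //; exact: circle_angle_pt. Qed.

Lemma Csmooth_cos_snd : Csmooth [set: E] (fun x => cos x.2) /\ Csmooth [set: E] (fun x => sin x.2).
Proof.
have [C S] := @Csmooth_cos_sin R setT openT.
have p : Csmooth [set: E] (fun x => x.2).
  move=> k; apply: (@Ck_linear _ k _ setT (snd : {linear E -> R})).
  by move=> x; exact: cvg_snd.
by split; [apply: (Csmooth_comp_1d openT openT _ C p)|apply: (Csmooth_comp_1d openT openT _ S p)].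
Qed.

Lemma torus_pt_smooth i : Csmooth [set: E] (fun x => torus_coord i (torus_pt R x)).
Proof.
have [C S] := Csmooth_cos_snd.
case: i => [ij|[i j]].
  move=> k; apply: (@Ck_linear _ k _ setT (@mx_coord R n 1 ij \o fst : {linear E -> R})).
  by move=> x; apply: continuous_comp; [exact: cvg_fst|exact: coord_continuous].
rewrite (_ : (fun x => _) = fun x : E => if i == 0 then cos x.2 else sin x.2).
  by case: (i == 0).
by apply/funext => x; rewrite /= mxE.
Qed.

(* A self-map of the solid torus in the coordinates [(v, t)] of [(v, e^it)];
   the junk value outside the closed disk is 0. *)
Definition angle_form (k : torus R n -> torus R n) (x : E) : W :=
  valL_ 0 (set_val \o k) (torus_pt R x).

Definition torus_elt (x : E) (x1 : enorm x.1 <= 1) : torus R n :=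
  SigSub (mem_set (torus_torus_pt x1)).

Lemma angle_formE k x (x1 : enorm x.1 <= 1) : angle_form k x = set_val (k (torus_elt x1)).
Proof. exact: (valL_val _ (set_val \o k) (torus_elt x1)). Qed.

Lemma torus_eltP (u : torus R n) : exists (x : E) (x1 : enorm x.1 <= 1), u = torus_elt x1.
Proof.
have [u1 /circle_angle_pt_ex[t ut]] := set_valP u.
exists ((set_val u).1, t), u1; apply: val_inj => /=.
by rewrite /torus_pt /= -ut -surjective_pairing.
Qed.

(** Here agreement is on the closed disk, as needed to rebuild a smooth map of the solid torus;
    [locally_smooth] is the weaker form that passes to derivatives. *)
Definition closed_smooth (f : E -> R) : Prop := forall x0, enorm x0.1 <= 1 ->
  exists (N : set E) (G : E -> R), [/\ open N, N x0, Csmooth N G &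
    forall x, N x -> enorm x.1 <= 1 -> f x = G x].

Lemma closed_smooth_local f : closed_smooth f -> locally_smooth f.
Proof.
move=> H x0 /H[N [G [oN Nx GC fG]]]; exists N, G; split => // x Nx' dx.
by apply: fG => //; exact: ltW.
Qed.

Lemma angle_form_smooth k j : smooth (set_val \o k) ->
  closed_smooth (fun x => torus_coord j (angle_form k x)).
Proof.
move=> kS x0 x01.
have [N [G [oN Nx GS kG]]] := pullback_local coordinates_torus coordinates_torus kS
  torus_pt_smooth (torus_torus_pt x01).
exists N, (fun x => torus_coord j (G x)); split => // x Nx' x1.
by rewrite /angle_form kG//; exact: torus_torus_pt.
Qed.

Lemma angle_form_periodic k : angle_periodic (angle_form k).
Proof.
move=> v t; rewrite /angle_form; congr (valL_ _ _ _).
apply/pair_equal_spec; split => //=.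
by have := angle_pt_periodic 1 t; rewrite mulr1z.
Qed.

(** Near a point of the torus, a local extension of [K] is composed with a smooth branch of the
    angle. The branch inverts [angle_pt] on the circle, which is enough at points of the torus. *)
Lemma torus_smooth (k : torus R n -> torus R n) (K : E -> W) :
  (forall x (x1 : enorm x.1 <= 1), set_val (k (torus_elt x1)) = K x) ->
  (forall j, closed_smooth (fun x => torus_coord j (K x))) -> smooth (set_val \o k).
Proof.
move=> kK KS; apply: (smooth_percoord coordinates_torus) => j u.
have [x0 [x1 uE]] := torus_eltP u.
have [N [psi [oN Nt psiS psi0 psiK]]] := angle_local x0.2.
have [N' [G [oN' Nx0 GS KG]]] := KS j x0 x1.
pose p (w : W) : E := (w.1, psi w.2).
have oN2 : open [set w : W | N w.2].
  by apply: (@open_comp _ _ (snd : W -> _)) => // w _; exact: cvg_snd.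
have pS i : Csmooth [set w : W | N w.2] (fun w => angle_coord i (p w)).
  case: i => [ij|[]].
    move=> k'; apply: (@Ck_linear _ k' _ _ (@mx_coord R n 1 ij \o fst : {linear W -> R})).
    by move=> x; apply: continuous_comp; [exact: cvg_fst|exact: coord_continuous].
  have := @Csmooth_comp_linear R _ _ N [set w : W | N w.2] (snd : {linear W -> 'cV[R]_2}) psi.
  by apply => // w; exact: cvg_snd.
have pc w : N w.2 -> {for w, continuous p}.
  move=> Nw; rewrite (_ : p = fun y => \sum_i angle_coord i (p y) *: angle_basis i).
    apply: continuous_bigsum => i; apply: continuousZl.
    exact: (Csmooth_continuous (pS i)).
  by apply/funext => y; rewrite -coordinates_angle.2.
have oP : open ([set w : W | N w.2] `&` p @^-1` N') by exact: open_preimage_in.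
exists ([set w : W | N w.2] `&` p @^-1` N'), (G \o p); split => //.
- by rewrite uE; split => //=; rewrite /p /= psi0 -surjective_pairing.
- move=> k'; apply: (@Ck_comp _ _ _ _ _ N' _ _ _ G p coordinates_angle) => //.
  + by move=> w [].
  + by move=> w [Nw _]; exact: pc.
  + by move=> i; apply: (Ck_sub _ (pS i k')) => w [].
- move=> y [Ny N'y] /=.
  have [y1 y2] := set_valP y.
  have py1 : enorm (p (set_val y)).1 <= 1 by [].
  rewrite -KG// -(kK _ py1); congr (torus_coord j (set_val (k _))).
  apply: val_inj => /=; rewrite /torus_pt /= psiK//.
  by rewrite -surjective_pairing.
Qed.

End TorusMaps.

Arguments torus_coord {R n}.
Arguments torus_basis {R n}.

(** * Leaf-preserving diffeomorphisms and loops *)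

Section LeafDiffeos.
Variables (R : realType) (n : nat).
Local Notation E := ('cV[R]_n * R)%type.
Local Notation W := ('cV[R]_n * 'cV[R]_2)%type.
Local Notation enorm := (@Defs.enorm R _).
Local Notation odisk := (@odisk R n).
Local Notation aform := (@angle_form R n).

(** Some angle of [y], chosen with no continuity; it is only fed to periodic functions. The default
    0 concerns points off the circle. *)
Definition arg (y : 'cV[R]_2) : R := xget 0 [set t | y = angle_pt R t].

Lemma argK y : circle R y -> angle_pt R (arg y) = y.
Proof. by move=> /circle_angle_pt_ex[t yt]; rewrite /arg; case: xgetP => [u _ <-|/(_ t)]. Qed.

Lemma angle_periodic_eq (X : Type) (K : E -> X) v t u : angle_periodic K ->
  angle_pt R t = angle_pt R u -> K (v, t) = K (v, u).
Proof.
move=> Kp /angle_pt_eq[k ->].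
by rewrite (@periodic_int R X (fun t => K (v, t)))//.
Qed.

(** What a map in angle coordinates must satisfy to descend to a smooth self-map of the torus that
    sends each leaf into itself. *)
Definition leaf_data (K : E -> W) : Prop :=
  [/\ forall j, closed_smooth (fun x => torus_coord j (K x)), angle_periodic K &
   forall x, enorm x.1 <= 1 -> enorm (K x).1 = enorm x.1 /\ circle R (K x).2].

(** [K] after [K'] is the identity. Such maps take an angle but return a point of the circle, so the
    composite is expressed through the representatives [z] of [K' x]. *)
Definition left_inverse (K K' : E -> W) : Prop :=
  forall x z, enorm x.1 <= 1 -> K' x = torus_pt R z -> K z = torus_pt R x.

(** Invariance is applied to the leaf through [u], whose radius is the norm of the disk component of
    [u]. *)
Lemma leaf_norm (h : leaf_diffeo R n) (u : torus R n) :
  enorm (set_val (h u)).1 = enorm (set_val u).1.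
Proof.
have [u1 u2] := set_valP u.
have Lu : leaf R (enorm (set_val u).1) u by split.
have fL : foliation R n (leaf R (enorm (set_val u).1)).
  by exists (enorm (set_val u).1) => //; rewrite /= in_itv /= enorm_ge0.
have : leaf R (enorm (set_val u).1) (h u).
  by rewrite -(diffeo_leaf _ _ h _ fL); exists u.
by move=> [].
Qed.

Lemma norm_leaf (k k' : torus R n -> torus R n) : cancel k' k ->
  (forall u, enorm (set_val (k u)).1 = enorm (set_val u).1) ->
  forall L, foliation R n L -> k @` L = L.
Proof.
move=> kK kn _ [r _ <-]; apply/seteqP; split=> [_ [u [u1 u2] <-]|u [u1 u2]].
  split; last by have [] := set_valP (k u).
  by rewrite /sphere /= kn.
exists (k' u); last exact: kK.
split; last by have [] := set_valP (k' u).
by rewrite /sphere /= -kn kK.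
Qed.

Lemma diffeo_ext (h h' : leaf_diffeo R n) :
  (forall x, enorm x.1 <= 1 -> aform h x = aform h' x) -> h = h'.
Proof.
move=> hh; have E : diffeo_fun R n h = diffeo_fun R n h'.
  apply/funext => u; have [x [x1 ->]] := torus_eltP u.
  by apply: val_inj; have := hh x x1; rewrite !angle_formE.
case: h h' hh E => [f f1 f2 f3] [g g1 g2 g3] /= _ E; subst g.
by congr LeafDiffeo; exact: Prop_irrelevance.
Qed.

(** Reduces the construction of a diffeomorphism to formulas for the map and its inverse in angle
    coordinates. Leaves are mapped into themselves because norms are kept, and onto because of the
    inverse. *)
Lemma mk_diffeo (K K' : E -> W) : leaf_data K -> leaf_data K' ->
  left_inverse K K' -> left_inverse K' K ->
  exists h : leaf_diffeo R n, forall x, enorm x.1 <= 1 -> aform h x = K x.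
Proof.
(* [K0] descends to the torus by evaluating at an angle picked by [arg]; periodicity makes the value
   independent of the pick. *)
have build K0 : leaf_data K0 -> exists k : torus R n -> torus R n,
    forall x (x1 : enorm x.1 <= 1), set_val (k (torus_elt x1)) = K0 x.
  move=> [_ Kp Kn].
  have P (u : torus R n) : torus R n (K0 ((set_val u).1, arg (set_val u).2)).
    have [u1 _] := set_valP u.
    by have [e1 e2] := Kn ((set_val u).1, arg (set_val u).2) u1; split => //; rewrite /disk /= e1.
  exists (fun u => SigSub (mem_set (P u))) => -[v t] x1 /=.
  apply: (angle_periodic_eq v Kp).
  by apply: argK; exact: circle_angle_pt.
move=> d d'; have [k kE] := build _ d; have [k' kE'] := build _ d'.
have canc K0 K0' k0 k0' : leaf_data K0' -> 
  (forall x (x1 : enorm x.1 <= 1), set_val (k0 (torus_elt x1)) = K0 x) ->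
  (forall x (x1 : enorm x.1 <= 1), set_val (k0' (torus_elt x1)) = K0' x) ->
  left_inverse K0 K0' -> cancel k0' k0.
  move=> _ H H' KK u; have [x [x1 ->]] := torus_eltP u.
  have [z [z1 zE]] := torus_eltP (k0' (torus_elt x1)).
  apply: val_inj; rewrite zE [LHS](H z z1).
  by apply: KK => //; rewrite -H' zE.
move=> KK KK'.
have c1 := canc _ _ _ _ d' kE kE' KK; have c2 := canc _ _ _ _ d kE' kE KK'.
have sm : smooth (set_val \o k) by apply: torus_smooth kE _; have [] := d.
have sm' : smooth (set_val \o k') by apply: torus_smooth kE' _; have [] := d'.
have nm u : enorm (set_val (k u)).1 = enorm (set_val u).1.
  have [x [x1 ->]] := torus_eltP u; rewrite kE.
  by have [_ _ /(_ x x1)[]] := d.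
have inv : exists g : torus R n -> torus R n, [/\ cancel k g, cancel g k & smooth (set_val \o g)].
  by exists k'.
exists (LeafDiffeo R n k sm inv (norm_leaf c1 nm)) => x x1.
by rewrite (angle_formE _ x1) /= kE.
Qed.

Lemma leaf_data_aform (h : leaf_diffeo R n) : leaf_data (aform h).
Proof.
split.
- by move=> j; apply: angle_form_smooth; exact: diffeo_smooth.
- exact: angle_form_periodic.
- move=> x x1; rewrite (angle_formE _ x1) leaf_norm; split => //.
  by have [] := set_valP (h (torus_elt x1)).
Qed.

Lemma diffeo_inverse (h : leaf_diffeo R n) : exists h' : leaf_diffeo R n,
  left_inverse (aform h) (aform h') /\ left_inverse (aform h') (aform h).
Proof.
have [g [hg gh gs]] := diffeo_inv _ _ h.
have gn u : enorm (set_val (g u)).1 = enorm (set_val u).1.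
  by rewrite -[in RHS](gh u) leaf_norm.
have inv : exists g' : torus R n -> torus R n, [/\ cancel g g', cancel g' g & smooth (set_val \o g')].
  by exists h; split => //; exact: diffeo_smooth.
pose h' := LeafDiffeo R n g gs inv (norm_leaf hg gn).
have canc (k k' : leaf_diffeo R n) : cancel k' k -> left_inverse (aform k) (aform k').
  move=> kK x z x1; rewrite (angle_formE _ x1) => zE.
  have z1 : enorm z.1 <= 1.
    by rewrite -[z.1]/(torus_pt R z).1 -zE; have [] := set_valP (k' (torus_elt x1)).
  rewrite (angle_formE _ z1) (_ : torus_elt z1 = k' (torus_elt x1)) ?kK//.
  by apply: val_inj; rewrite /= -zE.
by exists h'; split; apply: canc.
Qed.

Section convergence.
Variables (T : Type) (F : set_system T).
Context {FF : Filter F}.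

Lemma closed_smooth_Csmooth (f : E -> R) : closed_smooth f -> Csmooth odisk f.
Proof. by move=> /closed_smooth_local; exact: locally_smooth_Csmooth. Qed.

Lemma aform_Csmooth (h : leaf_diffeo R n) j : Csmooth odisk (fun x => torus_coord j (aform h x)).
Proof. by apply: closed_smooth_Csmooth; have [] := leaf_data_aform h. Qed.

Lemma aform_smooth_on (h : leaf_diffeo R n) : smooth_on odisk (aform h).
Proof.
apply: (smooth_on_coords (@coordinates_torus R n)); first exact: open_odisk.
by move=> j; apply: Csmooth_smooth_on; exact: aform_Csmooth.
Qed.

Lemma coord_periodic (K : E -> W) j : angle_periodic K -> angle_periodic (fun x => torus_coord j (K x)).
Proof. by move=> Kp v t /=; rewrite Kp. Qed.

Lemma aform_jets_ueq (h : leaf_diffeo R n) j : jets_ueq odisk (fun x => torus_coord j (aform h x)).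
Proof.
have [cs Kp _] := leaf_data_aform h => s.
apply: locally_smooth_ueq; first exact/locally_smooth_iter/closed_smooth_local.
by apply: angle_periodic_iter; exact: coord_periodic.
Qed.

(** Translates the topology of the diffeomorphism space into scalar terms. The boundedness contained
    in [jconv] is automatic here, by compactness of the closed torus. *)
Lemma cvg_diffeoP (H : T -> leaf_diffeo R n) (h0 : leaf_diffeo R n) :
  H @ F --> h0 <-> forall j, jconv F odisk (fun t x => torus_coord j (aform (H t) x))
    (fun x => torus_coord j (aform h0 x)).
Proof.
have U := ucvg_coords (@coordinates_torus R n) (@open_odisk R n)
   (fun t => aform_smooth_on (H t)) (aform_smooth_on h0).
split=> [Hc j|Hj].
  have Hc' : (@diffeo_jets R n \o H) @ F --> diffeo_jets R h0.
    by apply: (cvg_comp _ _ Hc); exact: (@initial_continuous _ _ (@diffeo_jets R n) h0).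
  apply: jconvP.
  - exact: aform_Csmooth.
  - by apply: nearW => t; exact: aform_Csmooth.
  - move=> s; apply: ((U F FF).1 _ j s) => {}s eps e0.
    by have /cvg_jetsP/(_ s)/cvg_uniformP/(_ eps e0) := Hc'.
  - have [cs Kp _] := leaf_data_aform h0 => s.
    apply: locally_smooth_ubnd; first exact/locally_smooth_iter/closed_smooth_local.
    by apply: angle_periodic_iter; exact: coord_periodic.
apply: (@cvg_to_initial _ _ _ (@diffeo_jets R n)).
apply/cvg_jetsP => s; apply/cvg_uniformP => eps e0.
apply: ((U F FF).2 _ s eps e0) => j {}s.
exact: (jconv_ucvg s (Hj j)).
Qed.

End convergence.
End LeafDiffeos.

(** * Loops as periodic matrix-valued functions *)

Section Loops.
Variables (R : realType) (n : nat).

Lemma angle_pt_smooth i : Csmooth [set: R] (fun t => @mx_coord R 2 1 i (angle_pt R t)).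
Proof.
have [C S] := @Csmooth_cos_sin R setT openT.
case: i => i j; rewrite (_ : (fun x => _) = fun x : R => if i == 0 then cos x else sin x).
  by case: (i == 0).
by apply/funext => x; rewrite /= mxE.
Qed.

Lemma circle_map_Csmooth (W : normedModType R) (J : finType) (e : J -> W)
   (d : J -> {linear W -> R}) (f : circle R -> W) j : coordinates e d -> smooth f ->
  Csmooth [set: R] (fun t => d j (f (angle R t))).
Proof.
move=> ed fS; apply: Csmooth_local; first exact: openT.
move=> t _.
have [N [G [oN Nt GS fG]]] := pullback_local (@coordinates_mx R 2 1) ed fS
  angle_pt_smooth (circle_angle_pt R t).
exists N, (fun t => d j (G t)); split => // u Nu _.
rewrite -fG//; last exact: circle_angle_pt.
by rewrite -[angle_pt R u]/(set_val (angle R u)) valL_val.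
Qed.

Definition loop_form (Phi : smooth_loop R n) (t : R) : 'M[R]_n := set_val (Phi (angle R t)).

Lemma loop_form_periodic (Phi : smooth_loop R n) t : loop_form Phi (t + pi *+ 2) = loop_form Phi t.
Proof.
rewrite /loop_form; congr (set_val (Phi _)); apply: val_inj => /=.
by have := angle_pt_periodic 1 t; rewrite mulr1z.
Qed.

Lemma loop_form_Csmooth Phi i j : Csmooth [set: R] (fun t => loop_form Phi t i j).
Proof. exact: (circle_map_Csmooth (i, j) (@coordinates_mx R n n) (loop_smooth _ _ Phi)). Qed.

(** Derivatives are again periodic and continuous, hence bounded by their bound on one compact
    period. *)
Lemma periodic_ubnd (f : R -> R) : Csmooth [set: R] f -> (forall t, f (t + pi *+ 2) = f t) ->
  forall s, ubnd [set: R] (iter_derive s f).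
Proof.
move=> fC fp s.
have D : forall s, Csmooth [set: R] (iter_derive s f) by move=> s'; exact: Csmooth_iter.
have P : forall s t, iter_derive s f (t + pi *+ 2) = iter_derive s f t.
  elim=> // v s' IH t /=; rewrite /derive; set g1 := (fun h : R => _); set g2 := (fun h : R => _).
  suff -> : g1 = g2 by [].
  by apply/funext => h; rewrite /g1 /g2 /= addrA !IH.
have /compact_bounded[M [_ MP]] : compact (iter_derive s f @` `[0, pi *+ 2]).
  apply: continuous_compact; last exact: segment_compact.
  by apply: continuous_subspaceT => t; apply: (Csmooth_continuous (D s)).
exists (M + 1) => t _.
have [t' [k [/andP[t0 t1] ->]]] := period_reduce t.
rewrite (periodic_int (P s)); apply: (MP (M + 1)); first by rewrite ltrDl.
by exists t' => //; rewrite /= in_itv /= t0 ltW.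
Qed.

Section convergence.
Variables (T : Type) (F : set_system T).
Context {FF : Filter F}.

(** The analogue of [cvg_diffeoP] for loops, with the bounds on the limit supplied by
    periodicity. *)
Lemma cvg_loopP (H : T -> smooth_loop R n) (Phi : smooth_loop R n) :
  H @ F --> Phi <-> forall i j, jconv F [set: R] (fun t x => loop_form (H t) x i j)
    (fun x => loop_form Phi x i j).
Proof.
have LE (P : smooth_loop R n) : loop_form P = valL_ 0 (set_val \o P) \o angle_pt R.
  by apply/funext => t; exact: (esym (valL_val 0 (set_val \o P) (angle R t))).
have sm (P : smooth_loop R n) : smooth_on [set: R] (loop_form P).
  apply: (smooth_on_coords (@coordinates_mx R n n)); first exact: openT.
  by move=> -[i j]; apply: Csmooth_smooth_on; exact: loop_form_Csmooth.
have U := ucvg_coords (@coordinates_mx R n n) openT (fun t => sm (H t)) (sm Phi).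
split=> [Hc i j|Hj].
  have Hc' : (@loop_jets R n \o H) @ F --> loop_jets R Phi.
    by apply: (cvg_comp _ _ Hc); exact: (@initial_continuous _ _ (@loop_jets R n) Phi).
  apply: jconvP.
  - exact: loop_form_Csmooth.
  - by apply: nearW => t; exact: loop_form_Csmooth.
  - move=> s; apply: ((U F FF).1 _ (i, j) s) => {}s eps e0.
    have /cvg_jetsP/(_ s)/cvg_uniformP/(_ eps e0) := Hc'.
    by apply: filterS => t Ht x xT; have := Ht x xT; rewrite !LE.
  - apply: periodic_ubnd; first exact: loop_form_Csmooth.
    by move=> t; rewrite loop_form_periodic.
apply: (@cvg_to_initial _ _ _ (@loop_jets R n)).
apply/cvg_jetsP => s; apply/cvg_uniformP => eps e0.
have := (U F FF).2 (fun i s => jconv_ucvg s (Hj i.1 i.2)) s eps e0.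
by apply: filterS => t Ht x xT; have := Ht x xT; rewrite !LE.
Qed.

End convergence.
End Loops.

(** * Lifts of circle maps *)

Section Lifts.
Variable R : realType.
Local Notation p2 := (pi *+ 2 : R).

Lemma pi2_gt0 : 0 < p2.
Proof. by rewrite mulrn_wgt0// pi_gt0. Qed.

Lemma is_derive_cst_eq (f g q : R -> R) : (forall t : R, is_derive t 1 f (q t)) ->
  (forall t : R, is_derive t 1 g (q t)) -> f 0 = g 0 -> f = g.
Proof.
move=> df dg fg; apply/funext => t; apply/eqP; rewrite -subr_eq0; apply/eqP.
have d (s : R) : is_derive s 1 (f - g) (q s - q s) by exact: is_deriveB.
have [|u _] := @line_mvt R R (f - g) 0 1 t; first by move=> u _; have [] := d (0 + (u * t) *: 1).
have [_ ->] := d (0 + (u * t) *: 1).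
by rewrite subrr mulr0 add0r [_ *: 1]mulr1 /= !fctE fg subrr subr0.
Qed.

(** The integral from [a]; the fundamental theorem of calculus is applied to the right of [a]
    only. *)
Lemma primitive_right (q : R -> R) (a : R) : continuous q ->
  exists p : R -> R, forall t : R, a < t -> is_derive t 1 p (q t).
Proof.
move=> qc; exists (fun x => (\int[lebesgue_measure]_(t in [set` `[a, x]]) (q t))%R) => t at'.
have tt : t < t + 1 by rewrite ltrDl.
have qi : lebesgue_measure.-integrable `[a, t + 1] (EFin \o q).
  apply: continuous_compact_integrable; first exact: segment_compact.
  exact: continuous_subspaceT.
have [d1 d2] := continuous_FTC1_closed tt qi at' (qc t).
by split; [exact: d1|rewrite -derive1E; exact: d2].
Qed.

(** Two one-sided primitives are glued, the second being obtained by the reflection t -> -t.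
    Normalized at 0, they agree on the overlap (-1, 1), where their difference has zero
    derivative. *)
Lemma primitive (q : R -> R) : continuous q ->
  exists p : R -> R, p 0 = 0 /\ forall t : R, is_derive t 1 p (q t).
Proof.
move=> qc; have [p1 d1] := primitive_right (-1) qc.
have qnc : continuous (fun t => - q (- t)).
  by move=> t; apply: continuousN; apply: continuous_comp; [exact: oppr_continuous|exact: qc].
have [p2 d2] := primitive_right (-1) qnc.
have d2' (t : R) : t < 1 -> is_derive t 1 (fun t => p2 (- t)) (q t).
  move=> t1; have dn : is_derive t 1 (fun s : R => - s) (-1).
    by apply: is_derive_eq.
  have d2t : is_derive (- t) 1 p2 (- q (- - t)) by apply: d2; rewrite ltrN2.
  have := is_derive1_comp d2t dn; rewrite opprK mulrN1 opprK.
  by [].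
have mid (t : R) : -1 < t -> t < 1 -> p1 t - p1 0 = p2 (- t) - p2 (- 0).
  move=> ta tb; pose g (s : R) := p1 s - p2 (- s).
  have dg (s : R) : -1 < s -> s < 1 -> is_derive s 1 g (q s - q s).
    by move=> sa sb; apply: is_deriveB; [exact: d1|exact: d2'].
  have rng (u : R) : 0 <= u <= 1 -> -1 < 0 + (u * t) *: (1 : R) < 1.
    move=> /andP[u0 u1]; rewrite add0r [_ *: _]mulr1 -ltr_norml normrM (ger0_norm u0).
    apply: (@le_lt_trans _ _ `|t|); first by rewrite ler_piMl.
    by rewrite ltr_norml ta tb.
  have [|u /rng/andP[ua ub]] := @line_mvt R R g 0 1 t.
    by move=> u /rng/andP[ua ub]; have [] := dg _ ua ub.
  have [_ ->] := dg _ ua ub; rewrite subrr mulr0 add0r [_ *: _]mulr1 /g; lra.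
exists (fun t => if -1 < t then p1 t - p1 0 else p2 (- t) - p2 (- 0)); split.
  by rewrite ltrN10 subrr.
move=> t; case: (ltP (-1) t) => t1.
  have H : is_derive t 1 (fun s => p1 s - p1 0) (q t).
    have := is_deriveB (d1 t t1) (is_derive_cst (p1 0) t 1); rewrite subr0.
    by [].
  apply: (near_eq_is_derive _ H).
  have : \forall s \near t, -1 < s by apply: lt_nbhsr.
  by apply: filterS => s ->.
have t1' : t < 1 by rewrite (le_lt_trans t1)// ltrN10.
have H : is_derive t 1 (fun s => p2 (- s) - p2 (- 0)) (q t).
  have := is_deriveB (d2' t t1') (is_derive_cst (p2 (- 0)) t 1); rewrite subr0.
  by [].
apply: (near_eq_is_derive _ H).
have : \forall s \near t, s < 1 by apply: lt_nbhsl.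
apply: filterS => s s1; case: ifP => // s2.
by rewrite mid.
Qed.

Lemma Csmooth_primitive (p q : R -> R) : (forall t : R, is_derive t 1 p (q t)) ->
  Csmooth [set: R] q -> Csmooth [set: R] p.
Proof.
move=> pq qC; case=> [|k]; last by apply: (Ck_1d openT (fun x _ => pq x)); exact: qC.
move=> x _; apply: differentiable_continuous; apply/derivable1_diffP.
by have [] := pq x.
Qed.

Lemma Csmooth_is_derive (f : R -> R) (t : R) : Csmooth [set: R] f -> is_derive t 1 f ('D_1 f t).
Proof. by move=> fC; apply/derivableP/diff_derivable/(Csmooth_derivable fC). Qed.

(** The lift is an initial angle plus the primitive of the angular speed x y' - y x'. That it is a
    lift follows from x cos L + y sin L and y cos L - x sin L, the cosine and sine of the angle
    between (x, y) and its candidate: both have zero derivative and start at 1 and 0. *)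
Lemma lift_exists (x y : R -> R) : Csmooth [set: R] x -> Csmooth [set: R] y ->
  (forall t, x t ^+ 2 + y t ^+ 2 = 1) ->
  exists L : R -> R, Csmooth [set: R] L /\ forall t, x t = cos (L t) /\ y t = sin (L t).
Proof.
move=> xC yC xy.
pose w t := x t * 'D_1 y t + (- 1) * (y t * 'D_1 x t).
have wC : Csmooth [set: R] w.
  move=> k; apply: CkD; first exact: openT.
    by apply: CkM; [exact: openT|exact: xC|exact: CsmoothD].
  apply: CkM; [exact: openT|exact: Ck_cst|].
  by apply: CkM; [exact: openT|exact: yC|exact: CsmoothD].
have [p [p0 pd]] : exists p : R -> R, p 0 = 0 /\ forall t : R, is_derive t 1 p (w t).
  by apply: primitive => t; exact: (Csmooth_continuous wC).
have [b0 [bx by_]] : exists b, x 0 = cos b /\ y 0 = sin b.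
  have c0 : circle R (\col_i (if i == 0 then x 0 else y 0)).
    by apply/circleE; rewrite !mxE /= xy.
  have [b /matrixP bE] := circle_angle_pt_ex c0.
  by exists b; have := bE 0 0; have := bE 1 0; rewrite !mxE.
pose L t := b0 + p t.
have Ld (t : R) : is_derive t 1 L (w t).
  by have := is_deriveD (is_derive_cst b0 t 1) (pd t); rewrite add0r.
have LC := Csmooth_primitive Ld wC.
exists L; split => //.
have xd t := Csmooth_is_derive t xC; have yd t := Csmooth_is_derive t yC.
have cd (t : R) : is_derive t 1 (cos \o L) (- sin (L t) * w t).
  exact: (is_derive1_comp (is_derive_cos (L t)) (Ld t)).
have sd (t : R) : is_derive t 1 (sin \o L) (cos (L t) * w t).
  exact: (is_derive1_comp (is_derive_sin (L t)) (Ld t)).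
(* The derivative of x^2 + y^2 = 1. Combined with the definition of [w] it gives x' = - w y and y' =
   w x. *)
have orth t : x t * 'D_1 x t + y t * 'D_1 y t = 0.
  have d : is_derive t 1 (x * x + y * y)
      (x t *: 'D_1 x t + x t *: 'D_1 x t + (y t *: 'D_1 y t + y t *: 'D_1 y t)).
    by apply: is_deriveD; apply: is_deriveM.
  have E : x * x + y * y = cst 1.
    by apply/funext => s; rewrite /= -[RHS](xy s) !expr2.
  have [_ ] := d; rewrite E derive_cst /GRing.scale /= => H.
  by move: H; move: (x t * _) (y t * _) => u v H; lra.
have dx t : 'D_1 x t = - w t * y t.
  rewrite /w; have := orth t; have := xy t.
  move: (x t) (y t) ('D_1 x t : R) ('D_1 y t : R) => a b a' b' h1 h2.
  apply/eqP; rewrite -subr_eq0; apply/eqP.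
  transitivity (a' * (1 - (a ^+ 2 + b ^+ 2)) + a * (a * a' + b * b')); first by ring.
  by rewrite h1 h2; ring.
have dy t : 'D_1 y t = w t * x t.
  rewrite /w; have := orth t; have := xy t.
  move: (x t) (y t) ('D_1 x t : R) ('D_1 y t : R) => a b a' b' h1 h2.
  apply/eqP; rewrite -subr_eq0; apply/eqP.
  transitivity (b' * (1 - (a ^+ 2 + b ^+ 2)) + b * (a * a' + b * b')); first by ring.
  by rewrite h1 h2; ring.
have P : x * (cos \o L) + y * (sin \o L) = cst 1.
  have H1 (t : R) : is_derive t 1 (x * (cos \o L) + y * (sin \o L)) 0.
    have := is_deriveD (is_deriveM (xd t) (cd t)) (is_deriveM (yd t) (sd t)).
    rewrite dx dy /GRing.scale /= => H; apply: (is_derive_eq H); ring.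
  have H2 (t : R) : is_derive t 1 (cst 1 : R -> R) (0 : R) by exact: is_derive_cst.
  apply: (is_derive_cst_eq H1 H2).
  by rewrite /= !fctE /= /L p0 addr0 bx by_ -!expr2 cos2Dsin2.
have Q : y * (cos \o L) - x * (sin \o L) = cst 0.
  have H1 (t : R) : is_derive t 1 (y * (cos \o L) - x * (sin \o L)) 0.
    have := is_deriveB (is_deriveM (yd t) (cd t)) (is_deriveM (xd t) (sd t)).
    rewrite dx dy /GRing.scale /= => H; apply: (is_derive_eq H); ring.
  have H2 (t : R) : is_derive t 1 (cst 0 : R -> R) (0 : R) by exact: is_derive_cst.
  apply: (is_derive_cst_eq H1 H2).
  by rewrite /= !fctE /= /L p0 addr0 bx by_ mulrC subrr.
move=> t; have /(congr1 (@^~ t)) Pt := P; have /(congr1 (@^~ t)) Qt := Q.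
rewrite /= !fctE /= in Pt; rewrite /= !fctE /= in Qt.
have := cos2Dsin2 (L t); move: (x t) (y t) (cos (L t)) (sin (L t)) Pt Qt => a b c s h1 h2 h3.
(* [Pt] and [Qt] form a linear system in x and y with determinant cos^2 + sin^2 = 1; the two
   identities below solve it. *)
split; apply/eqP; rewrite -subr_eq0; apply/eqP.
  transitivity (a * (1 - (c ^+ 2 + s ^+ 2)) + c * (a * c + b * s - 1) - s * (b * c - a * s)).
    by ring.
  by rewrite h1 h2 h3; ring.
transitivity (b * (1 - (c ^+ 2 + s ^+ 2)) + s * (a * c + b * s - 1) + c * (b * c - a * s)).
  by ring.
by rewrite h1 h2 h3; ring.
Qed.

Lemma nonzero_sign (f : R -> R) : continuous f -> (forall t, f t != 0) ->
  exists2 e : R, e = 1 \/ e = -1 & forall t, 0 < e * f t.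
Proof.
move=> fc f0; have S s t : 0 < f s -> 0 < f t.
  move=> fs; rewrite ltNge; apply/negP => ft.
  have iv : Num.min (f (Num.min s t)) (f (Num.max s t)) <= 0 <= Num.max (f (Num.min s t)) (f (Num.max s t)).
    by case: (leP s t) => _; rewrite ge_min le_max ft (ltW fs) ?orbT.
  have [|u _ /eqP] := @IVT R f (Num.min s t) (Num.max s t) 0 _ (continuous_subspaceT fc) iv.
    by rewrite ge_min le_max lexx.
  by apply/negP.
case: (ltP 0 (f 0)) => h.
  by exists 1; [left|move=> t; rewrite mul1r; exact: S h].
exists (-1); first by right.
move=> t; rewrite mulN1r oppr_gt0 lt_neqAle f0 /= leNgt; apply/negP => /(S _ 0).
by rewrite ltNge h.
Qed.

Lemma sign_sqr (e : R) : e = 1 \/ e = -1 -> e * e = 1.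
Proof. by case=> ->; rewrite ?mulr1// mulrN1 opprK. Qed.

Lemma angle_pt_sign (e t : R) : e = 1 \/ e = -1 -> angle_pt R (t + e * p2) = angle_pt R t.
Proof.
case=> ->; first by rewrite mul1r; have := angle_pt_periodic 1 t; rewrite mulr1z.
by rewrite mulN1r; have := angle_pt_periodic (-1) t; rewrite mulrN1z.
Qed.

Lemma increasing_lift (L : R -> R) (e : R) : Csmooth [set: R] L ->
  (forall t, 0 < e * 'D_1 L t) -> forall s t, s < t -> e * L s < e * L t.
Proof.
move=> LC Lp s t st.
have [|u _] := @line_mvt R R L s 1 (t - s).
  by move=> u _; apply/diff_derivable/(Csmooth_derivable LC).
have -> : s + (t - s) *: (1 : R) = t by rewrite [_ *: _]mulr1 addrC subrK.
move=> H; rewrite -subr_gt0 -mulrBr H mulrCA mulr_gt0// ?subr_gt0//.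
Qed.

(** The pair ([gx], [gy]) plays the inverse circle map. Its composite with L is (cos, sin), whose
    derivative never vanishes, so L' has a constant sign [e]; injectivity modulo 2 pi then forces
    the degree to be [e] itself. *)
Lemma lift_degree (L gx gy : R -> R) : Csmooth [set: R] L -> Csmooth [set: R] gx ->
  Csmooth [set: R] gy -> (forall t, gx (t + p2) = gx t) -> (forall t, gy (t + p2) = gy t) ->
  (forall t, gx (L t) = cos t /\ gy (L t) = sin t) ->
  (forall t, angle_pt R (L (t + p2)) = angle_pt R (L t)) ->
  exists e : R, [/\ e = 1 \/ e = -1, forall t, 0 < e * 'D_1 L t &
    forall t, L (t + p2) = L t + e * p2].
Proof.
move=> LC xC yC xp yp gL Lp.
have Lnz t : 'D_1 L t != 0.
  apply/eqP => L0.
  have Ld := Csmooth_is_derive t LC; rewrite L0 in Ld.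
  have E1 : gx \o L = cos by apply/funext => s; have [] := gL s.
  have E2 : gy \o L = sin by apply/funext => s; have [] := gL s.
  have [_ ] := is_derive1_comp (Csmooth_is_derive (L t) xC) Ld.
  have [_ ] := is_derive1_comp (Csmooth_is_derive (L t) yC) Ld.
  rewrite E1 E2 !mulr0.
  have [_ ->] := is_derive_sin t; have [_ ->] := is_derive_cos t => c /eqP.
  rewrite oppr_eq0 => /eqP s; have := cos2Dsin2 t; rewrite c s expr0n addr0 => /eqP.
  by rewrite eq_sym oner_eq0.
have [|e e1 ep] := nonzero_sign _ Lnz.
  by move=> t; exact: (Csmooth_continuous (CsmoothD (1 : R) LC)).
exists e; split => // t.
have inc := increasing_lift LC ep.
have [k kE] := angle_pt_eq (Lp t).
have ee := sign_sqr e1.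
have t2 : t < t + p2 by rewrite ltrDl pi2_gt0.
have lt1 := inc _ _ t2; rewrite kE mulrDr ltrDl in lt1.
(* Over a period e L increases by a positive integer multiple of 2 pi, so by at least 2 pi. *)
case: (leP (e * L t + p2) (e * L (t + p2))) => h; last first.
  exfalso; move: h lt1; rewrite kE mulrDr ltrD2l.
  rewrite -mulrzr => h lt1.
  have ek : e * k%:~R = (k%:~R : R) \/ e * k%:~R = (- k)%:~R :> R.
    by case: e1 => ->; [left; rewrite mul1r|right; rewrite mulN1r mulrNz].
  have [j jE] : exists j : int, e * k%:~R = j%:~R :> R.
    by case: ek => ->; [exists k|exists (- k)].
  move: h lt1; rewrite mulrCA jE -{2}(mulr1 p2) => h lt1.
  move: h; rewrite ltr_pM2l ?pi2_gt0// ltrz1 => j1.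
  by move: lt1; rewrite pmulr_rgt0 ?pi2_gt0// ltr0z gtz0_ge1 leNgt j1.
have cont : {within `[t, t + p2], continuous (fun s => e * L s)}.
  apply: continuous_subspaceT => s; apply: continuousM; first exact: cst_continuous.
  exact: (Csmooth_continuous LC).
(* Somewhere in the period e L has grown by exactly 2 pi. The inverse map identifies that point [u]
   with t modulo 2 pi, and t < u <= t + 2 pi leaves only the end point. *)
have [||u] := @IVT R (fun s => e * L s) t (t + p2) (e * L t + p2) _ cont.
- by rewrite ltW.
- have le1 : e * L t <= e * L t + p2 by rewrite lerDl ltW// pi2_gt0.
  by rewrite ge_min le_max h le1 /= orbT.
rewrite in_itv /= => /andP[tu ut] uE.
have LuE : L u = L t + e * p2.
  by rewrite -[LHS]mul1r -[X in _ = X + _]mul1r -ee -!mulrA -mulrDr uE.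
have gp (g : R -> R) : (forall t, g (t + p2) = g t) -> g (L t + e * p2) = g (L t).
  move=> gper; case: e1 => ->; first by rewrite mul1r.
  by rewrite mulN1r -gper subrK.
have ut' : angle_pt R u = angle_pt R t.
  apply/angle_pt_inj; have [<- <-] := gL u; have [<- <-] := gL t.
  by rewrite LuE (gp gx)// (gp gy).
have [j jE] := angle_pt_eq ut'.
suff -> : t + p2 = u by [].
have tu' : t < u.
  rewrite lt_neqAle tu andbT; apply/eqP => tu'; move: uE; rewrite -tu' => /eqP.
  by rewrite -subr_eq0 opprD addrA subrr add0r oppr_eq0 gt_eqF// pi2_gt0.
apply/eqP; rewrite eq_le ut andbT {1}jE lerD2l -mulrzr -{1}(mulr1 p2).
rewrite ler_pM2l ?pi2_gt0// ler1z.
move: tu'; rewrite {1}jE ltrDl -mulrzr pmulr_rgt0 ?pi2_gt0// ltr0z.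
by [].
Qed.

(** L is strictly monotone, and onto by its growth over periods. The equation M' = 1 / (L' o M) then
    bootstraps the smoothness of the inverse. *)
Lemma lift_inverse (L : R -> R) (e : R) : Csmooth [set: R] L -> e = 1 \/ e = -1 ->
  (forall t, 0 < e * 'D_1 L t) -> (forall t, L (t + p2) = L t + e * p2) ->
  exists M : R -> R, [/\ Csmooth [set: R] M, cancel M L, cancel L M &
    forall t, M (t + p2) = M t + e * p2].
Proof.
move=> LC e1 Lp per; have inc := increasing_lift LC Lp; have ee := sign_sqr e1.
have inj : injective L.
  move=> s t E; case: (ltgtP s t) => // /inc; rewrite E ltxx.
    by [].
  by [].
have pern (k : nat) t : L (t + p2 *+ k) = L t + e * (p2 *+ k).
  elim: k t => [|k IH] t; first by rewrite !mulr0n mulr0 !addr0.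
  rewrite (mulrS (pi *+ 2) k) addrA IH per; ring.
have perm (k : nat) t : L (t - p2 *+ k) = L t - e * (p2 *+ k).
  by rewrite -[in RHS](subrK (p2 *+ k) t) pern addrK.
have Lc t : {for t, continuous L} by exact: (Csmooth_continuous LC).
have surj x : exists t, L t = x.
  (* Moving k periods away from 0 changes L by more than |x - L 0|, so [x] is attained between - 2
     pi k and 2 pi k for either sign [e]. *)
  pose k := (Num.bound (`|x - L 0| / p2)).+1.
  have kP : `|x - L 0| < p2 *+ k.
    rewrite -[ltRHS]mulr_natl -ltr_pdivrMr ?pi2_gt0//.
    rewrite (lt_trans (archi_boundP _))// ?divr_ge0// ?(ltW pi2_gt0)//.
    by rewrite ltr_nat.
  have k0 : 0 < p2 *+ k by rewrite (le_lt_trans _ kP).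
  have [||u _ uE] := @IVT R L (- (p2 *+ k)) (p2 *+ k) x _ (continuous_subspaceT Lc).
  - by rewrite ge0_cp// ltW.
  - have := pern k 0; have := perm k 0; rewrite !add0r => -> ->.
    rewrite ltr_norml in kP; case/andP: kP => kP1 kP2.
    rewrite ge_min le_max; case: e1 => ->; rewrite ?mul1r ?mulN1r ?opprK.
      by apply/andP; split; apply/orP; [left|right]; lra.
    by apply/andP; split; apply/orP; [right|left]; lra.
  - by exists u.
have /choice[M ML] := surj.
have LM : cancel L M by move=> t; apply: inj; rewrite ML.
have Md (x : R) : is_derive x 1 M ('D_1 L (M x))^-1.
  rewrite -{1}(ML x); apply: (@is_derive_inverse R L M).
  - by apply: filterE; exact: LM.
  - by apply: filterE => y; exact: Lc.
  - exact: Csmooth_is_derive.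
  - by apply/eqP => L0; have := Lp (M x); rewrite L0 mulr0 ltxx.
exists M; split => //; last first.
  move=> t; apply: inj; rewrite ML.
  have : L (M t + e * p2) = L (M t) + e * (e * p2).
    case: e1 => eE; first by rewrite {1 2 3}eE !mul1r per eE mul1r.
    by have := perm 1%N (M t); rewrite eE !mulr1n !mulN1r opprK.
  by move=> ->; rewrite ML mulrA ee mul1r.
elim=> [|k IH].
  move=> x _; apply: differentiable_continuous; apply/derivable1_diffP.
  by have [] := Md x.
apply: (Ck_1d openT (fun x _ => Md x)).
have Mc (x : R) : [set: R] x -> {for x, continuous M}.
  move=> _; apply: differentiable_continuous; apply/derivable1_diffP.
  by have [] := Md x.
have DLM : Ck k [set: R] (fun x => 'D_1 L (M x)).
  by apply: (Ck_comp_1d openT openT _ Mc (CsmoothD (1 : R) LC k) IH).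
apply: (Ck_comp_1d openT (@open_neq0 R) _ _ (@Csmooth_inv R k) DLM).
- by move=> x _ /=; apply/eqP => L0; have := Lp (M x); rewrite L0 mulr0 ltxx.
- move=> x xT; exact: (continuous_comp (Mc x xT) (Csmooth_continuous (CsmoothD (1 : R) LC) I)).
Qed.

End Lifts.

(** * Diffeomorphisms linear in the disk direction *)

Section LinearDiffeos.
Variables (R : realType) (n : nat).
Local Notation E := ('cV[R]_n * R)%type.
Local Notation W := ('cV[R]_n * 'cV[R]_2)%type.
Local Notation enorm := (@Defs.enorm R _).
Local Notation odisk := (@odisk R n).
Local Notation aform := (@angle_form R n).
Local Notation p2 := (pi *+ 2 : R).

Definition linear_form (A : R -> 'M[R]_n) (L : R -> R) (x : E) : W :=
  (A x.2 *m x.1, angle_pt R (L x.2)).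

Definition linear_data (A : R -> 'M[R]_n) (L : R -> R) (e : R) : Prop :=
  [/\ forall i j, Csmooth [set: R] (fun t => A t i j), forall t, A (t + p2) = A t,
   forall t, (A t)^T *m A t = 1%:M, Csmooth [set: R] L &
   forall t, L (t + p2) = L t + e * p2].

Lemma enorm_sqr_mx m (v : 'cV[R]_m) : enorm v ^+ 2 = (v^T *m v) 0 0.
Proof. by rewrite enorm_sqr mxE; apply: eq_bigr => i _; rewrite mxE expr2. Qed.

Lemma enorm_orthogonal m (Q : 'M[R]_m) v : Q^T *m Q = 1%:M -> enorm (Q *m v) = enorm v.
Proof.
move=> QQ; apply/eqP; rewrite -(@eqrXn2 _ 2) ?enorm_ge0//; apply/eqP.
by rewrite !enorm_sqr_mx trmx_mul mulmxA -[X in X *m v]mulmxA QQ mulmx1.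
Qed.

Lemma Csmooth_comp_snd (V : normedModType R) (f : R -> R) :
  Csmooth [set: R] f -> Csmooth [set: V * R] (fun x : V * R => f x.2).
Proof.
move=> fC; have := @Csmooth_comp_linear R _ _ setT [set: V * R] (snd : {linear (V * R)%type -> R}) f.
by apply => // x; exact: cvg_snd.
Qed.

Lemma leaf_data_linear A L e : e = 1 \/ e = -1 -> linear_data A L e ->
  leaf_data (linear_form A L).
Proof.
move=> e1 [AC Ap AA LC Lp]; split.
- move=> j x0 _; exists setT, (fun x => torus_coord j (linear_form A L x)); split => //.
    exact: openT.
  have [Cc Cs] := @Csmooth_cos_sin R setT openT.
  case: j => [[i j]|[i j]] k.
    apply: (@Ck_eq _ k _ setT (fun x : E => \sum_l A x.2 i l * x.1 l j)); first exact: openT.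
      by move=> x _; rewrite /= mxE.
    apply: Ck_sum; first exact: openT.
    move=> l; apply: CkM; first exact: openT.
      have := @Csmooth_comp_snd 'cV[R]_n _ (AC i l) k; exact.
    apply: (@Ck_linear _ k _ setT (@mx_coord R n 1 (l, j) \o fst : {linear E -> R})).
    by move=> x; apply: continuous_comp; [exact: cvg_fst|exact: coord_continuous].
  have LC2 := @Csmooth_comp_snd 'cV[R]_n _ LC.
  rewrite (_ : (fun x => _) = fun x : E => if i == 0 then cos (L x.2) else sin (L x.2)).
    by case: (i == 0); [apply: (Csmooth_comp_1d openT openT _ Cc LC2)|
      apply: (Csmooth_comp_1d openT openT _ Cs LC2)].
  by apply/funext => x; rewrite /= mxE.
- by move=> v t; rewrite /linear_form /= Ap Lp angle_pt_sign.
- move=> x x1 /=; rewrite enorm_orthogonal//; split => //; exact: circle_angle_pt.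
Qed.

Lemma left_inverse_linear A L A' L' e : e = 1 \/ e = -1 -> linear_data A L e ->
  cancel L' L -> (forall t, A (L' t) *m A' t = 1%:M) ->
  left_inverse (linear_form A L) (linear_form A' L').
Proof.
move=> e1 ld LL AA x z x1 /pair_equal_spec[/= zE aE].
have [_ Kp _] := leaf_data_linear e1 ld.
rewrite (surjective_pairing z) -(angle_periodic_eq z.1 Kp aE) /linear_form /= -zE.
by rewrite mulmxA AA mul1mx LL.
Qed.

(** With M the inverse of L, the inverse map is (v, t) -> (A(M t)^T v, M t), which has the same
    form. *)
Lemma linear_diffeo A L e : e = 1 \/ e = -1 -> linear_data A L e ->
  (forall t, 0 < e * 'D_1 L t) ->
  exists h : leaf_diffeo R n, forall x, enorm x.1 <= 1 -> aform h x = linear_form A L x.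
Proof.
move=> e1 ld Lpos; have [AC Ap AA LC Lp] := ld.
have [M [MC ML LM Mp]] := lift_inverse LC e1 Lpos Lp.
pose A' t := (A (M t))^T.
have AA' t : A t *m (A t)^T = 1%:M by apply: mulmx1C.
have ld' : linear_data A' M e.
  split => //.
  - move=> i j; have := Csmooth_comp_1d openT openT (fun x _ => I) (AC j i) MC.
    by apply: Csmooth_eq; [exact: openT|move=> x _; rewrite mxE].
  - move=> t; rewrite /A' Mp; congr (_^T).
    case: e1 => ->; first by rewrite mul1r.
    by rewrite mulN1r -[in RHS](subrK p2 (M t)) Ap.
  - by move=> t; rewrite /A' trmxK AA'.
apply: (@mk_diffeo _ _ (linear_form A L) (linear_form A' M)).
- exact: leaf_data_linear ld.
- exact: leaf_data_linear ld'.
- by apply: (left_inverse_linear e1 ld ML) => t; exact: AA'.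
- by apply: (left_inverse_linear e1 ld' LM) => t; rewrite /A' LM.
Qed.

Section core.
Variable h : leaf_diffeo R n.

Definition disk_part i (x : E) : R := torus_coord (inl (i, 0)) (aform h x).
Definition circle_part i (x : E) : R := torus_coord (inr (i, 0)) (aform h x).

Definition core_mx (t : R) : 'M[R]_n :=
  \matrix_(i, j) 'D_(delta_mx j 0, 0) (disk_part i) (0, t).

Lemma enorm0 m : enorm (0 : 'cV[R]_m) = 0.
Proof. by rewrite -(scale0r (0 : 'cV[R]_m)) enormZ normr0 mul0r. Qed.

Lemma odisk_axis (t : R) : odisk (0, t).
Proof. by rewrite /odisk/= enorm0 ltr01. Qed.

Lemma enorm_eq0 m (v : 'cV[R]_m) : enorm v = 0 -> v = 0.
Proof.
move=> v0; apply/matrixP => i j; rewrite [j]ord1 mxE; apply/eqP.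
by rewrite -normr_le0 -v0 coord_le_enorm.
Qed.

Lemma aform_enorm x : enorm x.1 <= 1 -> enorm (aform h x).1 = enorm x.1 /\ circle R (aform h x).2.
Proof. by have [_ _ H] := leaf_data_aform h; exact: H. Qed.

Lemma aform_axis t : (aform h (0, t)).1 = 0.
Proof. have t1 : enorm ((0 : 'cV[R]_n), t).1 <= 1 by rewrite /= enorm0 ler01.
by apply: enorm_eq0; rewrite (aform_enorm t1).1 /= enorm0. Qed.

Lemma disk_part_axis i : axis_zero odisk (disk_part i).
Proof. by move=> t _; rewrite /disk_part /= aform_axis mxE. Qed.

Lemma disk_part_Csmooth i : Csmooth odisk (disk_part i).
Proof. exact: aform_Csmooth. Qed.

(** The derivative at the core is expanded in the standard basis; this identifies the end of the
    shrinking as a map linear in the disk direction. *)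
Lemma dquot0E i x : dquot 0 (disk_part i) x = (core_mx x.2 *m x.1) i 0.
Proof.
have d0 : dilate _ 0 x = (0, x.2) by rewrite /= scale0r.
rewrite /dquot eqxx (derive_coords (@coordinates_mx R n 1) _ (disk_part_Csmooth i)); last first.
  by rewrite d0; exact: odisk_axis.
rewrite mxE -(pair_bigA _ (fun k l => x.1 k l * 'D_(delta_mx k l, 0) (disk_part i) (dilate _ 0 x))) /=.
by apply: eq_bigr => k _; rewrite big_ord1 mulrC mxE scale0r.
Qed.

Lemma disk_part_dquot (a : R) x : 0 < a <= 1 -> enorm x.1 <= 1 ->
  enorm (\col_i dquot a (disk_part i) x) = enorm x.1.
Proof.
move=> /andP[a0 a1] x1; have -> : \col_i dquot a (disk_part i) x = a^-1 *: (aform h (dilate _ a x)).1.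
  by apply/matrixP => i j; rewrite !mxE [j]ord1 /dquot gt_eqF.
rewrite enormZ (aform_enorm _).1 /= enormZ; last first.
  by rewrite gtr0_norm// mulr_ile1// ?enorm_ge0// ltW.
by rewrite normfV mulrA mulVf ?mul1r// normr_eq0 gt_eqF.
Qed.

(** For 0 < a <= 1 the rescaled vector has exactly the norm of [v], and it tends to the core
    derivative as a -> 0+, so the limit has that norm too. The convergence comes from [dquot_ueq],
    hence the open disk. *)
Lemma core_mx_enorm_disk t v : enorm v < 1 -> enorm (core_mx t *m v) = enorm v.
Proof.
move=> v1; apply/eqP; rewrite -(@eqrXn2 _ 2) ?enorm_ge0//.
pose N (a : R) := \sum_i dquot a (disk_part i) (v, t) ^+ 2.
have N0 : enorm (core_mx t *m v) ^+ 2 = N 0.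
  by rewrite enorm_sqr; apply: eq_bigr => i _; rewrite dquot0E.
have Na (a : R) : 0 < a <= 1 -> N a = enorm v ^+ 2.
  move=> a01; rewrite -(disk_part_dquot (x := (v, t)) a01) ?ltW//.
  by rewrite enorm_sqr; apply: eq_bigr => i _; rewrite mxE.
have Nc : N a @[a --> 0^'+] --> N 0.
  apply: cvg_bigsum => i.
  have dc : dquot a (disk_part i) (v, t) @[a --> 0^'+] --> dquot 0 (disk_part i) (v, t).
    apply/cvgrPdist_le => eps e0.
    have [_ fb] : True /\ ubnd odisk (disk_part i).
      split => //; apply: locally_smooth_ubnd.
        have [cs _ _] := leaf_data_aform h.
        exact: (closed_smooth_local (cs (inl (i, 0)))).
      by apply: coord_periodic; exact: angle_form_periodic.
    have z01 : (fun a : R => 0 <= a <= 1) 0 by rewrite /= lexx ler01.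
    have := dquot_ueq (@coordinates_mx R n 1) (@odisk_dilate R n)
      (@odisk_bounded R n) (disk_part_Csmooth i) (disk_part_axis i) fb
      (@aform_jets_ueq R n h _) z01 e0.
    rewrite /within /= => H.
    have : \forall a \near (0 : R)^'+, 0 <= a <= 1 ->
        forall x, odisk x -> `|dquot a (disk_part i) x - dquot 0 (disk_part i) x| <= eps.
      have Hn : nbhs (0 : R) [set a | 0 <= a <= 1 ->
        forall x, odisk x -> `|dquot a (disk_part i) x - dquot 0 (disk_part i) x| <= eps] := H.
      by apply: filterS Hn => a /[swap] _; apply.
    have : \forall a \near (0 : R)^'+, 0 < a <= 1.
      near=> a; apply/andP; split; first by near: a; exact: nbhs_right_gt.
      by near: a; apply: nbhs_right_le; exact: ltr01.
    apply: filterS2 => a /andP[a0 a1] Ha.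
    by rewrite distrC; apply: Ha => //; rewrite (ltW a0).
  rewrite expr2 (_ : (fun a => _) = (fun a => dquot a (disk_part i) (v, t) *
     dquot a (disk_part i) (v, t))); first exact: cvgM.
  by apply/funext => a; rewrite expr2.
have Nc' : N a @[a --> 0^'+] --> enorm v ^+ 2.
  apply: cvg_near_cst; near=> a; apply: Na; apply/andP; split.
    by near: a; exact: nbhs_right_gt.
  by near: a; apply: nbhs_right_le; exact: ltr01.
by rewrite N0; apply/eqP; apply: cvg_unique Nc Nc'; exact: Rhausdorff.
Unshelve. all: by end_near. Qed.

Lemma core_mx_enorm t v : enorm (core_mx t *m v) = enorm v.
Proof.
have [v0|v0] := eqVneq (enorm v) 0.
  by rewrite (enorm_eq0 v0) mulmx0.
have vp : 0 < enorm v by rewrite lt_neqAle eq_sym v0 enorm_ge0.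
(* This scales [v] to norm 1/2, inside the open disk; homogeneity gives the rest. *)
pose a := (2 * enorm v)^-1; have a0 : 0 < a by rewrite invr_gt0 mulr_gt0.
have av : enorm (a *: v) < 1.
  by rewrite enormZ gtr0_norm// /a invfM mulfVK// invf_lt1// ltr1n.
have := core_mx_enorm_disk t av.
by rewrite -scalemxAr !enormZ => /mulfI; apply; rewrite normr_eq0 gt_eqF.
Qed.

(** Polarization: S = A^T A - 1 is symmetric with vanishing quadratic form, and evaluating the form
    on e_i and e_i + e_j kills every entry. *)
Lemma core_mx_orthogonal t : (core_mx t)^T *m core_mx t = 1%:M.
Proof.
set A := core_mx t; pose S := A^T *m A - 1%:M.
have Sq (v : 'cV[R]_n) : (v^T *m S *m v) 0 0 = 0.
  rewrite mulmxBr mulmx1 mulmxBl !mulmxA -trmx_mul -mulmxA.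
  by rewrite [LHS]mxE [X in _ + X]mxE -!enorm_sqr_mx core_mx_enorm subrr.
have SE i j : ((delta_mx i 0 : 'cV[R]_n)^T *m S *m (delta_mx j 0 : 'cV[R]_n)) 0 0 = S i j.
  rewrite trmx_delta -rowE mxE (bigD1 j)//= big1 => [|k kj]; last first.
    by rewrite !mxE (negbTE kj) mulr0.
  by rewrite !mxE !eqxx mulr1 addr0.
have Sd i : S i i = 0 by rewrite -SE Sq.
have Ssym i j : S i j = S j i.
  suff : S^T = S by move=> {1}<-; rewrite mxE.
  by rewrite /S linearB /= trmx_mul trmxK trmx1.
have S0 i j : S i j = 0.
  clearbody S; have := Sq (delta_mx i 0 + delta_mx j 0 : 'cV[R]_n).
  have trD (u v : 'cV[R]_n) : (u + v)^T = u^T + v^T by apply/matrixP => k l; rewrite !mxE.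
  rewrite trD !mulmxDl !mulmxDr [LHS]mxE [X in X + _]mxE [X in _ + X]mxE.
  by rewrite !SE !Sd (Ssym j i) => H; lra.
by apply/eqP; rewrite -subr_eq0; apply/eqP/matrixP => i j; rewrite [LHS]S0 mxE.
Qed.

Lemma axis_Csmooth (f : E -> R) : Csmooth odisk f -> Csmooth [set: R] (fun t => f (0, t)).
Proof.
move=> fC; have := @Csmooth_comp_linear R _ _ odisk setT (axis 'cV[R]_n) f.
by apply => //; [exact: axis_continuous|move=> t _; exact: odisk_axis].
Qed.

Lemma core_mx_Csmooth i j : Csmooth [set: R] (fun t => core_mx t i j).
Proof.
apply: (@Csmooth_eq R _ _ openT (fun t => 'D_(delta_mx j 0, 0) (disk_part i) (0, t))).
  by move=> t _; rewrite mxE.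
have H := axis_Csmooth (CsmoothD (delta_mx j 0, 0) (disk_part_Csmooth i)); exact: H.
Qed.

Lemma core_mx_periodic t : core_mx (t + p2) = core_mx t.
Proof.
apply/matrixP => i j; rewrite !mxE; apply: angle_periodic_derive.
by apply: coord_periodic; exact: angle_form_periodic.
Qed.

Lemma core_circle t : circle R (aform h (0, t)).2.
Proof. by have [] := aform_enorm (ltW (odisk_axis t)). Qed.

Lemma aform2_periodic x t : (aform h (x, t + p2)).2 = (aform h (x, t)).2.
Proof. by rewrite angle_form_periodic. Qed.

End core.

Lemma circle_part_Csmooth (h : leaf_diffeo R n) i : Csmooth odisk (circle_part h i).
Proof. exact: aform_Csmooth. Qed.

(** The core is the leaf of radius 0, so [h] induces a circle map there, and the inverse
    diffeomorphism induces the inverse circle map that [lift_degree] asks for. *)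
Lemma core_lift (h : leaf_diffeo R n) : exists L e, [/\ Csmooth [set: R] L, e = 1 \/ e = -1,
  forall t, 0 < e * 'D_1 L t, forall t, L (t + p2) = L t + e * p2 &
  forall t, (aform h (0, t)).2 = angle_pt R (L t)].
Proof.
have bC k i : Csmooth [set: R] (fun t => circle_part k i (0, t)).
  by apply: axis_Csmooth; exact: circle_part_Csmooth.
have [|L [LC bL]] := lift_exists (bC h 0) (bC h 1).
  by move=> t; apply/circleE; exact: core_circle.
have bE t : (aform h (0, t)).2 = angle_pt R (L t).
  apply/matrixP => i j; rewrite [j]ord1 mxE; have [<- <-] := bL t.
  by case: (ord2_cases i) => ->.
have [h' [_ hh]] := diffeo_inverse h.
have gL t : circle_part h' 0 (0, L t) = cos t /\ circle_part h' 1 (0, L t) = sin t.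
  have := hh (0, t) (0, L t) (ltW (odisk_axis t)).
  rewrite (surjective_pairing (aform h (0, t))) aform_axis bE => /(_ erefl) H.
  by rewrite /circle_part /= H /= !mxE.
have [|||e [e1 ep Lp]] := lift_degree LC (bC h' 0) (bC h' 1) _ _ gL.
- by move=> t; rewrite /circle_part /= aform2_periodic.
- by move=> t; rewrite /circle_part /= aform2_periodic.
- by move=> t; rewrite -!bE aform2_periodic.
by exists L, e.
Qed.

End LinearDiffeos.

(** * Shrinking towards the core *)

Section ShrinkingFamily.
Variables (R : realType) (n : nat).
Local Notation E := ('cV[R]_n * R)%type.
Local Notation W := ('cV[R]_n * 'cV[R]_2)%type.
Local Notation enorm := (@Defs.enorm R _).
Local Notation odisk := (@odisk R n).
Local Notation aform := (@angle_form R n).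
Local Notation p2 := (pi *+ 2 : R).
Implicit Types h : leaf_diffeo R n.

Definition shrink_form h (a : R) (x : E) : W :=
  (\col_i dquot a (disk_part h i) x, (aform h (dilate _ a x)).2).

Lemma shrink_form_pos h (a : R) x : 0 < a ->
  shrink_form h a x = (a^-1 *: (aform h (dilate _ a x)).1, (aform h (dilate _ a x)).2).
Proof.
move=> a0; congr pair; apply/matrixP => i j.
by rewrite !mxE [j]ord1 /dquot gt_eqF.
Qed.

Lemma shrink_form_disk h (a : R) x i :
  torus_coord (inl (i, 0)) (shrink_form h a x) = dquot a (disk_part h i) x.
Proof.
change ((\col_i dquot a (disk_part h i) x) i 0 = dquot a (disk_part h i) x).
by rewrite mxE.
Qed.

Lemma dilate_closed_disk (a : R) (x : E) : 0 <= a <= 1 -> enorm x.1 <= 1 ->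
  enorm (dilate 'cV[R]_n a x).1 <= 1.
Proof. by move=> /andP[a0 a1] x1; rewrite /= enormZ ger0_norm// mulr_ile1// enorm_ge0. Qed.

Lemma leaf_data_shrink h (a : R) : 0 < a <= 1 -> leaf_data (shrink_form h a).
Proof.
move=> a01; have /andP[a0 a1] := a01; have [hS hP hN] := leaf_data_aform h.
have a01' : 0 <= a <= 1 by rewrite ltW.
split.
- move=> j x0 x01; have [N [G [oN Nx GS GE]]] := hS j _ (dilate_closed_disk a01' x01).
  have dc := @dilate_continuous R 'cV[R]_n a.
  exists (dilate _ a @^-1` N), (fun x => (if j is inl _ then a^-1 else 1) * G (dilate _ a x)).
  split => //.
  + by move/continuousP : dc; apply.
  + have GC := Csmooth_comp_linear dc (fun x (Nx : (dilate _ a @^-1` N) x) => Nx) GS.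
    move=> k; apply: CkM; [by move/continuousP : dc; apply|exact: Csmooth_cst|exact: GC].
  + move=> x Nax x1; rewrite shrink_form_pos//= -GE//; last exact: dilate_closed_disk.
    by case: j {GE GS hS} => [[i k]|[i k]] /=; rewrite ?mxE ?mul1r.
- move=> v t; rewrite !shrink_form_pos//=; congr pair.
    by rewrite [in LHS](hP _ t).
  by rewrite [in LHS](hP _ t).
- move=> x x1; split; first exact: disk_part_dquot.
  by have [_] := hN _ (dilate_closed_disk a01' x1).
Qed.

Lemma left_inverse_shrink h h' (a : R) : 0 < a <= 1 ->
  left_inverse (aform h) (aform h') -> left_inverse (shrink_form h a) (shrink_form h' a).
Proof.
move=> a01 hh x z x1; have /andP[a0 a1] := a01; rewrite !shrink_form_pos// => zE.
have a01' : 0 <= a <= 1 by rewrite ltW.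
have E1 : aform h' (dilate _ a x) = torus_pt R (dilate _ a z).
  move/pair_equal_spec: zE; rewrite /torus_pt /= => -[<- <-].
  by rewrite scalerA divff ?scale1r ?gt_eqF// -surjective_pairing.
rewrite (hh _ _ (dilate_closed_disk a01' x1) E1) /torus_pt /= scalerA mulVf ?gt_eqF//.
by rewrite scale1r.
Qed.

(** At [a] = 0 the map is linear in the disk direction and [linear_diffeo] applies with a lift of
    the core map. For [a] > 0 shrinking is conjugation by a dilation, so the inverse is the shrunken
    inverse of [h]. *)
Lemma shrink_diffeo_ex h (a : R) : 0 <= a <= 1 ->
  exists k : leaf_diffeo R n, forall x, enorm x.1 <= 1 -> aform k x = shrink_form h a x.
Proof.
move=> /andP[]; rewrite le_eqVlt => /predU1P[<- _|a0 a1].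
  have [L [e [LC e1 Lpos Lp bL]]] := core_lift h.
  have ld : linear_data (core_mx h) L e.
    by split; [exact: core_mx_Csmooth|exact: core_mx_periodic|exact: core_mx_orthogonal| |].
  have [k kE] := linear_diffeo e1 ld Lpos.
  exists k => x x1; rewrite kE// /linear_form /shrink_form -bL; congr pair.
    by apply/matrixP => i j; rewrite [j]ord1 mxE dquot0E.
  by rewrite /= scale0r.
have a01 : 0 < a <= 1 by rewrite a0.
have [h' [hh' h'h]] := diffeo_inverse h.
apply: (@mk_diffeo _ _ (shrink_form h a) (shrink_form h' a)).
- exact: leaf_data_shrink.
- exact: leaf_data_shrink.
- exact: left_inverse_shrink.
- exact: left_inverse_shrink.
Qed.

(** The default [h] can matter only for [a] outside [0, 1]. *)
Definition shrink h (a : R) : leaf_diffeo R n :=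
  xget h [set k | forall x, enorm x.1 <= 1 -> aform k x = shrink_form h a x].

Lemma shrinkE h (a : R) x : 0 <= a <= 1 -> enorm x.1 <= 1 ->
  aform (shrink h a) x = shrink_form h a x.
Proof.
move=> a01 x1; have [k kE] := shrink_diffeo_ex h a01.
by rewrite /shrink; case: xgetP => [k' _|/(_ k)]; [apply|].
Qed.

Lemma shrink1 h : shrink h 1 = h.
Proof.
apply: diffeo_ext => x x1; rewrite shrinkE ?ler01 ?lexx// shrink_form_pos//.
by rewrite invr1 /= !scale1r -!surjective_pairing.
Qed.

(** Joint continuity in the diffeomorphism and the factor, [r0] = 0 included: the disk coordinates
    are quotients ([jconv_dquot]), the circle coordinates plain dilations ([jconv_dilate]). *)
Lemma cvg_shrink (T : Type) (F : set_system T) {FF : Filter F} (h : T -> leaf_diffeo R n)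
    h0 (r : T -> R) (r0 : R) : h @ F --> h0 -> r @ F --> r0 ->
  (\forall t \near F, 0 <= r t <= 1) -> 0 <= r0 <= 1 ->
  (fun t => shrink (h t) (r t)) @ F --> shrink h0 r0.
Proof.
move=> /cvg_diffeoP hh rr r01 r001; apply/cvg_diffeoP => j.
have oU := @open_odisk R n.
case: j => [[i k]|[i k]]; rewrite [k]ord1.
  have J := jconv_dquot (@coordinates_mx R n 1) oU (@odisk_dilate R n) (@odisk_bounded R n)
    rr r01 r001 (hh (inl (i, 0))) (aform_jets_ueq h0 _) _ _.
  move=> m; apply: (jc_eq oU _ _ (J FF _ _ m)).
  - by apply: filterS r01 => t rt x x1; rewrite (shrinkE _ rt (ltW x1)) shrink_form_disk.
  - by move=> x x1; rewrite (shrinkE _ r001 (ltW x1)) shrink_form_disk.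
  - by apply: filterE => t; exact: disk_part_axis.
  - exact: disk_part_axis.
have J := jconv_dilate oU (@odisk_dilate R n) rr r01 r001 (hh (inr (i, 0))) (aform_jets_ueq h0 _).
move=> m; apply: (jc_eq oU _ _ (J FF m)).
- by apply: filterS r01 => t rt x x1; rewrite (shrinkE _ rt (ltW x1)).
- by move=> x x1; rewrite (shrinkE _ r001 (ltW x1)).
Qed.

End ShrinkingFamily.

(** * Straightening the core rotation *)

Section PeriodicFamilies.
Variable R : realType.
Variables (T : Type) (F : set_system T).
Context {FF : Filter F}.
Local Notation p2 := (pi *+ 2 : R).

Lemma ucvg_cvg (X : Type) (U : set X) (f : T -> X -> R) f0 x : ucvg F U f f0 -> U x ->
  f t x @[t --> F] --> f0 x.
Proof.
move=> ff Ux; apply/cvgrPdist_le => eps e0; apply: filterS (ff _ e0) => t ft.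
by rewrite distrC; exact: ft.
Qed.

Lemma jconv_periodic (f : R -> R) : Csmooth [set: R] f -> (forall t, f (t + p2) = f t) ->
  jconv F [set: R] (fun=> f) f.
Proof.
move=> fC fp; apply: jconvP => //; first exact: filterE.
  move=> s eps e0; apply: filterE => t x _; by rewrite subrr normr0 ltW.
exact: periodic_ubnd.
Qed.

(** By the mean value theorem over one period, starting at 0 where all the functions vanish, the
    distance of the functions is at most 2 pi times that of their derivatives. *)
Lemma jconv_antiderivative (p : T -> R -> R) p0 :
  (forall t, Csmooth [set: R] (p t)) -> Csmooth [set: R] p0 ->
  (forall t u, p t (u + p2) = p t u) -> (forall u, p0 (u + p2) = p0 u) ->
  (forall t, p t 0 = 0) -> p0 0 = 0 ->
  jconv F [set: R] (fun t => 'D_1 (p t)) ('D_1 p0) -> jconv F [set: R] p p0.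
Proof.
move=> pC p0C pp p0p pz p0z dp.
have pd (q : R -> R) : Csmooth [set: R] q -> forall u : R, derivable q u 1.
  by move=> qC u; apply/diff_derivable/(Csmooth_derivable qC).
have base : [/\ Csmooth [set: R] p0, \forall t \near F, Csmooth [set: R] (p t),
    ucvg F [set: R] p p0 & ubnd [set: R] p0].
  split=> //; first exact: filterE; last exact: (periodic_ubnd p0C p0p [::]).
  apply: (@ucvg_le _ _ _ _ _ _ _ _ p2) => eps e0.
  have [_ _ /(_ _ e0) H _] := jc0W (dp 0%N).
  apply: filterS H => t H x _.
  pose d u := p t u - p0 u.
  have dper u : d (u + p2) = d u by rewrite /d pp p0p.
  have [x' [k [/andP[x0 x1] ->]]] := period_reduce x.
  rewrite -[_ - _]/(d _) (periodic_int dper).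
  have dd (u : R) : derivable d u 1.
    by apply: derivableB; exact: pd.
  have [|u _] := @line_mvt R R d 0 1 x'.
    by move=> u _; exact: dd.
  rewrite add0r [_ *: _]mulr1 [d 0]/d pz p0z !subr0 => ->.
  rewrite normrM ger0_norm//.
  apply: ler_pM => //; first exact: ltW.
  by rewrite deriveB; [exact: H|exact: pd|exact: pd].
case=> [|k]; first by case: base.
split; try by case: base.
move=> v; apply: (@jc_eq _ _ _ _ _ _ openT _ (fun t x => v * 'D_1 (p t) x) _ (fun x => v * 'D_1 p0 x)).
- by apply: filterE => t x _; have [_ ->] := derive_1d v (pd _ (pC t) x).
- by move=> x _; have [_ ->] := derive_1d v (pd _ p0C x).
- apply: jcM; [exact: openT|apply: jc_num; exact: cvg_cst|exact: dp].
Qed.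

End PeriodicFamilies.

Section LinearConvergence.
Variables (R : realType) (n : nat).
Local Notation E := ('cV[R]_n * R)%type.
Local Notation enorm := (@Defs.enorm R _).
Local Notation odisk := (@odisk R n).
Local Notation aform := (@angle_form R n).
Variables (T : Type) (F : set_system T).
Context {FF : Filter F}.

(** For maps linear in the disk direction only functions of the angle have to converge; the disk
    coordinates enter as fixed linear functions, bounded on the disk. *)
Lemma cvg_linear_diffeo (H : T -> leaf_diffeo R n) (H0 : leaf_diffeo R n) (A : T -> R -> 'M[R]_n) A0
    (b : T -> R -> 'cV[R]_2) b0 :
  (\forall t \near F, forall x, enorm x.1 <= 1 -> aform (H t) x = (A t x.2 *m x.1, b t x.2)) ->
  (forall x, enorm x.1 <= 1 -> aform H0 x = (A0 x.2 *m x.1, b0 x.2)) ->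
  (forall i j, jconv F [set: R] (fun t u => A t u i j) (fun u => A0 u i j)) ->
  (forall i, jconv F [set: R] (fun t u => b t u i 0) (fun u => b0 u i 0)) ->
  H @ F --> H0.
Proof.
move=> HE H0E AA bb; apply/cvg_diffeoP => j.
have oU := @open_odisk R n.
have sc : continuous (snd : {linear E -> R}) by move=> x; exact: cvg_snd.
case: j => [[i k]|[i k]]; rewrite [k]ord1 => m.
  apply: (@jc_eq _ _ _ _ _ _ oU _ (fun t x => \sum_l A t x.2 i l * x.1 l 0) _
     (fun x => \sum_l A0 x.2 i l * x.1 l 0)).
  - by apply: filterS HE => t Ht x x1; rewrite (Ht _ (ltW x1)) /= mxE.
  - by move=> x x1; rewrite (H0E _ (ltW x1)) /= mxE.
  - apply: jc_sum => // l; apply: jcM => //.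
      have J := @jconv_comp_linear R T F FF R E setT odisk snd _ _ sc (fun _ _ => I) (AA i l).
      exact: J.
    have J : jconv F odisk (fun=> (@mx_coord R n 1 (l, 0) \o fst : {linear E -> R}))
        (@mx_coord R n 1 (l, 0) \o fst : {linear E -> R}).
      apply: jconv_linear => //; last exact: odisk_bounded.
      by move=> x; apply: continuous_comp; [exact: cvg_fst|exact: coord_continuous].
    exact: (J m).
apply: (@jc_eq _ _ _ _ _ _ oU _ (fun t x => b t x.2 i 0) _ (fun x => b0 x.2 i 0)).
- by apply: filterS HE => t Ht x x1; rewrite (Ht _ (ltW x1)).
- by move=> x x1; rewrite (H0E _ (ltW x1)).
have J := @jconv_comp_linear R T F FF R E setT odisk snd _ _ sc (fun _ _ => I) (bb i).
exact: J.
Qed.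

End LinearConvergence.

(** * The lift of the core map and its deformation to an affine one *)

Section Straightening.
Variables (R : realType) (n : nat).
Local Notation E := ('cV[R]_n * R)%type.
Local Notation enorm := (@Defs.enorm R _).
Local Notation odisk := (@odisk R n).
Local Notation aform := (@angle_form R n).
Local Notation p2 := (pi *+ 2 : R).
Implicit Types h : leaf_diffeo R n.

(** The lift is picked by choice, with no continuity in [h]. Convergence is therefore stated for
    [circle_part], [core_speed], [core_degree] and [core_deviation] instead. *)
Definition core_angle h : R -> R := projT1 (cid (core_lift h)).
Definition core_degree h : R := projT1 (cid (projT2 (cid (core_lift h)))).

Lemma core_angleP h : let L := core_angle h in let e := core_degree h in
  [/\ Csmooth [set: R] L, e = 1 \/ e = -1,
  forall t, 0 < e * 'D_1 L t, forall t, L (t + p2) = L t + e * p2 &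
  forall t, (aform h (0, t)).2 = angle_pt R (L t)].
Proof. exact: (projT2 (cid (projT2 (cid (core_lift h))))). Qed.

(** The periodic part p of the lift; subtracting the value at 0 removes the dependence on which lift
    was picked. *)
Definition core_deviation h (t : R) : R :=
  core_angle h t - core_angle h 0 - core_degree h * t.

(** The angular speed x y' - y x' of the core map. It is the derivative of every smooth lift, yet it
    is written from [h] alone, so its convergence is immediate. *)
Definition core_speed h (t : R) : R :=
  circle_part h 0 (0, t) * 'D_1 (fun u => circle_part h 1 (0, u)) t -
  circle_part h 1 (0, t) * 'D_1 (fun u => circle_part h 0 (0, u)) t.

Lemma core_speedE h (L : R -> R) : Csmooth [set: R] L ->
  (forall t, (aform h (0, t)).2 = angle_pt R (L t)) -> forall t, 'D_1 L t = core_speed h t.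
Proof.
move=> LC hL t.
have b0 : (fun u => circle_part h 0 (0, u)) = cos \o L.
  by apply/funext => u; rewrite /circle_part /= hL mxE.
have b1 : (fun u => circle_part h 1 (0, u)) = sin \o L.
  by apply/funext => u; rewrite /circle_part /= hL mxE.
have Ld := Csmooth_is_derive t LC.
have cd : is_derive t 1 (cos \o L) (- sin (L t) * 'D_1 L t).
  exact: (is_derive1_comp (is_derive_cos (L t)) Ld).
have sd : is_derive t 1 (sin \o L) (cos (L t) * 'D_1 L t).
  exact: (is_derive1_comp (is_derive_sin (L t)) Ld).
rewrite /core_speed b0 b1 (@derive_val _ _ _ _ _ _ _ cd) (@derive_val _ _ _ _ _ _ _ sd).
rewrite (congr1 (@^~ t) b0) (congr1 (@^~ t) b1) /=.
transitivity ((cos (L t) ^+ 2 + sin (L t) ^+ 2) * 'D_1 L t); last by ring.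
by rewrite cos2Dsin2 mul1r.
Qed.

Lemma core_speed_sign h t : 0 < core_degree h * core_speed h t.
Proof. by have [LC _ Lp _ hL] := core_angleP h; rewrite -(core_speedE LC hL). Qed.

Lemma core_deviationP h : [/\ Csmooth [set: R] (core_deviation h),
  forall t, core_deviation h (t + p2) = core_deviation h t, core_deviation h 0 = 0 &
  forall t : R, is_derive t 1 (core_deviation h) (core_speed h t - core_degree h)].
Proof.
have [LC e1 Lp Lper hL] := core_angleP h.
have D (t : R) : is_derive t 1 (core_deviation h) (core_speed h t - core_degree h).
  have d1 := Csmooth_is_derive t LC; rewrite (core_speedE LC hL) in d1.
  have d2 := is_derive_cst (core_angle h 0) t 1.
  have d3 := is_deriveZ (core_degree h) (is_derive_id t (1 : R)).
  have := is_deriveB (is_deriveB d1 d2) d3.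
  by rewrite subr0 [_ *: _]mulr1.
split => //.
- apply: (Csmooth_primitive D).
  have DC : Csmooth [set: R] ('D_1 (core_angle h)) by exact: CsmoothD.
  move=> k; apply: CkD; [exact: openT| |exact: (Csmooth_cst [set: R] (- core_degree h))].
  by apply: (Ck_eq openT _ (DC k)) => t _; exact: core_speedE.
- by move=> t; rewrite /core_deviation Lper; ring.
- by rewrite /core_deviation mulr0 subr0 subrr.
Qed.

Definition straight_angle h (s t : R) : R :=
  core_angle h 0 + core_degree h * t + s * core_deviation h t.

Lemma straight_angle_data h s : linear_data (core_mx h) (straight_angle h s) (core_degree h).
Proof.
have [pC pp _ _] := core_deviationP h.
split; [exact: core_mx_Csmooth|exact: core_mx_periodic|exact: core_mx_orthogonal| |].
  move=> k; apply: CkD; first exact: openT.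
    apply: CkD; [exact: openT|exact: Csmooth_cst|].
    apply: CkM; [exact: openT|exact: Csmooth_cst|].
    by apply: (@Ck_linear _ k _ setT (idfun : {linear R -> R})) => x; exact: cvg_id.
  apply: CkM; [exact: openT|exact: Csmooth_cst|exact: pC].
by move=> t; rewrite /straight_angle pp; ring.
Qed.

(** With w the core speed, the product is (1 - s) e^2 + s e w, where e^2 = 1 and e w > 0: a convex
    combination of positive numbers. *)
Lemma straight_angle_pos h s t : 0 <= s <= 1 ->
  0 < core_degree h * 'D_1 (straight_angle h s) t.
Proof.
move=> /andP[s0 s1]; have [_ _ _ pd] := core_deviationP h; have [_ e1 _ _ _] := core_angleP h.
have d2 := is_derive_cst (core_angle h 0) t 1.
have d3 := is_deriveZ (core_degree h) (is_derive_id t (1 : R)).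
have D := is_deriveD (is_deriveD d2 d3) (is_deriveZ s (pd t)).
rewrite (_ : 'D_1 _ t = core_degree h + s * (core_speed h t - core_degree h)); last first.
  by rewrite (@derive_val _ _ _ _ _ _ _ D) add0r [_ *: 1]mulr1.
rewrite (_ : _ * _ = (1 - s) * (core_degree h * core_degree h) + s * (core_degree h * core_speed h t)); last by ring.
have ee := sign_sqr e1; have w0 := core_speed_sign h t; rewrite ee mulr1.
have [->|s0'] := eqVneq s 0; first by rewrite mul0r addr0 subr0.
apply: ltr_wpDl; first by rewrite subr_ge0.
by rewrite mulr_gt0// lt_neqAle eq_sym s0'.
Qed.

Definition straighten h (s : R) : leaf_diffeo R n := xget h
  [set k | forall x, enorm x.1 <= 1 -> aform k x = linear_form (core_mx h) (straight_angle h s) x].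

Lemma straightenE h s x : 0 <= s <= 1 -> enorm x.1 <= 1 ->
  aform (straighten h s) x = linear_form (core_mx h) (straight_angle h s) x.
Proof.
move=> s01 x1; have [_ e1 _ _ _] := core_angleP h.
have [k kE] := linear_diffeo e1 (straight_angle_data h s) (fun t => straight_angle_pos h t s01).
by rewrite /straighten; case: xgetP => [k' _|/(_ k)]; [apply|].
Qed.

(** At s = 1 the angle is the lift itself, so the two families meet here; this is the joint of the
    final homotopy. *)
Lemma straighten1 h : straighten h 1 = shrink h 0.
Proof.
have [_ _ _ _ hL] := core_angleP h.
apply: diffeo_ext => x x1; rewrite straightenE ?ler01 ?lexx// shrinkE ?ler01 ?lexx//.
congr pair.
  by apply/matrixP => i j; rewrite [j]ord1 !mxE dquot0E mxE.
rewrite /= scale0r hL; congr (angle_pt R).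
by rewrite /straight_angle /core_deviation; ring.
Qed.

Section convergence.
Variables (T : Type) (F : set_system T).
Context {FF : Filter F}.
Variables (h : T -> leaf_diffeo R n) (h0 : leaf_diffeo R n).
Hypothesis hh : h @ F --> h0.

Lemma jconv_circle_axis i : jconv F [set: R] (fun t u => circle_part (h t) i (0, u))
  (fun u => circle_part h0 i (0, u)).
Proof.
have /cvg_diffeoP/(_ (inr (i, 0))) H := hh.
have J := @jconv_comp_linear R T F FF E R odisk setT (axis 'cV[R]_n) _ _
  (@axis_continuous R _) (fun t _ => odisk_axis n t) H.
exact: J.
Qed.

Lemma jconv_core_mx i j : jconv F [set: R] (fun t u => core_mx (h t) u i j)
  (fun u => core_mx h0 u i j).
Proof.
have /cvg_diffeoP/(_ (inl (i, 0))) H := hh.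
have J := @jconv_comp_linear R T F FF E R odisk setT (axis 'cV[R]_n) _ _
  (@axis_continuous R _) (fun t _ => odisk_axis n t) (jconv_derive (delta_mx j 0, 0) H).
move=> k; apply: (jc_eq openT _ _ (J k)).
  by apply: filterE => t x _; rewrite /= mxE.
by move=> x _; rewrite /= mxE.
Qed.

Lemma jconv_core_speed : jconv F [set: R] (fun t => core_speed (h t)) (core_speed h0).
Proof.
move=> k; have J i := @jconv_circle_axis i; have oT := @openT R.
have D i := jconv_derive (1 : R) (J i).
by apply: (jc_eq oT _ _ (jcD oT (jcM oT (J 0 k) (D 1 k))
  (jcM oT (jc_num [set: R] k (cvg_cst (-1 : R))) (jcM oT (J 1 k) (D 0 k))))) => [|x _]; [apply: filterE => t x _|]; rewrite mulN1r.
Qed.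

(** The degree is the sign of the core speed at angle 0, and this speed has a nonzero limit. *)
Lemma near_core_degree : \forall t \near F, core_degree (h t) = core_degree h0.
Proof.
have [_ _ U _] := jc0W (jconv_core_speed 0%N).
have C := @ucvg_cvg _ _ _ FF _ _ _ _ (0 : R) U I.
have [_ e1 _ _ _] := core_angleP h0; have w0 := core_speed_sign h0 0.
have C' : core_degree h0 * core_speed (h t) 0 @[t --> F] --> core_degree h0 * core_speed h0 0.
  by apply: cvgM => //; exact: cvg_cst.
have N : \forall t \near F, 0 < core_degree h0 * core_speed (h t) 0.
  exact: (C' _ (lt_nbhsr w0)).
apply: filterS N => t wt; have wt' := core_speed_sign (h t) 0.
have [_ e1' _ _ _] := core_angleP (h t).
by case: e1 wt => ->; case: e1' wt' => ->; rewrite ?mul1r ?mulN1r ?oppr_gt0// => h1 h2;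
  have := lt_trans h1 h2; rewrite ltxx.
Qed.

Lemma cvg_core_degree : core_degree (h t) @[t --> F] --> core_degree h0.
Proof. by apply: cvg_near_cst; exact: near_core_degree. Qed.

(** The derivative is the core speed minus the degree, both of which converge; being periodic and
    zero at angle 0, the deviations can be recovered by integration. *)
Lemma jconv_core_deviation :
  jconv F [set: R] (fun t => core_deviation (h t)) (core_deviation h0).
Proof.
have dv k (t : R) : 'D_1 (core_deviation k) t = core_speed k t - core_degree k.
  by have [_ _ _ D] := core_deviationP k; exact: (@derive_val _ _ _ _ _ _ _ (D t)).
apply: jconv_antiderivative.
- by move=> t; have [] := core_deviationP (h t).
- by have [] := core_deviationP h0.
- by move=> t; have [] := core_deviationP (h t).
- by have [] := core_deviationP h0.
- by move=> t; have [] := core_deviationP (h t).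
- by have [] := core_deviationP h0.
move=> k; have oT := @openT R.
by apply: (jc_eq oT _ _ (jcD oT (jconv_core_speed k) (jc_num [set: R] k (cvgN cvg_core_degree)))) => [|x _]; [apply: filterE => t x _|]; rewrite dv.
Qed.

(** The affine part L(0) + e t is outside the reach of [jconv_cos_sin]: it is unbounded and L(0) is
    a choice. Its cos and sin are expanded ([sg]) in the core point at angle 0, e, cos t and sin t,
    all of which converge. Only the periodic part s p goes through [jconv_cos_sin], and the addition
    formulas recombine the two. *)
Lemma cvg_straighten (s : T -> R) (s0 : R) : s @ F --> s0 ->
  (\forall t \near F, 0 <= s t <= 1) -> 0 <= s0 <= 1 ->
  (fun t => straighten (h t) (s t)) @ F --> straighten h0 s0.
Proof.
move=> ss s01 s001; have oT := @openT R.
have [Cc Cs] := @Csmooth_cos_sin R setT oT.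
have Jc k : jc F [set: R] k (fun=> @cos R) (@cos R).
  by apply: jconv_periodic => // t; rewrite cosD2pi.
have Js k : jc F [set: R] k (fun=> @sin R) (@sin R).
  by apply: jconv_periodic => // t; rewrite sinD2pi.
have N i k : jc F [set: R] k (fun t _ => circle_part (h t) i (0, 0)) (fun=> circle_part h0 i (0, 0)).
  apply: jc_num => //; have [_ _ U _] := jc0W (jconv_circle_axis i 0%N).
  exact: (@ucvg_cvg _ _ _ FF _ _ _ _ (0 : R) U I).
have Ne k : jc F [set: R] k (fun t _ => core_degree (h t)) (fun=> core_degree h0).
  by apply: jc_num => //; exact: cvg_core_degree.
have Nm k : jc F [set: R] k (fun _ _ => -1) (fun=> -1).
  by apply: jc_num => //; exact: cvg_cst.
have sg k t : cos (core_angle k 0 + core_degree k * t) =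
    circle_part k 0 (0, 0) * cos t + -1 * (circle_part k 1 (0, 0) * (core_degree k * sin t)) /\
    sin (core_angle k 0 + core_degree k * t) =
    circle_part k 1 (0, 0) * cos t + circle_part k 0 (0, 0) * (core_degree k * sin t).
  have [_ e1 _ _ kL] := core_angleP k.
  have -> : circle_part k 0 (0, 0) = cos (core_angle k 0) by rewrite /circle_part /= kL mxE.
  have -> : circle_part k 1 (0, 0) = sin (core_angle k 0) by rewrite /circle_part /= kL mxE.
  rewrite cosD sinD.
  have [-> ->] : cos (core_degree k * t) = cos t /\ sin (core_degree k * t) = core_degree k * sin t.
    by case: e1 => ->; rewrite ?mul1r// !mulN1r cosN sinN.
  by split; ring.
have Ac : jconv F [set: R] (fun t u => cos (core_angle (h t) 0 + core_degree (h t) * u))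
    (fun u => cos (core_angle h0 0 + core_degree h0 * u)).
  move=> k; by apply: (jc_eq oT _ _ (jcD oT (jcM oT (N 0 k) (Jc k))
    (jcM oT (Nm k) (jcM oT (N 1 k) (jcM oT (Ne k) (Js k)))))) => [|x _]; [apply: filterE => t x _|]; rewrite (sg _ x).1.
have As : jconv F [set: R] (fun t u => sin (core_angle (h t) 0 + core_degree (h t) * u))
    (fun u => sin (core_angle h0 0 + core_degree h0 * u)).
  move=> k; by apply: (jc_eq oT _ _ (jcD oT (jcM oT (N 1 k) (Jc k)) (jcM oT (N 0 k) (jcM oT (Ne k) (Js k))))) => [|x _]; [apply: filterE => t x _|]; rewrite (sg _ x).2.
have P : jconv F [set: R] (fun t u => s t * core_deviation (h t) u)
    (fun u => s0 * core_deviation h0 u).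
  by move=> k; apply: jcM => //; [exact: jc_num|exact: jconv_core_deviation].
have [Pc Ps] := jconv_cos_sin oT P.
apply: (@cvg_linear_diffeo R n T F FF _ _ (fun t => core_mx (h t)) (core_mx h0)
  (fun t u => angle_pt R (straight_angle (h t) (s t) u))
  (fun u => angle_pt R (straight_angle h0 s0 u))).
- by apply: filterS s01 => t st x x1; rewrite straightenE.
- by move=> x x1; rewrite straightenE.
- exact: jconv_core_mx.
move=> i k; case: (eqVneq i 0) => [->|i0].
  apply: (jc_eq oT _ _ (jcD oT (jcM oT (Ac k) (Pc k)) (jcM oT (Nm k) (jcM oT (As k) (Ps k))))) => [|x _].
    by apply: filterE => t x _; rewrite angle_ptE /= [RHS]cosD mulN1r.
  by rewrite angle_ptE /= [RHS]cosD mulN1r.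
by apply: (jc_eq oT _ _ (jcD oT (jcM oT (As k) (Pc k)) (jcM oT (Ac k) (Ps k)))) => [|x _]; [apply: filterE => t x _|];
  rewrite angle_ptE (negbTE i0) [RHS]sinD.
Qed.

End convergence.
End Straightening.

(** * Loops and orthogonal matrices *)

Section ParametrizedLoops.
Variables (R : realType) (n : nat).
Local Notation E := ('cV[R]_n * R)%type.
Local Notation enorm := (@Defs.enorm R _).
Local Notation aform := (@angle_form R n).
Local Notation p2 := (pi *+ 2 : R).
Implicit Types h : leaf_diffeo R n.

Lemma continuous_bigprod (T : topologicalType) I (r : seq I) (f : I -> T -> R) :
  (forall i, continuous (f i)) -> continuous (fun t => \prod_(i <- r) f i t).
Proof.
move=> fc; elim: r => [|i r IH].
  by under eq_fun do rewrite big_nil; move=> t; exact: cvg_cst.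
under eq_fun do rewrite big_cons; move=> t; apply: cvgM; [exact: fc|exact: IH].
Qed.

Lemma cvg_mx_entries m p (T : Type) (F : set_system T) {FF : Filter F} (M : T -> 'M[R]_(m, p))
    (M0 : 'M[R]_(m, p)) :
  (forall i j, M t i j @[t --> F] --> M0 i j) -> M @ F --> M0.
Proof.
move=> MM; have D (N : 'M[R]_(m, p)) : N = \sum_ij N ij.1 ij.2 *: delta_mx ij.1 ij.2.
  by rewrite [LHS]matrix_sum_delta pair_bigA.
rewrite (D M0) (_ : M = fun t => \sum_ij M t ij.1 ij.2 *: delta_mx ij.1 ij.2).
  by apply: cvg_bigsum => ij; apply: cvgZr_tmp; exact: MM.
by apply/funext => t; exact: D.
Qed.

Lemma cvg_set_type (V : topologicalType) (S : set V) (T : Type) (F : set_system T) {FF : Filter F}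
  (H : T -> S) (x : S) : set_val (H t) @[t --> F] --> set_val x -> H @ F --> x.
Proof. by move=> Hx; apply: (@cvg_to_initial _ _ _ (set_val : S -> V)). Qed.

Lemma cvg_set_val (V : topologicalType) (S : set V) (T : Type) (F : set_system T) {FF : Filter F}
  (H : T -> S) (x : S) : H @ F --> x -> set_val (H t) @[t --> F] --> set_val x.
Proof. by move=> Hx; apply: (cvg_comp _ _ Hx); exact: (@initial_continuous _ _ (set_val : S -> V) x). Qed.

Lemma cvg_orthogonal_entry m (T : Type) (F : set_system T) {FF : Filter F}
    (H : T -> orthogonal_group R m) (x : orthogonal_group R m) i j :
  H @ F --> x -> set_val (H t) i j @[t --> F] --> set_val x i j.
Proof. move=> /cvg_set_val Hx.
exact: (@cvg_comp _ _ _ _ (fun M : 'M[R]_m => M i j) _ _ _ Hx (@coord_continuous _ _ _ i j (set_val x))). Qed.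

Lemma mk_loop (M : R -> 'M[R]_n) : (forall i j, Csmooth [set: R] (fun t => M t i j)) ->
  (forall t, M (t + p2) = M t) -> (forall t, special_orthogonal_group R n (M t)) ->
  M 0 = 1%:M -> exists Phi : smooth_loop R n, forall t, loop_form Phi t = M t.
Proof.
move=> MC Mp MS M0.
have Mper t u : angle_pt R t = angle_pt R u -> M t = M u.
  by move=> /angle_pt_eq[k ->]; rewrite (periodic_int Mp).
pose f (y : circle R) : special_orthogonal_group R n := SigSub (mem_set (MS (arg (set_val y)))).
have fE t : set_val (f (angle R t)) = M t.
  by apply: Mper; rewrite argK//; exact: circle_angle_pt.
have fS : smooth (set_val \o f).
  by apply: (circle_smooth (@coordinates_mx R n n) fE) => -[i j]; exact: MC.
have f0 : set_val (f (angle R 0)) = 1%:M by rewrite fE M0.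
by exists (SmoothLoop R n f fS f0).
Qed.

Lemma loop_ext (Phi Psi : smooth_loop R n) :
  (forall t, loop_form Phi t = loop_form Psi t) -> Phi = Psi.
Proof.
case: Phi Psi => [f fS f0] [g gS g0] fg.
have {fg} fg : f = g.
  apply/funext => y; apply: val_inj; have [t yt] := circle_angle_pt_ex (set_valP y).
  have -> : y = angle R t by apply: val_inj.
  exact: fg.
by case: _ / fg in gS g0 *; congr SmoothLoop; exact: Prop_irrelevance.
Qed.

Lemma loop_form_orthogonal (Phi : smooth_loop R n) t :
  (loop_form Phi t)^T *m loop_form Phi t = 1%:M.
Proof. by have [] := set_valP (Phi (angle R t)). Qed.

Lemma loop_form0 (Phi : smooth_loop R n) : loop_form Phi 0 = 1%:M.
Proof. exact: loop_base. Qed.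

(** [b] is the angle of the first column and [e] the determinant; the second column is e times the
    first one turned by a quarter. So B is a rotation or a reflection according to e. *)
Lemma orthogonal2_angle (B : 'M[R]_2) : B^T *m B = 1%:M -> exists b e,
  [/\ e = 1 \/ e = -1, forall t, B *m angle_pt R t = angle_pt R (b + e * t),
   B 0 1 = - (e * B 1 0) & B 1 1 = e * B 0 0].
Proof.
move=> /matrixP BB.
have sum2 (f : 'I_2 -> R) : \sum_i f i = f 0 + f 1.
  by rewrite big_ord_recl big_ord1; congr (_ + f _); apply: val_inj.
have := BB 0 0; have := BB 0 1; have := BB 1 1; rewrite !mxE !sum2 !mxE /=.
set a := B 0 0; set c := B 1 0; set b := B 0 1; set d := B 1 1 => bd ab ac.
have ac1 : circle R (\col_i B i 0) by apply/circleE; rewrite !mxE -/a -/c !expr2.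
have [be /matrixP bE] := circle_angle_pt_ex ac1.
have aE : a = cos be by have := bE 0 0; rewrite !mxE.
have cE : c = sin be by have := bE 1 0; rewrite !mxE.
pose e := a * d - c * b.
have e1 : e = 1 \/ e = -1.
  have : e ^+ 2 = 1.
    transitivity ((a * a + c * c) * (b * b + d * d) - (a * b + c * d) ^+ 2); first by rewrite /e; ring.
    by rewrite bd ab ac; ring.
  by move/eqP; rewrite sqrf_eq1 => /orP[]/eqP ->; [left|right].
have bE' : b = - (e * c).
  apply/eqP; rewrite -subr_eq0; apply/eqP.
  transitivity (b * (1 - (a * a + c * c)) + a * (a * b + c * d)); first by rewrite /e; ring.
  by rewrite ac ab; ring.
have dE : d = e * a.
  apply/eqP; rewrite -subr_eq0; apply/eqP.
  transitivity (d * (1 - (a * a + c * c)) + c * (a * b + c * d)); first by rewrite /e; ring.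
  by rewrite ac ab; ring.
exists be, e; split => // t.
have [ce se] : cos (e * t) = cos t /\ sin (e * t) = e * sin t.
  by case: e1 => ->; rewrite ?mul1r// !mulN1r cosN sinN.
apply/matrixP => i j; rewrite [j]ord1 mxE sum2 !angle_ptE /=.
case: i => [[|[|//]] i2].
  have -> : Ordinal i2 = 0 by apply: val_inj.
  by rewrite eqxx -/a -/b bE' aE cE cosD ce se; ring.
have -> : Ordinal i2 = 1 by apply: val_inj.
by rewrite /= -/c -/d dE aE cE sinD ce se; ring.
Qed.

(** For a map already linear in the disk direction, the difference quotient at the core is constant
    for small steps. *)
Lemma core_mx_linear h (M : R -> 'M[R]_n) (b : R -> 'cV[R]_2) :
  (forall x, enorm x.1 <= 1 -> aform h x = (M x.2 *m x.1, b x.2)) ->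
  forall t, core_mx h t = M t.
Proof.
move=> hE t; apply/matrixP => i j; rewrite mxE.
set v : E := (delta_mx j 0, 0); set x : E := (0, t).
have f0 : disk_part h i x = 0 by exact: disk_part_axis (odisk_axis n t).
apply: cvg_lim => //; apply: cvg_near_cst.
have ev : enorm (delta_mx j 0 : 'cV[R]_n) <= 1.
  rewrite -(@expr_le1 _ 2)// ?enorm_ge0// enorm_sqr (bigD1 j)//= big1 => [|k kj].
    by rewrite !mxE !eqxx addr0 expr1n.
  by rewrite !mxE (negbTE kj) expr0n.
(* The bound |s| < 1 keeps s times the basis vector in the closed disk, where the formula for [h]
   holds. *)
have N : \forall s \near (0 : R)^', s != 0 /\ `|s| < 1.
  near=> s; split; first by near: s; exact: nbhs_dnbhs_neq.
  by near: s; apply: dnbhs0_lt.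
apply: filterS N => s [s0 s1].
have fs : disk_part h i (s *: v + x) = s * M t i j.
  have sx : enorm (s *: v + x).1 <= 1.
    by rewrite /= addr0 enormZ mulr_ile1// ?enorm_ge0// ltW.
  rewrite /disk_part hE//= addr0 scaler0 add0r -scalemxAr -colE.
  by rewrite [LHS]mxE mxE.
by rewrite /= fs f0 subr0 [_ *: _]mulrA mulVf// mul1r.
Unshelve. all: by end_near. Qed.

End ParametrizedLoops.

(** * The homotopy equivalence *)

Section Retraction.
Variables (R : realType) (n : nat).
Local Notation E := ('cV[R]_n * R)%type.
Local Notation enorm := (@Defs.enorm R _).
Local Notation aform := (@angle_form R n).
Local Notation p2 := (pi *+ 2 : R).
Local Notation params := (smooth_loop R n * orthogonal_group R n * orthogonal_group R 2)%type.
Implicit Types h : leaf_diffeo R n.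

Definition params_form (p : params) (x : E) :=
  (loop_form p.1.1 x.2 *m set_val p.1.2 *m x.1, set_val p.2 *m angle_pt R x.2).

Lemma affine_lift (b e : R) : e = 1 \/ e = -1 ->
  [/\ Csmooth [set: R] (fun t : R => b + e * t),
   forall t : R, is_derive t 1 (fun t : R => b + e * t) e &
   forall t : R, 0 < e * 'D_1 (fun t : R => b + e * t) t].
Proof.
move=> e1; have D (t : R) : is_derive t 1 (fun t : R => b + e * t) e.
  have := is_deriveD (is_derive_cst b t (1 : R)) (is_deriveZ e (is_derive_id t (1 : R))).
  by rewrite add0r [_ *: _]mulr1.
split=> //; first by apply: (Csmooth_primitive D); exact: Csmooth_cst.
by move=> t; rewrite (@derive_val _ _ _ _ _ _ _ (D t)) sign_sqr.
Qed.

(** An orthogonal B acts on angles as t -> b + e t, so the map has the form treated by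
    [linear_diffeo], with an affine lift. *)
Lemma params_diffeo_ex (p : params) : exists k : leaf_diffeo R n,
  forall x, enorm x.1 <= 1 -> aform k x = params_form p x.
Proof.
have AO := set_valP p.1.2; have [b [e [e1 BE _ _]]] := orthogonal2_angle (set_valP p.2).
have [LC _ Lpos] := affine_lift b e1.
have ld : linear_data (fun t => loop_form p.1.1 t *m set_val p.1.2) (fun t => b + e * t) e.
  split => //.
  - move=> i j; have S l : Csmooth [set: R] (fun t => loop_form p.1.1 t i l * set_val p.1.2 l j).
      by move=> k; apply: CkM; [exact: openT|exact: loop_form_Csmooth|exact: Csmooth_cst].
    move=> k; apply: (@Ck_eq _ k _ setT (fun t : R => \sum_l loop_form p.1.1 t i l * set_val p.1.2 l j)).
    + exact: openT.
    + by move=> t _; rewrite mxE.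
    + by apply: Ck_sum; [exact: openT|move=> l; exact: S].
  - by move=> t; rewrite loop_form_periodic.
  - by move=> t; rewrite trmx_mul mulmxA -[X in X *m _]mulmxA loop_form_orthogonal mulmx1.
  - by move=> t; ring.
have [k kE] := linear_diffeo e1 ld Lpos.
by exists k => x x1; rewrite kE// /linear_form -BE.
Qed.

Definition eta (p : params) : leaf_diffeo R n := projT1 (cid (params_diffeo_ex p)).

Lemma etaE p x : enorm x.1 <= 1 -> aform (eta p) x = params_form p x.
Proof. exact: (projT2 (cid (params_diffeo_ex p))). Qed.

Lemma eta_val (Phi : smooth_loop R n) (A : orthogonal_group R n) (B : orthogonal_group R 2)
    (v : disk R n) (y : circle R) : set_val (eta (Phi, A, B) (sigT_of_setX _ _ (v, y))) =
  (set_val (Phi y) *m (set_val A *m set_val v), set_val B *m set_val y).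
Proof.
have [t yt] := circle_angle_pt_ex (set_valP y).
have v1 : enorm (set_val v, t).1 <= 1 by exact: (set_valP v).
have yE : y = angle R t by apply: val_inj.
have -> : sigT_of_setX _ _ (v, y) = torus_elt v1.
  by apply: val_inj; rewrite /= /torus_pt /= yt.
by rewrite -angle_formE etaE// /params_form /loop_form /= -yE -yt mulmxA.
Qed.

Lemma jc_mulmx (T : Type) (F : set_system T) {FF : Filter F} k m p q
    (M : T -> R -> 'M[R]_(m, p)) (M0 : R -> 'M[R]_(m, p))
    (N : T -> R -> 'M[R]_(p, q)) (N0 : R -> 'M[R]_(p, q)) i j :
  (forall l, jc F [set: R] k (fun t u => M t u i l) (fun u => M0 u i l)) ->
  (forall l, jc F [set: R] k (fun t u => N t u l j) (fun u => N0 u l j)) ->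
  jc F [set: R] k (fun t u => (M t u *m N t u) i j) (fun u => (M0 u *m N0 u) i j).
Proof.
move=> MM NN; have oT := @openT R.
apply: (@jc_eq _ _ _ _ _ _ oT k (fun t u => \sum_l M t u i l * N t u l j) _
  (fun u => \sum_l M0 u i l * N0 u l j)).
- by apply: filterE => t u _; rewrite mxE.
- by move=> u _; rewrite mxE.
- by apply: jc_sum => // l; exact: jcM.
Qed.

Lemma eta_continuous : continuous eta.
Proof.
move=> p; have c1 : (fun q : params => q.1.1) @ nbhs p --> p.1.1.
  by apply: (cvg_comp fst fst); exact: cvg_fst.
have c2 : (fun q : params => q.1.2) @ nbhs p --> p.1.2.
  by apply: (cvg_comp fst snd); [exact: cvg_fst|exact: cvg_snd].
have c3 : (fun q : params => q.2) @ nbhs p --> p.2 by exact: cvg_snd.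
apply: (@cvg_linear_diffeo R n _ _ _ _ _
  (fun q t => loop_form q.1.1 t *m set_val q.1.2) (fun t => loop_form p.1.1 t *m set_val p.1.2)
  (fun q t => set_val q.2 *m angle_pt R t) (fun t => set_val p.2 *m angle_pt R t)).
- by apply: filterE => q x x1; rewrite etaE.
- by move=> x x1; rewrite etaE.
- move=> i j k; apply: jc_mulmx => l.
    by have /cvg_loopP := c1; apply.
  by apply: jc_num; exact: cvg_orthogonal_entry.
- move=> i k; apply: jc_mulmx => l.
    by apply: jc_num; exact: cvg_orthogonal_entry.
  have per t : angle_pt R (t + p2) l 0 = angle_pt R t l 0.
    by have := angle_pt_periodic 1 t; rewrite mulr1z => ->.
  exact: (@jconv_periodic R _ _ (nbhs_filter p) (fun u => angle_pt R u l 0)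
    (@angle_pt_smooth R (l, 0)) per k).
Qed.

(** Orthogonality makes the determinant square to 1, continuity in [t] fixes its sign, and its value
    at 0 is 1. *)
Lemma core_loop_det h t : \det (core_mx h t *m (core_mx h 0)^T) = 1.
Proof.
pose f u := \det (core_mx h u *m (core_mx h 0)^T).
have O u : (core_mx h u *m (core_mx h 0)^T)^T *m (core_mx h u *m (core_mx h 0)^T) = 1%:M.
  rewrite trmx_mul trmxK mulmxA -[X in X *m _]mulmxA core_mx_orthogonal mulmx1.
  by apply: mulmx1C; exact: core_mx_orthogonal.
have f2 u : f u * f u = 1 by have /(congr1 determinant) := O u; rewrite det_mulmx det_tr det1.
have ec i j : continuous (fun u => (core_mx h u *m (core_mx h 0)^T) i j).
  move=> u; rewrite (_ : (fun v => _) = fun v => \sum_l core_mx h v i l * (core_mx h 0)^T l j).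
    apply: cvg_bigsum => l; apply: cvgM; last exact: cvg_cst.
    exact: (Csmooth_continuous (@core_mx_Csmooth R n h i l)).
  by apply/funext => v; rewrite mxE.
have fc : continuous f.
  rewrite /f /determinant => u; apply: cvg_bigsum => s; apply: cvgM; first exact: cvg_cst.
  by apply: (@continuous_bigprod R) => i; exact: ec.
have [u|e e1 fe] := nonzero_sign fc.
  by apply/eqP => fu; have := f2 u; rewrite fu mul0r => /eqP; rewrite eq_sym oner_eq0.
have f0 : f 0 = 1.
  by rewrite /f (mulmx1C (core_mx_orthogonal h 0)) det1.
have e0 := fe 0; rewrite f0 mulr1 in e0.
have ft : 0 < f t.
  by have := fe t; case: e1 e0 => ->; rewrite ?mul1r// oppr_gt0 ltr10.
rewrite -/(f t); move: (f t) ft (f2 t) => y y0; rewrite -expr2 => /eqP.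
by rewrite sqrf_eq1 => /orP[/eqP//|/eqP y1]; move: y0; rewrite y1 oppr_gt0 ltr10.
Qed.

Lemma core_loop_ex h : exists Phi : smooth_loop R n,
  forall t, loop_form Phi t = core_mx h t *m (core_mx h 0)^T.
Proof.
apply: mk_loop.
- move=> i j k; apply: (@Ck_eq _ k _ setT (fun t : R => \sum_l core_mx h t i l * (core_mx h 0)^T l j)).
  + exact: openT.
  + by move=> t _; rewrite mxE.
  + apply: Ck_sum; first exact: openT.
    by move=> l; apply: CkM; [exact: openT|exact: core_mx_Csmooth|exact: Csmooth_cst].
- by move=> t; rewrite core_mx_periodic.
- move=> t; split; last exact: core_loop_det.
  rewrite /orthogonal_group /= trmx_mul trmxK mulmxA -[X in X *m _]mulmxA core_mx_orthogonal mulmx1.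
  by apply: mulmx1C; exact: core_mx_orthogonal.
- by apply: mulmx1C; exact: core_mx_orthogonal.
Qed.

Definition core_loop h : smooth_loop R n := projT1 (cid (core_loop_ex h)).

Lemma core_loopE h t : loop_form (core_loop h) t = core_mx h t *m (core_mx h 0)^T.
Proof. exact: (projT2 (cid (core_loop_ex h))). Qed.

Definition core_start h : orthogonal_group R n := SigSub (mem_set (core_mx_orthogonal h 0)).

(** The isometry of angle L(0) + e t. Its first column is the core image of angle 0 and its second
    is e times that column turned by a quarter; written this way it avoids L(0), and its continuity
    reduces to that of [circle_part] and [core_degree]. *)
Definition core_frame_mx h : 'M[R]_2 := \matrix_(i, j)
  if j == 0 then circle_part h i (0, 0)
  else core_degree h * (if i == 0 then - circle_part h 1 (0, 0) else circle_part h 0 (0, 0)).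

Lemma core_frame_angle h t :
  core_frame_mx h *m angle_pt R t = angle_pt R (core_angle h 0 + core_degree h * t).
Proof.
have [_ e1 _ _ hL] := core_angleP h.
have [ce se] : cos (core_degree h * t) = cos t /\ sin (core_degree h * t) = core_degree h * sin t.
  by case: e1 => ->; rewrite ?mul1r// !mulN1r cosN sinN.
apply/matrixP => i j; rewrite [j]ord1 mxE big_ord_recl big_ord1 !mxE /= /circle_part /= hL !mxE /=.
by case: (i == 0); rewrite ?cosD ?sinD ce se; ring.
Qed.

Lemma core_frame_orthogonal h : orthogonal_group R 2 (core_frame_mx h).
Proof.
have [_ e1 _ _ hL] := core_angleP h; have ee := sign_sqr e1.
have cs := cos2Dsin2 (core_angle h 0).
apply/matrixP => i j; rewrite mxE big_ord_recl big_ord1 !mxE /= /circle_part /= hL !mxE /=.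
case: (ord2_cases i) => ->; case: (ord2_cases j) => -> /=.
- by rewrite -[RHS]cs; ring.
- by ring.
- by ring.
- transitivity (core_degree h * core_degree h * (cos (core_angle h 0) ^+ 2 + sin (core_angle h 0) ^+ 2)).
    by ring.
  by rewrite ee cs mulr1.
Qed.

Definition core_frame h : orthogonal_group R 2 := SigSub (mem_set (core_frame_orthogonal h)).

Definition core_params h : params := (core_loop h, core_start h, core_frame h).

Lemma core_params_continuous : continuous core_params.
Proof.
move=> h; have hh : (fun k : leaf_diffeo R n => k) @ nbhs h --> h by exact: cvg_id.
have hF := nbhs_filter h; have J := @jconv_core_mx R n _ _ hF _ _ hh.
have cA i j : core_mx k 0 i j @[k --> nbhs h] --> core_mx h 0 i j.
  by have [_ _ U _] := jc0W (J i j 0%N); exact: (@ucvg_cvg _ _ _ hF _ _ _ _ (0 : R) U I).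
have cb i : circle_part k i (0, 0) @[k --> nbhs h] --> circle_part h i (0, 0).
  by have [_ _ U _] := jc0W (@jconv_circle_axis R n _ _ hF _ _ hh i 0%N); exact: (@ucvg_cvg _ _ _ hF _ _ _ _ (0 : R) U I).
have ce := @cvg_core_degree R n _ _ hF _ _ hh.
have c1 : core_loop k @[k --> nbhs h] --> core_loop h.
  apply/cvg_loopP => i j m.
  apply: (@jc_eq _ _ _ _ _ _ (@openT R) m (fun k t => (core_mx k t *m (core_mx k 0)^T) i j) _
    (fun t => (core_mx h t *m (core_mx h 0)^T) i j)).
  - by apply: filterE => k t _; rewrite core_loopE.
  - by move=> t _; rewrite core_loopE.
  apply: jc_mulmx => l; first exact: J.
  have N := @jc_num _ _ _ (nbhs_filter h) R setT m _ _ (cA j l).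
  apply: (jc_eq (@openT R) _ _ N) => [|t _]; last by rewrite [RHS]mxE.
  by apply: filterE => k t _; rewrite [RHS]mxE.
have c2 : core_start k @[k --> nbhs h] --> core_start h.
  by apply: cvg_set_type; apply: cvg_mx_entries => i j; exact: cA.
have c3 : core_frame k @[k --> nbhs h] --> core_frame h.
  apply: cvg_set_type; apply: cvg_mx_entries => i j.
  rewrite (_ : (fun k => _) = fun k => if j == 0 then circle_part k i (0, 0)
    else core_degree k * (if i == 0 then - circle_part k 1 (0, 0) else circle_part k 0 (0, 0))).
    rewrite (_ : set_val (core_frame h) i j = core_frame_mx h i j)// mxE; case: (j == 0); first exact: cb.
    by apply: cvgM => //; case: (i == 0); [apply: cvgN|]; exact: cb.
  by apply/funext => k; rewrite /= mxE.
exact: (cvg_pair (cvg_pair c1 c2) c3).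
Qed.

Lemma core_params_eta p : core_params (eta p) = p.
Proof.
case: p => -[Phi A] B; set k := eta (Phi, A, B).
have kE := @etaE (Phi, A, B); rewrite -/k in kE.
have MA t : core_mx k t = loop_form Phi t *m set_val A.
  exact: (@core_mx_linear R n k (fun t => loop_form Phi t *m set_val A)
    (fun t => set_val B *m angle_pt R t) kE t).
(* Loops are based at the identity, so [A] is read off at angle 0 and [Phi] is what remains. *)
have MA0 : core_mx k 0 = set_val A by rewrite MA loop_form0 mul1mx.
congr (_, _, _).
- apply: loop_ext => t; rewrite core_loopE MA MA0 -mulmxA.
  by rewrite (mulmx1C (set_valP A)) mulmx1.
- by apply: val_inj.
- apply: val_inj => /=.
  have [b [e [e1 BE B01 B11]]] := orthogonal2_angle (set_valP B).
  have [LC Ld _] := affine_lift b e1.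
  have kL t : (aform k (0, t)).2 = angle_pt R (b + e * t).
    by rewrite kE ?enorm0 ?ler01//= BE.
  (* The lift b + e t has derivative e, so e is the core speed; its product with [core_degree k] is
     positive, and both are 1 or -1. *)
  have de : core_degree k = e.
    have := core_speed_sign k 0; rewrite -(core_speedE LC kL) (@derive_val _ _ _ _ _ _ _ (Ld 0)).
    have [_ e1' _ _ _] := core_angleP k.
    by case: e1 => ->; case: e1' => ->; rewrite ?mulr1 ?mulN1r ?mulrN1 ?opprK// oppr_gt0 ltr10.
  have kb i : circle_part k i (0, 0) = set_val B i 0.
    rewrite /circle_part /= kE ?enorm0 ?ler01//= mxE big_ord_recl big_ord1 !mxE /=.
    by rewrite cos0 sin0 mulr1 mulr0 addr0.
  apply/matrixP => i j; rewrite mxE !kb de.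
  case: (ord2_cases j) => ->; first by [].
  by case: (ord2_cases i) => -> /=; rewrite ?B01 ?B11// mulrN.
Qed.

(** The factor A(0)^T of the loop cancels against A(0), and at s = 0 only the affine part of the
    lift is left. *)
Lemma eta_core_params h : eta (core_params h) = straighten h 0.
Proof.
apply: diffeo_ext => x x1; rewrite etaE// straightenE ?ler01 ?lexx//.
rewrite /params_form /linear_form /= core_loopE core_frame_angle.
rewrite -[X in X *m x.1]mulmxA core_mx_orthogonal mulmx1; congr (_, angle_pt R _).
by rewrite /straight_angle mul0r addr0.
Qed.

(** The two families run at double speed, each with its parameter going from 0 to 1, from
    [eta (core_params h)] through the map linear in the disk direction up to [h]. *)
Definition contraction (q : leaf_diffeo R n * R) : leaf_diffeo R n :=
  if q.2 <= 2^-1 then straighten q.1 (2 * q.2) else shrink q.1 (2 * q.2 - 1).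

Lemma contraction_continuous :
  {within [set: leaf_diffeo R n] `*` `[0, 1], continuous contraction}.
Proof.
pose S (a b : R) : set (leaf_diffeo R n * R) := [set: leaf_diffeo R n] `*` `[a, b].
have S0 (a b : R) : closed (S a b).
  have -> : S a b = snd @^-1` `[a, b] by apply/seteqP; split=> [q []|q] //.
  have /continuous_closedP : continuous (snd : leaf_diffeo R n * R -> R).
    by move=> q; exact: cvg_snd.
  by apply; exact: interval_closed.
have -> : [set: leaf_diffeo R n] `*` `[0, 1] = S 0 2^-1 `|` S 2^-1 1.
  apply/seteqP; split=> [[h t]|[h t]] /=; rewrite /S /= !in_itv /=.
    by move=> [_ /andP[t0 t1]]; case: (leP t 2^-1) => ht; [left|right]; rewrite ?t0 ?t1 ?(ltW ht).
  by move=> [[_ /andP[t0 t1]]|[_ /andP[t0 t1]]]; split=> //; apply/andP; split; lra.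
have c1 (q : leaf_diffeo R n * R) (A : set (leaf_diffeo R n * R)) : (fun q => q.1) @ within A (nbhs q) --> q.1.
  by apply: cvg_within_filter; exact: cvg_fst.
have c2 (q : leaf_diffeo R n * R) (A : set (leaf_diffeo R n * R)) : (fun q => q.2) @ within A (nbhs q) --> q.2.
  by apply: cvg_within_filter; exact: cvg_snd.
(* Continuity is checked on two closed pieces; at the common time 1/2 the two formulas agree by
   [straighten1]. *)
apply: withinU_continuous => //.
- apply: (@subspace_eq_continuous _ (S 0 2^-1) _
    (fun q : leaf_diffeo R n * R => straighten q.1 (2 * q.2)) contraction).
    move=> [h t]; rewrite inE /S /= in_itv /= => -[_ /andP[t0 t1]].
    by rewrite /contraction /= t1.
  apply/subspace_continuousP => -[h t] /=; rewrite /S /= in_itv /= => -[_ /andP[t0 t1]].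
  apply: cvg_straighten; first exact: c1.
  + by apply: cvgM; [exact: cvg_cst|exact: c2].
  + apply: filterS (withinT _ _) => -[k u] /=; rewrite in_itv /= => -[_ /andP[u0 u1]].
    by apply/andP; split; lra.
  + by apply/andP; split; rewrite /=; lra.
- apply: (@subspace_eq_continuous _ (S 2^-1 1) _
    (fun q : leaf_diffeo R n * R => shrink q.1 (2 * q.2 - 1)) contraction).
    move=> [h t]; rewrite inE /S /= in_itv /= => -[_ /andP[t0 t1]].
    rewrite /contraction /=; case: leP => // ht.
    have -> : t = 2^-1 by apply/eqP; rewrite eq_le ht t0.
    by rewrite divff ?pnatr_eq0// subrr straighten1.
  apply/subspace_continuousP => -[h t] /=; rewrite /S /= in_itv /= => -[_ /andP[t0 t1]].
  apply: cvg_shrink; first exact: c1.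
  + by apply: cvgB; [apply: cvgM; [exact: cvg_cst|exact: c2]|exact: cvg_cst].
  + apply: filterS (withinT _ _) => -[k u] /=; rewrite in_itv /= => -[_ /andP[u0 u1]].
    by apply/andP; split; lra.
  + by apply/andP; split; rewrite /=; lra.
Qed.

Lemma homotopic_eq (X Y : topologicalType) (f g : X -> Y) : continuous f -> f =1 g ->
  homotopic R f g.
Proof.
move=> fc fg; exists (fun q => f q.1); split => //.
by apply: continuous_subspaceT => q; apply: (cvg_comp _ _ cvg_fst); exact: fc.
Qed.

(** [core_params] is an exact left inverse of [eta], so only the other composite needs the
    nontrivial homotopy [contraction]. *)
Lemma eta_homotopy_equivalence : homotopy_equivalence R eta.
Proof.
split; first exact: eta_continuous.
exists core_params; split; first exact: core_params_continuous.
- apply: homotopic_eq => [p|p]; last exact: core_params_eta.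
  by apply: continuous_comp; [exact: eta_continuous|exact: core_params_continuous].
- exists contraction; split; first exact: contraction_continuous.
  + move=> h; rewrite /contraction /= invr_ge0 ler0n mulr0; exact: esym (eta_core_params h).
  + move=> h; rewrite /contraction /= leNgt invf_lt1 ?ltr0n// ltr1n /=.
    have -> : 2 * 1 - 1 = (1 : R) by ring.
    exact: shrink1.
Qed.

End Retraction.

Theorem theorem1p1p1 (R : realType) (n : nat) (hn : (2 <= n)%N) :
  exists eta : smooth_loop R n * orthogonal_group R n * orthogonal_group R 2
               -> leaf_diffeo R n,
    (forall (Phi : smooth_loop R n) (A : orthogonal_group R n) (B : orthogonal_group R 2)
            (v : disk R n) (y : circle R),
       set_val (eta (Phi, A, B) (sigT_of_setX _ _ (v, y))) =
         (set_val (Phi y) *m (set_val A *m set_val v), set_val B *m set_val y))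
    /\ homotopy_equivalence R eta.
Proof. by exists (@eta R n); split; [exact: eta_val|exact: eta_homotopy_equivalence]. Qed.
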